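(* Let $m,k\in\mathbb N$. There exists a constant $C(m,k)>0$, depending only on $m$ and $k$, such that, for every $n,d\in\mathbb N$ and every $f\in\mathcal P_d(\mathbb R^n)$, one has \[ \|\nabla f\|_{L^{2k}(\nu_m^n)}\le C(m,k)\,d^{1-\frac1{2m}}\,\|f\|_{L^{2k}(\nu_m^n)}. \]
   Context: $\mathbb N=\{1,2,\dots\}$. $\mathcal P_d(\mathbb R^n)$ is the space of all real algebraic polynomials in $n$ variables of (total) degree at most $d$. $\nu_m$ is the probability measure on $\mathbb R$ given by $\nu_m(dt)=c_me^{-|t|^{2m}}\,dt$, where $c_m$ is the normalizing constant, and $\nu_m^n$ is its $n$-fold product on $\mathbb R^n$. $\|\nabla f\|_{L^{2k}(\nu_m^n)}$ is the $L^{2k}(\nu_m^n)$ norm of the Euclidean length $|\nabla f|$. *)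

(* Defs.v *)
From HB Require Import structures.
From mathcomp Require Import all_boot all_order all_algebra.
(* Some notations of mpoly clash with those of mathcomp-analysis. *)
From mathcomp Require Import -(notations) mpoly.
From mathcomp Require Import all_classical all_reals all_analysis.
From mathcomp Require Import measurable_realfun.
From mathcomp Require Import lra.

Set Implicit Arguments.
Unset Strict Implicit.
Unset Printing Implicit Defensive.
Import Order.TTheory GRing.Theory Num.Theory.
Import numFieldNormedType.Exports.

Local Open Scope classical_set_scope.
Local Open Scope ring_scope.

Definition tuple_cons (T : Type) (n : nat) (x : T * n.-tuple T) :
  n.+1.-tuple T := [the n.+1.-tuple T of x.1 :: x.2].

Lemma measurable_tuple_cons d (T : measurableType d) n :
  measurable_fun [set: T * n.-tuple T] (@tuple_cons T n).
Proof. exact: measurable_cons. Qed.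

Lemma measurable_tuple_box d (T : measurableType d) n (A : 'I_n -> set T) :
  (forall i, measurable (A i)) ->
  measurable [set x : n.-tuple T | forall i, A i (tnth x i)].
Proof.
move=> mA.
rewrite (_ : [set _ | _] = \bigcap_(i in [set: 'I_n])
    ((fun x : n.-tuple T => tnth x i) @^-1` A i)).
  apply: fin_bigcap_measurable => // i _.
  by rewrite -[X in measurable X]setTI; exact: measurable_tnth.
by apply/seteqP; split => x /= Ax i; [move=> _|]; exact: Ax.
Qed.

Section cons_measure.
Context d (T : measurableType d) (R : realType) (n : nat).
Variables (mu : {finite_measure set T -> \bar R})
  (nu : {finite_measure set (n.-tuple T) -> \bar R}).
Local Open Scope ereal_scope.

Definition cons_measure : set (n.+1.-tuple T) -> \bar R :=
  pushforward (mu \x nu) (@tuple_cons T n).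

Let mcons (A : set (n.+1.-tuple T)) :
  measurable A -> measurable (@tuple_cons T n @^-1` A).
Proof.
by move=> mA; rewrite -[X in measurable X]setTI; exact: measurable_tuple_cons.
Qed.

Let cons_measure0 : cons_measure set0 = 0.
Proof. by rewrite /cons_measure /pushforward preimage_set0 measure0. Qed.

Let cons_measure_ge0 A : 0 <= cons_measure A.
Proof. by rewrite /cons_measure /pushforward; exact: (measure_ge0 (mu \x nu)). Qed.

Let cons_measure_sigma_additive : semi_sigma_additive cons_measure.
Proof.
move=> F mF tF mUF; rewrite /cons_measure /pushforward preimage_bigcup.
apply: measure_semi_sigma_additive => [i||].
- exact: mcons.
- apply/trivIsetP => /= i j _ _ ij; rewrite -preimage_setI.
  by move/trivIsetP : tF => /(_ _ _ _ _ ij) ->//; rewrite preimage_set0.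
- by rewrite -preimage_bigcup; exact: mcons.
Qed.

HB.instance Definition _ := isMeasure.Build _ _ _ cons_measure
  cons_measure0 cons_measure_ge0 cons_measure_sigma_additive.

Let cons_measure_fin : cons_measure setT < +oo.
Proof.
rewrite /cons_measure /pushforward preimage_setT -setXTT product_measure1E//.
by rewrite ltey_eq fin_numM// fin_num_measure.
Qed.

HB.instance Definition _ := Measure_isFinite.Build _ _ _ cons_measure
  (lty_fin_num_fun cons_measure_fin).
End cons_measure.

Fixpoint power_measure d (T : measurableType d) (R : realType)
    (mu : {finite_measure set T -> \bar R}) (n : nat) :
    {finite_measure set (n.-tuple T) -> \bar R} :=
  if n is n'.+1 then cons_measure mu (power_measure mu n')
  else \d_([tuple] : 0.-tuple T).

Lemma power_measure_box d (T : measurableType d) (R : realType)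
    (mu : {finite_measure set T -> \bar R}) (n : nat) (A : 'I_n -> set T) :
  (forall i, measurable (A i)) ->
  power_measure mu n [set x | forall i, A i (tnth x i)] =
  (\prod_(i < n) mu (A i))%E.
Proof.
elim: n A => [|n IHn] A mA /=.
  rewrite big_ord0 (_ : [set _ | _] = setT) ?diracT//.
  by apply/seteqP; split => // x _ [].
have mB := measurable_tuple_box (fun i => mA (lift ord0 i)).
rewrite big_ord_recl -IHn// -product_measure1E//.
rewrite /cons_measure /pushforward; congr (product_measure1 _ _ _).
apply/seteqP; split => -[x y] /= Axy.
  split; first by have := Axy ord0; rewrite tnth0.
  by move=> i; have := Axy (lift ord0 i); rewrite tnthS.
move=> i; case: (unliftP ord0 i) => [j|] ->.
  by rewrite tnthS; exact: Axy.2.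
by rewrite tnth0; exact: Axy.1.
Qed.

Section freud_measure.
Context (R : realType) (m : nat).
Local Notation mu := (@lebesgue_measure R).

Definition freud_weight (t : R) : R := expR (- `|t| ^+ (2 * m)).

Definition freud_const : R := (fine (\int[mu]_t (freud_weight t)%:E)%E)^-1.

Definition freud_measure (V : set R) : \bar R :=
  (\int[mu]_(t in V) (freud_const * freud_weight t)%:E)%E.

Lemma measurable_freud_weight : measurable_fun [set: R] freud_weight.
Proof.
apply: measurableT_comp => //; apply: measurableT_comp => //.
by apply: measurable_funX; exact: normr_measurable.
Qed.

Lemma freud_const_ge0 : 0 <= freud_const.
Proof.
rewrite invr_ge0 fine_ge0// integral_ge0// => t _.
by rewrite lee_fin expR_ge0.
Qed.

Let freud_density_ge0 (t : R) : (0 <= (freud_const * freud_weight t)%:E)%E.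
Proof. by rewrite lee_fin mulr_ge0 ?expR_ge0 ?freud_const_ge0. Qed.

Let freud0 : freud_measure set0 = 0%E.
Proof. by rewrite /freud_measure integral_set0. Qed.

Let freud_ge0 A : (0 <= freud_measure A)%E.
Proof. exact: integral_ge0. Qed.

Let freud_sigma_additive : semi_sigma_additive freud_measure.
Proof.
apply: (@semi_sigma_additive_nng_induced _ _ _ mu
  (fun t => (freud_const * freud_weight t)%:E)) => //.
apply/measurable_EFinP; apply: measurable_funM => //.
exact: measurable_freud_weight.
Qed.

HB.instance Definition _ := isMeasure.Build _ _ _ freud_measure
  freud0 freud_ge0 freud_sigma_additive.

Let freud_setTE : freud_measure setT =
  (freud_const%:E * \int[mu]_t (freud_weight t)%:E)%E.
Proof.
rewrite /freud_measure; under eq_integral do rewrite EFinM.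
rewrite ge0_integralZl//.
- by apply/measurable_EFinP; exact: measurable_freud_weight.
- by move=> t _; rewrite lee_fin expR_ge0.
- by rewrite lee_fin freud_const_ge0.
Qed.

Let freud_fin : (freud_measure setT < +oo)%E.
Proof.
rewrite freud_setTE /freud_const.
set I := (\int[mu]_t _)%E.
have : (0 <= I)%E by apply: integral_ge0 => t _; rewrite lee_fin expR_ge0.
by case: I => [r||]//= _; rewrite ?ltry// invr0 mul0e ltry.
Qed.

HB.instance Definition _ := Measure_isFinite.Build _ _ _ freud_measure
  (lty_fin_num_fun freud_fin).

Lemma integral_freud_weight_lty : (0 < m)%N ->
  (\int[mu]_t (freud_weight t)%:E < +oo)%E.
Proof.
move=> m0; apply: (@le_lt_trans _ _
    (\int[mu]_t ((expR 1)%:E * (gauss_fun t)%:E))%E).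
  apply: ge0_le_integral => //.
  - by move=> t _; rewrite lee_fin expR_ge0.
  - by apply/measurable_EFinP; exact: measurable_freud_weight.
  - apply/measurable_EFinP; apply: measurable_funM => //.
    exact: measurable_gauss_fun.
  move=> t _; rewrite -EFinM lee_fin /freud_weight /gauss_fun -expRD ler_expR.
  rewrite -(real_normK (num_real t)) exprM.
  have [t1|t1] := leP (`|t| ^+ 2) 1.
    by have := exprn_ge0 m (sqr_ge0 `|t|); lra.
  by have := ler_eXnr m0 (ltW t1); lra.
rewrite ge0_integralZl//.
- by rewrite integralT_gauss ltry.
- by apply/measurable_EFinP; exact: measurable_gauss_fun.
- by move=> t _; rewrite lee_fin gauss_fun_ge0.
Qed.

Lemma integral_freud_weight_gt0 : (0 < \int[mu]_t (freud_weight t)%:E)%E.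
Proof.
apply: (@lt_le_trans _ _ (\int[mu]_(t in `[0%R, 1%R]) (cst (expR (-1))%:E) t)%E).
  by rewrite integral_cst//= lebesgue_measure_itv/= lte01 oppr0 adde0 mule1
    lte_fin expR_gt0.
apply: (@le_trans _ _ (\int[mu]_(t in `[0%R, 1%R]) (freud_weight t)%:E)%E).
  apply: ge0_le_integral => //.
  - by move=> t _; rewrite lee_fin expR_ge0.
  - apply: measurable_funTS; apply/measurable_EFinP.
    exact: measurable_freud_weight.
  move=> t /=; rewrite in_itv/= => /andP[t0 t1].
  by rewrite lee_fin ler_expR lerN2 exprn_ile1// ger0_norm.
apply: ge0_subset_integral => //.
- by apply/measurable_EFinP; exact: measurable_freud_weight.
- by move=> t _; rewrite lee_fin expR_ge0.
Qed.

(* For m = 0 the integral is infinite, so that freud_const = 0. *)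
Lemma freud_measure_setT : (0 < m)%N -> freud_measure setT = 1%E.
Proof.
move=> /integral_freud_weight_lty; rewrite freud_setTE /freud_const.
move: integral_freud_weight_gt0.
case: (\int[mu]_t _)%E => [r||]//=; rewrite lte_fin => r0 _.
by rewrite -EFinM mulVf// gt_eqF.
Qed.

End freud_measure.
Arguments freud_weight {R} m t.
Arguments freud_const : clear implicits.
Arguments freud_measure : clear implicits.

Section polynomials.
Context (R : realType) (n : nat).
Implicit Types (f : mpoly.mpoly n R) (x : n.-tuple R).

Definition poly_fun f x : R := mpoly.meval (tnth x) f.

Definition grad_length f x : R :=
  Num.sqrt (\sum_(i < n) poly_fun (mpoly.mderiv i f) x ^+ 2).

(* msize is 1 + the total degree for f != 0, and 0 for f = 0. *)
Definition degree_le (d : nat) f : bool := (mpoly.msize f <= d.+1)%N.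

End polynomials.

(* Main.v *)
From HB Require Import structures.
Require Import Defs.
From mathcomp Require Import all_boot all_order all_algebra.
(* The notations of mpoly and of complex clash with those of the analysis files. *)
From mathcomp Require Import -(notations) mpoly.
From mathcomp Require Import all_classical all_reals all_analysis.
From mathcomp Require Import measurable_realfun.
From mathcomp Require Import lra ring.
From mathcomp Require Import -(notations) complex.
From mathcomp Require Import cyclic separable cyclotomic.
Set Implicit Arguments.
Unset Strict Implicit.
Unset Printing Implicit Defensive.
Import Order.TTheory GRing.Theory Num.Theory.
Import numFieldNormedType.Exports.
Local Open Scope classical_set_scope.
Local Open Scope ring_scope.

(** Put W(t) = t^(2m), so that nu_m has density proportional to exp(-W), and
    double the variables: to the positions x_1, ..., x_n add independent momenta
    y_1, ..., y_n of the same law.  The derivation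

      D = sum_i (W'(y_i) d/dx_i - W'(x_i) d/dy_i)

    generates the Hamiltonian flow of the energy sum_i (W(x_i) + W(y_i)), which
    preserves the product measure.  If f depends on the positions only, then
    D f = sum_i W'(y_i) d_i f is the velocity of f along the flow.  Averaging over
    the momenta, Jensen's inequality bounds c^k E |grad f|^(2k) by
    E (D f)^(2k), with c = E W'' > 0 ([mean_grad_pow_le]).  It remains to prove a
    Bernstein inequality for the single operator D, with constants that do not
    depend on the number of variables.

    In L^2: D = U - U* with U = sum_i (d/dy_i)* d/dx_i.  The matrix of d/dx in the
    basis of orthonormal polynomials of nu_m is banded, of bandwidth 2m, and its
    entries at level a are O(a^(1-1/(2m))); hence, for g of degree at most d <= L,
    the square norm of g' is at most C d L^(1-1/m) times that of g
    ([deriv_comb_le]).  This is linear in d, and the degrees in the various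
    variables add up, so that the estimate tensorizes without loss ([grad_le]).
    Consequently the square norm of D^j f is at most (B N^2)^j (j!)^2 times that of
    f, with N = L^(1-1/(2m)), as long as the degrees that occur stay below L
    ([iter_flow_le]).

    From L^2 to L^(2k): consider the Taylor polynomial Q(z) = sum_(j <= d) z^j D^j f / j!
    of f along the flow.  By the Leibniz rule the coefficient of z^l in Q^k
    is D^l (f^k) / l! for l <= d, and its L^2 norm is controlled by that of f^k,
    that is, by the L^(2k) norm of f.  The coefficients with l > d are sums of
    products of k polynomials of degree O(d); estimating them by the moment
    comparison E g^4 <= C^(deg g) (E g^2)^2 ([mean_fourth_le]) costs a factor
    C^d <= C^l, which is harmless ([mean_jetX_le]).  Finally D f is the coefficient of
    z in Q, and |q_1|^(2k) <= sum_l |[Q^k]_l|^2 for every polynomial Q, by Parseval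
    on a circle ([coef1_pow_le]).  On a circle of squared radius proportional to N^(-2)
    the right-hand side is a convergent geometric series, whence
    E (D f)^(2k) <= C N^(2k) E f^(2k) ([mean_flow_pow_le]).

    The measure enters only through a linear form M on polynomials of one variable
    that is normalized, positive and satisfies M(p') = M(W' p)
    ([freud_functional]), and through its tensor powers ([product_mean]). *)

(** * Moments of the one-dimensional measure *)

Section density.
Context d (T : measurableType d) (R : realType).
Variables (mu : {sigma_finite_measure set T -> \bar R}) (g : T -> R).
Hypotheses (g0 : forall t, 0 <= g t) (intg : mu.-integrable setT (EFin \o g)).
Local Open Scope ereal_scope.

(** The two proofs are arguments so that the measure structure can be attached to
    the constant. *)
Definition density_measure (_ : mu.-integrable setT (EFin \o g))
  (_ : forall t, (0 <= g t)%R) (A : set T) : \bar R := \int[mu]_(t in A) (g t)%:E.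
Local Notation nu := (density_measure intg g0).

Let nu0 : nu set0 = 0. Proof. exact: integral_set0. Qed.

Let nu_ge0 A : 0 <= nu A.
Proof. by apply: integral_ge0 => t _; rewrite lee_fin. Qed.

Let nu_additive : semi_sigma_additive nu.
Proof.
apply: (@semi_sigma_additive_nng_induced _ _ _ mu (EFin \o g)).
  exact: measurable_int intg.
by move=> t; rewrite lee_fin.
Qed.

HB.instance Definition _ := isMeasure.Build _ _ _ nu nu0 nu_ge0 nu_additive.

Let nu_fin : nu setT < +oo.
Proof.
have /integrableP[_] := intg.
by under eq_integral do rewrite /= ger0_norm//.
Qed.

HB.instance Definition _ := Measure_isFinite.Build _ _ _ nu (lty_fin_num_fun nu_fin).

Lemma density_measure_dominated : nu `<< mu.
Proof.
apply/null_content_dominatesP => A mA A0; apply: null_set_integral => //.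
by apply: measurable_funTS; exact: measurable_int intg.
Qed.

(** The density agrees almost everywhere with the Radon-Nikodym derivative, because
    both have the same integral over every measurable set. *)
Lemma ge0_integral_density (f : T -> \bar R) : (forall t, 0 <= f t) ->
  measurable_fun setT f -> \int[nu]_t f t = \int[mu]_t (f t * (g t)%:E).
Proof.
move=> f0 mf; have dom := density_measure_dominated.
have mg := measurable_int _ intg.
have mRN := measurable_int _ (Radon_Nikodym_SigmaFinite.f_integrable dom).
rewrite -(Radon_Nikodym_SigmaFinite.change_of_variables dom f0)//.
apply: ae_eq_integral => //; [exact: emeasurable_funM..|].
apply: ae_eqe_mul2l; apply: ae_eq_sym; apply: integral_ae_eq => // A _ mA.
by rewrite -Radon_Nikodym_SigmaFinite.f_integral.
Qed.

End density.

Section freud_moments.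
Context (R : realType) (m : nat).
Local Notation mu := (@lebesgue_measure R).
Local Notation nu := (freud_measure R m).
Local Notation w := (@freud_weight R m).

Definition freud_density (t : R) : R := freud_const R m * w t.

Lemma freud_density_ge0 t : 0 <= freud_density t.
Proof. by rewrite mulr_ge0 ?expR_ge0 ?freud_const_ge0. Qed.

Lemma measurable_freud_density : measurable_fun [set: R] freud_density.
Proof. by apply: measurable_funM => //; exact: measurable_freud_weight. Qed.

Lemma integrable_freud_density : mu.-integrable setT (EFin \o freud_density).
Proof.
apply/integrableP; split; first by apply/measurable_EFinP; exact: measurable_freud_density.
under eq_integral do rewrite /= ger0_norm ?freud_density_ge0//.
have : nu setT \is a fin_num by exact: fin_num_measure.
by rewrite ge0_fin_numE.
Qed.

Lemma measurable_mul_freud_density (f : R -> \bar R) : measurable_fun setT f ->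
  measurable_fun setT (fun t => f t * (freud_density t)%:E)%E.
Proof.
move=> mf; apply: emeasurable_funM => //.
by apply/measurable_EFinP; exact: measurable_freud_density.
Qed.

(** The Freud measure lives on the real line with its Borel structure, Lebesgue
    measure on a copy of it; the identity map transports one to the other. *)
Lemma integral_freud_ge0 (f : R -> \bar R) : (forall t, 0 <= f t)%E ->
  measurable_fun setT f ->
  (\int[nu]_t f t = \int[mu]_t (f t * (freud_density t)%:E))%E.
Proof.
move=> f0 mf.
pose idR : measurableTypeR R -> R := idfun.
have midR : measurable_fun setT idR by move=> _ B mB; rewrite setTI.
rewrite (eq_measure_integral
    (pushforward (density_measure integrable_freud_density freud_density_ge0) idR)) => //.
rewrite ge0_integral_pushforward// preimage_setT.
rewrite ge0_integral_density//; exact: (measurableT_comp mf midR).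
Qed.

Lemma integral_freud (f : R -> \bar R) : nu.-integrable setT f ->
  (\int[nu]_t f t = \int[mu]_t (f t * (freud_density t)%:E))%E.
Proof.
move=> intf; have mf := measurable_int _ intf.
have mfp : measurable_fun setT f^\+%E by exact: measurable_funepos.
have mfn : measurable_fun setT f^\-%E by exact: measurable_funeneg.
have g0 t : (0 <= (freud_density t)%:E)%E by rewrite lee_fin freud_density_ge0.
have ip h : measurable_fun setT h -> (forall t, 0 <= h t)%E ->
    nu.-integrable setT h ->
    mu.-integrable setT (fun t => h t * (freud_density t)%:E)%E.
  move=> mh h0 /integrableP[_ ih]; apply/integrableP; split.
    exact: measurable_mul_freud_density.
  under eq_integral do rewrite gee0_abs ?mule_ge0//.
  rewrite -integral_freud_ge0//; apply: le_lt_trans ih.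
  by apply: ge0_le_integral => //; [exact: measurableT_comp|move=> t _; rewrite gee0_abs].
rewrite integralE !integral_freud_ge0//.
rewrite -integralB//; last 2 first.
- by apply: ip => //; exact: integrable_funepos.
- by apply: ip => //; exact: integrable_funeneg.
apply: eq_integral => t _; rewrite -muleBl//.
  by rewrite [in RHS](funeposneg f).
exact: add_def_funeposneg.
Qed.

Hypothesis m0 : (0 < m)%N.

(** Since t^2 <= 1 + t^(2m), the weight is at most e * exp(-t^2), and half of this
    Gaussian absorbs the power. *)
Lemma pow_freud_weight_le (j : nat) :
  exists C : R, 0 <= C /\ forall t, `|t| ^+ j * w t <= C * expR (- (t ^+ 2 / 2)).
Proof.
exists (expR 1 * (2 ^+ j.+1 * (j.+1)`!%:R)); split.
  by rewrite !mulr_ge0 ?expR_ge0 ?exprn_ge0.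
move=> t.
(* t^2 <= 1 + |t|^(2m), whether |t| is below or above 1. *)
have hw : w t <= expR 1 * expR (- t ^+ 2).
  rewrite /freud_weight -expRD ler_expR -(real_normK (num_real t)) exprM.
  have [t1|t1] := leP (`|t| ^+ 2) 1.
    by have := exprn_ge0 m (sqr_ge0 `|t|); lra.
  by have := ler_eXnr m0 (ltW t1); lra.
have hp : `|t| ^+ j <= 2 ^+ j.+1 * (j.+1)`!%:R * expR (t ^+ 2 / 2).
  have h1 := @expR_ge1Dxn R (t ^+ 2 / 2) j.
  have {h1} := h1 (divr_ge0 (sqr_ge0 t) (ler0n _ 2)).
  have f0 : 0 < (j.+1)`!%:R :> R by rewrite ltr0n fact_gt0.
  have p0 : 0 < 2 ^+ j.+1 :> R by rewrite exprn_gt0.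
  have e1 : 1 <= (j.+1)`!%:R :> R by rewrite ler1n fact_gt0.
  have e2 : 1 <= 2 ^+ j.+1 :> R by apply: exprn_ege1; lra.
  set E := expR _ => hE.
  have {hE} hE : 2 ^+ j.+1 * (j.+1)`!%:R + (t ^+ 2) ^+ j.+1 <=
      2 ^+ j.+1 * (j.+1)`!%:R * E.
    have -> : 2 ^+ j.+1 * (j.+1)`!%:R + (t ^+ 2) ^+ j.+1 =
        2 ^+ j.+1 * (j.+1)`!%:R * (1 + (t ^+ 2 / 2) ^+ j.+1 / (j.+1)`!%:R).
      rewrite expr_div_n; field.
      by rewrite pnatr_eq0 -lt0n fact_gt0 lt0r_neq0.
    by rewrite ler_pM2l// mulr_gt0.
  apply: le_trans hE; rewrite -(real_normK (num_real t)) -exprM.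
  have [t1|t1] := leP `|t| 1.
    have : `|t| ^+ j <= 1 by rewrite exprn_ile1.
    have : 1 <= 2 ^+ j.+1 * (j.+1)`!%:R :> R.
      by rewrite -[leLHS]mulr1; apply: ler_pM.
    have : 0 <= `|t| ^+ (2 * j.+1) by rewrite exprn_ge0.
    lra.
  have : `|t| ^+ j <= `|t| ^+ (2 * j.+1).
    by apply: ler_weXn2l; [exact: ltW|rewrite mul2n -addnn -addSnnS leq_addl].
  have : 0 <= 2 ^+ j.+1 * (j.+1)`!%:R :> R by rewrite mulr_ge0// ltW.
  lra.
apply: le_trans (ler_pM _ _ hp hw) _; rewrite ?exprn_ge0 ?expR_ge0//.
rewrite le_eqVlt; apply/orP; left; apply/eqP.
have -> : expR (- (t ^+ 2 / 2)) = expR (t ^+ 2 / 2) * expR (- t ^+ 2) :> R.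
  by rewrite -expRD; congr expR; field.
ring.
Qed.

Lemma continuous_pow_freud_weight (j : nat) :
  continuous (fun t : R => t ^+ j * w t).
Proof.
move=> t; apply: (@continuousM R R (fun t : R => t ^+ j) w); first exact: exprn_continuous.
apply: (@continuous_comp R R R (fun t : R => - `|t| ^+ (2 * m)) expR).
  apply: (@continuousN R R R (fun t : R => `|t| ^+ (2 * m))).
  apply: (@continuous_comp R R R Num.norm (fun t : R => t ^+ (2 * m))).
    exact: norm_continuous.
  exact: exprn_continuous.
exact: continuous_expR.
Qed.

Lemma measurable_pow_freud_weight (j : nat) :
  measurable_fun setT (fun t : R => t ^+ j * w t).
Proof.
by apply: continuous_measurable_fun; exact: continuous_pow_freud_weight.
Qed.

Lemma integrable_pow_freud_weight (j : nat) :
  mu.-integrable setT (fun t => (t ^+ j * w t)%:E).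
Proof.
have [C [C0 hC]] := pow_freud_weight_le j.
have s1 : (1 : R) != 0 by [].
have ig := integrable_normal_pdf 0 (1 : R).
have pk0 : 0 < normal_peak (1 : R) by exact: normal_peak_gt0.
apply: (@le_integrable _ _ _ mu setT measurableT _
   (fun t => ((C / normal_peak (1 : R)) * normal_pdf 0 1 t)%:E)) => //.
- by apply/measurable_EFinP; exact: measurable_pow_freud_weight.
- move=> t _ /=; rewrite lee_fin normrM normrX (ger0_norm (expR_ge0 _)).
  apply: le_trans (hC t) _; rewrite ger0_norm; last first.
    by rewrite mulr_ge0 ?normal_pdf_ge0// divr_ge0// ltW.
  rewrite normal_pdfE// /normal_fun mulrA -(mulrA C) mulVf ?gt_eqF// mulr1.
  by rewrite subr0 expr1n -mulr_natl mulr1 mulNr.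
- by under eq_fun do rewrite EFinM; exact: integrableZl.
Qed.

Lemma integrable_freud_pow (j : nat) : nu.-integrable setT (fun t => (t ^+ j)%:E).
Proof.
have mj : measurable_fun setT (fun t : R => (t ^+ j)%:E).
  by apply/measurable_EFinP; exact: exprn_measurable.
apply/integrableP; split => //.
rewrite integral_freud_ge0//; last exact: measurableT_comp.
have /integrableP[_] := integrable_pow_freud_weight j.
have c0 := freud_const_ge0 R m.
rewrite (_ : (\int[mu]_t _)%E = ((freud_const R m)%:E *
    \int[mu]_t `|(t ^+ j * w t)%:E|)%E).
  by move=> h; apply: lte_mul_pinfty => //; rewrite lee_fin.
rewrite -ge0_integralZl//; last first.
  apply/measurable_EFinP; apply: (@measurableT_comp _ _ _ _ _ _ (@Num.norm R R)) => //.
  exact: measurable_pow_freud_weight.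
apply: eq_integral => t _ /=; rewrite -!EFinM; congr EFin.
by rewrite /freud_density normrM [X in _ = _ * (_ * X)]ger0_norm ?expR_ge0// mulrCA.
Qed.

Definition freud_moment (j : nat) : R := \int[nu]_t t ^+ j.

Lemma freud_momentE j : freud_moment j =
  freud_const R m * \int[mu]_t (t ^+ j * w t).
Proof.
rewrite /freud_moment /Rintegral integral_freud; last exact: integrable_freud_pow.
rewrite -[RHS](RintegralZl (mu := mu) (D := setT))//; last first.
  exact: integrable_pow_freud_weight.
congr fine; apply: eq_integral => t _; rewrite -EFinM; congr EFin.
by rewrite /freud_density; ring.
Qed.

Lemma freud_weightE (t : R) : w t = expR (- t ^+ (2 * m)).
Proof. by rewrite /freud_weight !exprM real_normK// num_real. Qed.

Lemma is_derive_pow_freud_weight (j : nat) (t : R) :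
  is_derive t 1 (fun t : R => t ^+ j * w t)
    (j%:R * (t ^+ j.-1 * w t) - (2 * m)%:R * (t ^+ (j + (2 * m).-1) * w t)).
Proof.
have dX (n : nat) (u : R) : is_derive u 1 (fun t : R => t ^+ n) (n%:R * u ^+ n.-1).
  have := is_deriveX n (is_derive_id u (1 : R)).
  by rewrite /GRing.scale /= mulr1 exprfctE.
have dw : is_derive t 1 (w : R -> R)
  (expR (- t ^+ (2 * m)) * - ((2 * m)%:R * t ^+ (2 * m).-1)).
  rewrite (_ : (w : R -> R) = expR \o (fun t : R => - t ^+ (2 * m))); last first.
    by apply/funext => u; rewrite /= freud_weightE.
  exact: is_derive1_comp (is_derive_expR _) (is_deriveN (dX _ _)).
have := is_deriveM (dX j t) dw.
set a := _ + _ => h; suff -> : j%:R * (t ^+ j.-1 * w t) -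
   (2 * m)%:R * (t ^+ (j + (2 * m).-1) * w t) = a by exact: h.
by rewrite /a /GRing.scale /= freud_weightE exprD; ring.
Qed.

(** The fundamental theorem on [-n, n], and dominated convergence as n grows. *)
Lemma integral_derive_eq0 (F f : R -> R) : (forall t : R, is_derive t 1 F (f t)) ->
  continuous f -> mu.-integrable setT (EFin \o f) ->
  F n.+1%:R @[n --> \oo] --> 0 -> F (- n.+1%:R) @[n --> \oo] --> 0 ->
  \int[mu]_t f t = 0.
Proof.
move=> dF cf intf Fp Fn.
have cF : continuous F.
  by move=> t; apply: differentiable_continuous; apply/derivable1_diffP.
pose A n : set R := `[- n.+1%:R, n.+1%:R]%classic.
have h1 n : (\int[mu]_t ((EFin \o f) \_ (A n)) t = (F n.+1%:R - F (- n.+1%:R))%:E)%E.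
  rewrite -integral_mkcond; apply: continuous_FTC2.
  - by rewrite gtrN.
  - exact: continuous_subspaceT.
  - split.
    + by move=> x _; have := dF x.
    + by apply: cvg_at_right_filter; exact: cF.
    + by apply: cvg_at_left_filter; exact: cF.
  - by move=> x _; rewrite derive1E; apply: derive_val.
have mf : measurable_fun setT (EFin \o f) by apply: measurable_int intf.
have h2 : (\int[mu]_t ((EFin \o f) \_ (A n)) t)%E @[n --> \oo] --> 0%E.
  under eq_cvg do rewrite h1.
  apply: cvg_EFin; first exact: nearW.
  by rewrite -[X in _ --> X](subr0 0); apply: cvgB.
have {}h3 : (\int[mu]_t ((EFin \o f) \_ (A n)) t)%E @[n --> \oo] -->
    (\int[mu]_t (EFin \o f) t)%E.
  apply: (@dominated_cvg _ _ _ mu setT measurableT (fun n => (EFin \o f) \_ (A n))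
     (EFin \o f) (abse \o (EFin \o f))).
  - move=> n; have mA : measurable (A n) by exact: measurable_itv.
    apply: (measurable_restrictT (D := A n) (EFin \o f) mA).1.
    by apply: measurable_funTS; exact: mf.
  - move=> x _; apply: cvg_near_cst; near=> n.
    rewrite patchE ifT// inE /A /= in_itv /= -ler_norml.
    apply: (@le_trans _ _ n%:R); last by rewrite ler_nat.
    by near: n; exact: nbhs_infty_ger.
  - by [].
  - exact: integrable_abse.
  - by move=> n x _; rewrite patchE; case: ifP => // _; rewrite abse0 /= lee_fin.
have := cvg_unique _ h3 h2.
by rewrite /Rintegral => ->.
Unshelve. all: by end_near. Qed.

Lemma cvg_pow_freud_weight (j : nat) (u : nat -> R) : (forall n, `|u n| = n.+1%:R) ->
  u n ^+ j * w (u n) @[n --> \oo] --> 0.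
Proof.
move=> un; have [C [C0 hC]] := pow_freud_weight_le j.+1.
apply/norm_cvg0P; apply: (@squeeze_cvgr _ _ _ _ (cst 0) (fun n => C * harmonic n)).
- apply: nearW => n; rewrite normr_ge0 /=.
  have n0 : 0 < n.+1%:R :> R by [].
  have ew : `|w (u n)| = w (u n) by rewrite ger0_norm// expR_ge0.
  rewrite ler_pdivlMr// normrM normrX ew un.
  have := hC (u n); rewrite un exprS => h.
  have : C * expR (- (u n ^+ 2 / 2)) <= C.
    by rewrite ler_piMr// expR_le1 oppr_le0 divr_ge0// sqr_ge0.
  move/(le_trans h); apply: le_trans.
  by rewrite le_eqVlt; apply/orP; left; apply/eqP; ring.
- exact: cvg_cst.
- by rewrite -[X in _ --> X](mulr0 C); apply: cvgMr; exact: cvg_harmonic.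
Qed.

(** Integration of the derivative of t^j exp(-t^(2m)); this is M(p') = M(W' p) for
    p = t^j.  For j = 0 it says that an odd moment vanishes. *)
Lemma freud_moment_rec (j : nat) :
  (2 * m)%:R * freud_moment (j + (2 * m).-1) = j%:R * freud_moment j.-1.
Proof.
rewrite !freud_momentE.
have i1 := integrable_pow_freud_weight j.-1.
have i2 := integrable_pow_freud_weight (j + (2 * m).-1).
have iZ (c : R) i : mu.-integrable setT (fun t => (c * (t ^+ i * w t))%:E).
  under eq_fun do rewrite EFinM.
  by apply: integrableZl => //; exact: integrable_pow_freud_weight.
have : \int[mu]_t (j%:R * (t ^+ j.-1 * w t) - (2 * m)%:R * (t ^+ (j + (2 * m).-1) * w t)) = 0.
  apply: (@integral_derive_eq0 (fun t : R => t ^+ j * w t)).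
  - exact: is_derive_pow_freud_weight.
  - have cM (c : R) (i : nat) : continuous (fun t : R => c * (t ^+ i * w t)).
      move=> t; apply: (@continuousM R R (cst c) (fun t : R => t ^+ i * w t)).
        exact: cst_continuous.
      exact: continuous_pow_freud_weight.
    move=> t; apply: (@continuousB R R R (fun t : R => j%:R * (t ^+ j.-1 * w t))
      (fun t : R => (2 * m)%:R * (t ^+ (j + (2 * m).-1) * w t))); exact: cM.
  - exact: (integrableB measurableT (iZ _ _) (iZ _ _)).
  - by apply: cvg_pow_freud_weight => n; rewrite ger0_norm.
  - by apply: cvg_pow_freud_weight => n; rewrite normrN ger0_norm.
rewrite RintegralB//; [|exact: iZ|exact: iZ].
rewrite !RintegralZl// => /eqP; rewrite subr_eq0 => /eqP h.
by rewrite mulrCA -h mulrCA.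
Qed.

Lemma freud_moment0 : freud_moment 0 = 1.
Proof.
rewrite /freud_moment; under eq_Rintegral do rewrite expr0.
rewrite Rintegral_cst// mul1r.
by rewrite (_ : fine _ = fine (1%E : \bar R))//; congr fine; exact: freud_measure_setT.
Qed.

End freud_moments.

(** * Expectations of polynomials *)

Section freud_expectation.
Context (R : realType) (m : nat) (m0 : (0 < m)%N).
Local Notation nu := (freud_measure R m).
Local Notation mom := (freud_moment R m).

Definition freud_expect1 (p : {poly R}) : R := \int[nu]_t p.[t].
Local Notation M := freud_expect1.

Lemma integrable_freud_poly (p : {poly R}) :
  nu.-integrable setT (fun t => (p.[t])%:E).
Proof.
under eq_fun do rewrite horner_coef -sumEFin.
apply: integrable_sum => // i _; under eq_fun do rewrite EFinM.
by apply: integrableZl => //; exact: integrable_freud_pow.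
Qed.

Lemma freud_expect1_is_linear : linear_for *%R M.
Proof.
move=> a p q; rewrite /freud_expect1 -RintegralZl//; last exact: integrable_freud_poly.
rewrite -RintegralD//; last exact: integrable_freud_poly.
  by apply: eq_Rintegral => t _; rewrite !hornerE.
exact: (integrableZl measurableT a (integrable_freud_poly p)).
Qed.

(** Packed as a linear form, so that all the estimates can be carried out on
    abstract linear forms. *)
Definition freud_mean1 : {linear {poly R} -> R | *%R} :=
  HB.pack M (GRing.isLinear.Build R {poly R} R *%R M freud_expect1_is_linear).

Lemma freud_expect1_ge0 (p : {poly R}) : (forall t, 0 <= p.[t]) -> 0 <= M p.
Proof. by move=> p0; apply: Rintegral_ge0. Qed.

Lemma freud_expect1Xn j : M 'X^j = mom j.
Proof. by rewrite /freud_expect1 /freud_moment; apply: eq_Rintegral => t _;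
  rewrite hornerXn. Qed.

Local Notation P n := (power_measure nu n).

Lemma integrable_integral_tensor n (h : R -> R) (g : n.-tuple R -> R) :
  measurable_fun setT h -> measurable_fun setT g ->
  nu.-integrable setT (EFin \o h) -> (P n).-integrable setT (EFin \o g) ->
  (nu \x P n)%E.-integrable setT (fun z => (h z.1 * g z.2)%:E) /\
  (\int[nu \x P n]_z (h z.1 * g z.2)%:E = \int[nu]_x (h x)%:E * \int[P n]_y (g y)%:E)%E.
Proof.
move=> mh mg ih ig.
have mhg : measurable_fun setT (fun z : R * n.-tuple R => (h z.1 * g z.2)%:E).
  apply/measurable_EFinP; apply: measurable_funM.
  - by apply: measurableT_comp => //; exact: measurable_fst.
  - by apply: measurableT_comp => //; exact: measurable_snd.
have gfin := integrable_fin_num measurableT ig.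
have aig := integrable_abse ig.
have agfin := integrable_fin_num measurableT aig.
have i : (nu \x P n)%E.-integrable setT (fun z => (h z.1 * g z.2)%:E).
  apply/integrable12ltyP => //.
  rewrite (eq_integral (fun x => `|(h x)%:E| * \int[P n]_y `|(g y)%:E|)%E); last first.
    move=> x _; rewrite -ge0_integralZl//; last exact: measurable_int aig.
    by apply: eq_integral => y _; rewrite -abseM.
  have [r ->] : exists r, (\int[P n]_y `|(g y)%:E| = r%:E)%E.
    by exists (fine (\int[P n]_y `|(g y)%:E|)%E); rewrite fineK.
  under eq_integral do rewrite muleC.
  have : nu.-integrable setT (fun x => r%:E * `|(h x)%:E|)%E.
    by apply: integrableZl => //; exact: integrable_abse.
  by move=> /(integrable_fin_num measurableT); rewrite fin_numElt => /andP[].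
split => //.
rewrite -(integral12_prod_meas1 i) /fubini_F /=.
have [r er] : exists r, (\int[P n]_y (g y)%:E = r%:E)%E.
  by exists (fine (\int[P n]_y (g y)%:E)%E); rewrite fineK.
rewrite er (eq_integral (fun x => r%:E * (h x)%:E)%E).
  by rewrite integralZl// muleC.
move=> x _; rewrite muleC -er -integralZl//.
Qed.

Lemma measurable_monomial n (e : 'I_n -> nat) :
  measurable_fun setT (fun x : n.-tuple R => \prod_(i < n) tnth x i ^+ e i).
Proof.
apply: measurable_prod => i _; apply: measurable_funX.
exact: measurable_tnth.
Qed.

(** Fubini, one coordinate at a time. *)
Lemma integral_monomial n (e : 'I_n -> nat) :
  (P n).-integrable setT (fun x => (\prod_(i < n) tnth x i ^+ e i)%:E) /\
  (\int[P n]_x (\prod_(i < n) tnth x i ^+ e i)%:E = (\prod_(i < n) mom (e i))%:E)%E.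
Proof.
elim: n e => [|n IHn] e.
  under eq_fun do rewrite big_ord0.
  rewrite big_ord0; split; first exact: finite_measure_integrable_cst.
  by rewrite integral_cst//= diracT mule1.
have [ig eg] := IHn (fun i => e (lift ord0 i)).
have mg := measurable_monomial (fun i => e (lift ord0 i)).
have mh : measurable_fun setT (fun t : R => t ^+ e ord0) by exact: exprn_measurable.
have [i eq] := integrable_integral_tensor mh mg (integrable_freud_pow R m0 (e ord0)) ig.
have ef : ((fun x : n.+1.-tuple R => (\prod_(i < n.+1) tnth x i ^+ e i)%:E) \o
    (@tuple_cons R n)) = (fun z => (z.1 ^+ e ord0 *
       \prod_(i < n) tnth z.2 i ^+ e (lift ord0 i))%:E).
  apply/funext => -[x y] /=; rewrite big_ord_recl tnth0.
  congr (_ * _)%:E; apply: eq_bigr => k _; congr (_ ^+ _).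
  by rewrite /tuple_cons tnthS.
have mf : measurable_fun setT (fun x : n.+1.-tuple R => (\prod_(i < n.+1) tnth x i ^+ e i)%:E).
  by apply/measurable_EFinP; exact: measurable_monomial.
have i2 : (nu \x P n)%E.-integrable setT
   ((fun x : n.+1.-tuple R => (\prod_(i < n.+1) tnth x i ^+ e i)%:E) \o (@tuple_cons R n)).
  by rewrite ef.
have mc := @measurable_tuple_cons _ R n.
split.
- exact: (integrable_pushforward mc mf).
- rewrite /= (integral_pushforward mc mf)//.
  rewrite preimage_setT ef eq eg big_ord_recl EFinM; congr (_ * _)%E.
  rewrite /freud_moment /Rintegral fineK//; apply: integrable_fin_num => //.
  exact: integrable_freud_pow.
Qed.

Section mpoly_expectation.
Variable n : nat.
Local Notation T := (mpoly.mpoly n R).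

Lemma poly_funE (f : T) x : poly_fun f x =
  \sum_(u <- mpoly.msupp f) mpoly.mcoeff u f * \prod_(i < n) tnth x i ^+ u i.
Proof. by rewrite /poly_fun mpoly.mevalE. Qed.

Lemma integrable_poly_fun (f : T) : (P n).-integrable setT (fun x => (poly_fun f x)%:E).
Proof.
under eq_fun do rewrite poly_funE -sumEFin.
apply: integrable_sum => // i _; under eq_fun do rewrite EFinM.
by apply: integrableZl => //; exact: (integral_monomial _).1.
Qed.

Definition freud_expect (f : T) : R := \int[P n]_x poly_fun f x.
Local Notation E := freud_expect.

Lemma freud_expect_is_linear : linear_for *%R E.
Proof.
move=> a p q; rewrite /freud_expect -RintegralZl//; last exact: integrable_poly_fun.
rewrite -RintegralD//; last exact: integrable_poly_fun.
  by apply: eq_Rintegral => t _; rewrite /poly_fun mpoly.mevalD mpoly.mevalZ.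
exact: (integrableZl measurableT a (integrable_poly_fun p)).
Qed.

Definition freud_mean : {linear T -> R | *%R} :=
  HB.pack E (GRing.isLinear.Build R T R *%R E freud_expect_is_linear).

Lemma freud_expect_ge0 (f : T) : (forall v, 0 <= mpoly.meval v f) -> 0 <= E f.
Proof. by move=> p0; apply: Rintegral_ge0 => x _; exact: p0. Qed.

Lemma freud_expectX (u : mpoly.multinom n) :
  E (mpoly.mpolyX R u) = \prod_(i < n) mom (u i).
Proof.
rewrite /freud_expect /Rintegral; under eq_integral do rewrite /poly_fun mpoly.mevalX.
by rewrite (integral_monomial u).2.
Qed.

End mpoly_expectation.
End freud_expectation.

(** * Positive linear forms on an algebra *)

Section cauchy_schwarz.
Context (R : realFieldType) (A : comAlgType R) (L : {linear A -> R | *%R}).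
Hypothesis L_sq_ge0 : forall a, 0 <= L (a ^+ 2).

Lemma linform_sqrD a b (s t : R) : L ((s *: a + t *: b) ^+ 2) =
  s ^+ 2 * L (a ^+ 2) + 2 * s * t * L (a * b) + t ^+ 2 * L (b ^+ 2).
Proof.
rewrite sqrrD !exprZn -scalerAl -scalerAr scalerA -scaler_nat scalerA mulrA.
by rewrite linearD [L (_ + _ *: (a * b))]linearD !linearZ.
Qed.

(** The form (a, b) -> L (a b) may be degenerate, which the case L (b^2) = 0 covers. *)
Lemma linform_cauchy_schwarz a b : L (a * b) ^+ 2 <= L (a ^+ 2) * L (b ^+ 2).
Proof.
have h s t := L_sq_ge0 (s *: a + t *: b).
have {}h s t : 0 <= s ^+ 2 * L (a ^+ 2) + 2 * s * t * L (a * b) + t ^+ 2 * L (b ^+ 2).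
  by rewrite -linform_sqrD.
move: (L_sq_ge0 a) (L_sq_ge0 b).
move: (L (a ^+ 2)) (L (b ^+ 2)) (L (a * b)) h => x z y h x0 z0.
have [z1|z1] := ltP 0 z; first by have := h z (- y); nra.
have ez : z = 0 by apply/le_anti; rewrite z0 z1.
rewrite ez mulr0; have [->|y0] := eqVneq y 0; first by rewrite expr0n.
(* If L (b^2) = 0, this choice makes the nonnegative quadratic form equal to -1. *)
have := h 1 (- (x + 1) / (2 * y)); rewrite ez.
rewrite (_ : _ + _ = - 1); first by lra.
by field.
Qed.

Lemma linform_sqr_sum_le n (u : 'I_n -> A) :
  L ((\sum_(i < n) u i) ^+ 2) <= n%:R * \sum_(i < n) L (u i ^+ 2).
Proof.
elim: n u => [|n IHn] u; first by rewrite !big_ord0 mul0r expr0n /= linear0.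
rewrite !big_ord_recr /=; set S := \sum_(i < n) _.
have := IHn (fun i => u (widen_ord (leqnSn n) i)); rewrite -/S => {}IHn.
set Q := \sum_(i < n) L _ in IHn *; set a := u ord_max.
have La0 : 0 <= L (a ^+ 2) by exact: L_sq_ge0.
have := linform_sqrD S a 1 1; rewrite !scale1r => ->.
have [n0|n0] := posnP n.
  by rewrite (_ : S = 0) ?mul0r ?expr0n /= ?linear0 /Q; [subst n; rewrite !big_ord0; lra|
    subst n; rewrite /S big_ord0].
have := L_sq_ge0 (1 *: S + (- n%:R) *: a); rewrite linform_sqrD.
have n1 : 0 < n%:R :> R by rewrite ltr0n.
rewrite -natr1; set x := L (S * a) => h.
have : 2 * x <= Q + n%:R * L (a ^+ 2).
  rewrite -(ler_pM2l n1); nra.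
lra.
Qed.
End cauchy_schwarz.

(** * Convexity of powers and Fourier coefficients of powers *)

Section convexity.
Context (F : numFieldType).

(** The tangent at tau lies below the convex function t^k.  It replaces Jensen's
    inequality wherever the latter would be applied to a linear form. *)
Lemma tangent_pow (t tau : F) k : 0 <= t -> 0 <= tau ->
  tau ^+ k + k%:R * tau ^+ k.-1 * (t - tau) <= t ^+ k.
Proof.
move=> t0 s0; elim: k => [|k IHk]; first by rewrite !expr0 !mul0r addr0.
rewrite [t ^+ _]exprSr; apply: le_trans (ler_wpM2r t0 IHk); rewrite -subr_ge0 /=.
case: k {IHk} => [|k]; first by rewrite (_ : _ - _ = 0)//; ring.
rewrite /= (_ : _ - _ = k.+1%:R * tau ^+ k * (t - tau) ^+ 2); last first.
  by rewrite -[k.+2%:R]natr1 !exprS; ring.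
apply: mulr_ge0; first by rewrite mulr_ge0// exprn_ge0.
by rewrite real_exprn_even_ge0// realB// ger0_real.
Qed.

Lemma power_mean n (t : 'I_n -> F) k : (0 < n)%N -> (forall i, 0 <= t i) ->
  n%:R * ((\sum_i t i) / n%:R) ^+ k <= \sum_i t i ^+ k.
Proof.
move=> n0 t0; set tau := _ / _.
have s0 : 0 <= tau by rewrite divr_ge0// sumr_ge0.
apply: le_trans (ler_sum _ (fun i _ => tangent_pow k (t0 i) s0)).
rewrite big_split /= -mulr_sumr sumrB !sumr_const !card_ord -mulr_natl.
have -> : \sum_i t i = tau *+ n by rewrite -mulr_natr divfK// pnatr_eq0 -lt0n.
by rewrite subrr mulr0 addr0 mulr1 mulr_natl.
Qed.

End convexity.

Section fourier.
Context (C : numClosedFieldType).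

(** X^n - 1 is separable and splits. *)
Lemma prim_root_exists n : (0 < n)%N -> exists z : C, n.-primitive_root z.
Proof.
move=> n0; pose p : {poly C} := 'X^n - 1; have [r Dp] := closed_field_poly_normal p.
rewrite (monicP _) ?monicXnsubC// scale1r in Dp.
have rn1 : all n.-unity_root r by apply/allP => z; rewrite -root_prod_XsubC -Dp.
have sz_r : (n < (size r).+1)%N by rewrite -(size_prod_XsubC r id) -Dp size_XnsubC.
have [|z] := hasP (has_prim_root n0 rn1 _ sz_r); last by exists z.
by rewrite -separable_prod_XsubC -Dp separable_Xn_sub_1// pnatr_eq0 -lt0n.
Qed.

Context (n : nat) (w : C).
Hypothesis (wP : n.-primitive_root w).

Let n0 : (0 < n)%N. Proof. exact: prim_order_gt0 wP. Qed.
Let wn : w ^+ n = 1. Proof. exact: prim_expr_order. Qed.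
Let w_norm : `|w| = 1.
Proof. by apply/eqP; rewrite -(@pexpr_eq1 _ _ n)// -normrX wn normr1. Qed.

Lemma prim_root_orthogonal l k : (l < n)%N -> (k < n)%N ->
  \sum_(j < n) (w ^+ j) ^+ l * ((w ^+ j) ^+ k)^* = n%:R * (l == k)%:R.
Proof.
move=> ln kn; have w0 : w != 0 by rewrite -normr_eq0 w_norm oner_eq0.
have cw : w^* = w^-1 by rewrite invC_norm w_norm expr1n invr1 mul1r.
pose z := w ^+ l * w^-1 ^+ k.
have -> : \sum_(j < n) (w ^+ j) ^+ l * ((w ^+ j) ^+ k)^* = \sum_(j < n) z ^+ j.
  by apply: eq_bigr => j _; rewrite !rmorphXn /= cw /z exprMn -!exprM ![(j * _)%N]mulnC.
have [e|lk] := eqVneq l k.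
  rewrite mulr1 (eq_bigr (fun=> 1)) ?sumr_const ?card_ord// => j _.
  by rewrite /z e -exprMn divff// !expr1n.
rewrite mulr0; have z1 : z != 1.
  apply: contra lk => /eqP h; have : w ^+ l == w ^+ k.
    apply/eqP; rewrite -[RHS]mul1r -h /z -mulrA -exprMn mulVf// expr1n mulr1 //.
  by rewrite (eq_prim_root_expr wP) !modn_small.
have : (z - 1) * \sum_(j < n) z ^+ j = 0.
  by rewrite -subrX1 /z exprMn -!exprM ![(_ * n)%N]mulnC !exprM exprVn wn invr1 !expr1n mulr1
    subrr.
by move/eqP; rewrite mulf_eq0 subr_eq0 (negbTE z1) => /eqP.
Qed.

Lemma parseval (S : {poly C}) : (size S <= n)%N ->
  \sum_(j < n) `|S.[w ^+ j]| ^+ 2 = n%:R * \sum_(l < n) `|S`_l| ^+ 2.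
Proof.
move=> sS; transitivity (\sum_(l < n) \sum_(k < n) S`_l * (S`_k)^* *
    \sum_(j < n) (w ^+ j) ^+ l * ((w ^+ j) ^+ k)^*).
  under [RHS]eq_bigr => l _ do under eq_bigr => k _ do rewrite mulr_sumr.
  under [RHS]eq_bigr => l _ do rewrite exchange_big /=.
  rewrite [RHS]exchange_big /=; apply: eq_bigr => j _.
  rewrite normCK !(horner_coef_wide _ sS) rmorph_sum /= mulr_suml; apply: eq_bigr => l _.
  rewrite mulr_sumr; apply: eq_bigr => k _; rewrite rmorphM /=; ring.
rewrite mulr_sumr; apply: eq_bigr => l _; rewrite (bigD1 l)//= [X in _ + X]big1 ?addr0.
  by rewrite prim_root_orthogonal// eqxx mulr1 normCK mulrC.
by move=> k kl; rewrite prim_root_orthogonal// eq_sym [_ == _](negbTE kl) !mulr0.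
Qed.

(** The same orthogonality of the powers of w recovers the coefficient itself. *)
Lemma fourier_coef1 (S : {poly C}) : (size S <= n)%N -> (1 < n)%N ->
  \sum_(j < n) S.[w ^+ j] * (w ^+ j)^* = n%:R * S`_1.
Proof.
move=> sS n1; transitivity (\sum_(l < n) S`_l *
    \sum_(j < n) (w ^+ j) ^+ l * ((w ^+ j) ^+ 1)^*).
  under [RHS]eq_bigr => l _ do rewrite mulr_sumr.
  rewrite [RHS]exchange_big /=; apply: eq_bigr => j _.
  rewrite (horner_coef_wide _ sS) mulr_suml; apply: eq_bigr => l _.
  by rewrite expr1 mulrA.
rewrite (bigD1 (Ordinal n1))//= [X in _ + X]big1 ?addr0.
  by rewrite prim_root_orthogonal// mulr1 mulrC.
by move=> l l1; rewrite prim_root_orthogonal// [(_ == _)](negbTE l1) !mulr0.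
Qed.

(** Q_1 is a mean of the values of Q against unimodular weights, so its power of
    exponent 2k is at most the mean of |Q|^(2k) = |Q^k|^2, which Parseval turns into
    the sum of the squared coefficients of Q^k. *)
Lemma coef1_pow_le (Q : {poly C}) k : (1 < n)%N -> (size Q <= n)%N -> (size (Q ^+ k) <= n)%N ->
  `|Q`_1| ^+ (2 * k) <= \sum_(l < n) `|(Q ^+ k)`_l| ^+ 2.
Proof.
move=> n1 sQ sQk; have nR : 0 < n%:R :> C by rewrite ltr0n.
rewrite -(ler_pM2l nR) -parseval//.
have -> : \sum_(j < n) `|(Q ^+ k).[w ^+ j]| ^+ 2 = \sum_(j < n) `|Q.[w ^+ j]| ^+ (2 * k).
  by apply: eq_bigr => j _; rewrite horner_exp normrX -exprM mulnC.
apply: le_trans (power_mean (2 * k) n0 (fun j => normr_ge0 _)).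
rewrite ler_pM2l// lerXn2r ?nnegrE ?divr_ge0 ?sumr_ge0//.
rewrite ler_pdivlMr// mulrC -[X in X * _](ger0_norm (ltW nR)) -normrM -fourier_coef1//.
apply: (le_trans (ler_norm_sum _ _ _)); apply: ler_sum => j _.
by rewrite normrM norm_conjC normrX w_norm expr1n mulr1.
Qed.

End fourier.

Lemma real_coef1_pow_le (R : rcfType) (Q : {poly R}) n k :
  (1 < n)%N -> (size Q <= n)%N -> (size (Q ^+ k) <= n)%N ->
  Q`_1 ^+ (2 * k) <= \sum_(l < n) (Q ^+ k)`_l ^+ 2.
Proof.
move=> n1 sQ sQk; have n0 := ltnW n1.
have [w wP] := prim_root_exists (complex R) n0.
pose iota := @real_complex_def R (Phant R); pose Qc := map_poly iota Q.
have rn (x : R) : `|iota x| ^+ 2 = iota (x ^+ 2).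
  by rewrite normCK /iota; rewrite rmorphXn expr2; congr (_ * _);
    rewrite conj_Creal// complex_real.
have := @coef1_pow_le _ n w wP Qc k n1; rewrite /Qc -rmorphXn !size_map_poly => /(_ sQ sQk).
rewrite coef_map exprM rn -rmorphXn -exprM.
under eq_bigr do rewrite coef_map rn.
by rewrite -rmorph_sum lecR.
Qed.

Lemma half_geometric_le (F : realFieldType) n : \sum_(l < n) (2^-1 : F) ^+ l <= 2.
Proof.
suff -> : \sum_(l < n) (2^-1 : F) ^+ l = 2 - 2 * 2^-1 ^+ n.
  by rewrite gerBl mulr_ge0// exprn_ge0.
elim: n => [|p IHp]; first by rewrite big_ord0 expr0; lra.
by rewrite big_ord_recr /= IHp exprS; lra.
Qed.

(** * Orthonormal polynomials of one variable *)

Section orthonormal_polynomials.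
Context (R : realType) (m : nat) (m0 : (0 < m)%N).
Context (M : {linear {poly R} -> R | *%R}).

(** The third clause is integration by parts against the density exp(-t^(2m)).
    The estimates use no other information on the measure. *)
Definition freud_functional : Prop :=
  [/\ M 1 = 1,
      forall p, (forall t, 0 <= p.[t]) -> 0 <= M p &
      forall p, M p^`() = (2 * m)%:R * M ('X^((2 * m).-1) * p)].

Hypothesis HM : freud_functional.

Let M1 : M 1 = 1. Proof. by case: HM. Qed.

Lemma functional_ge0 p : (forall t, 0 <= p.[t]) -> 0 <= M p.
Proof. by case: HM => _ h _; exact: h. Qed.

Let Mibp p : M p^`() = (2 * m)%:R * M ('X^((2 * m).-1) * p).
Proof. by case: HM. Qed.

Lemma functional_le p q : (forall t, p.[t] <= q.[t]) -> M p <= M q.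
Proof.
move=> h; rewrite -subr_ge0 -linearB; apply: functional_ge0 => t.
by rewrite !hornerE subr_ge0.
Qed.

Lemma functional_sq_ge0 (p : {poly R}) : 0 <= M (p ^+ 2).
Proof. by apply: functional_ge0 => t; rewrite horner_exp sqr_ge0. Qed.

Local Notation CS := (linform_cauchy_schwarz functional_sq_ge0).

(** If p is orthogonal to everything, then so is p', by integration by parts; by
    induction on the degree p' = 0, and p is a constant of mean zero. *)
Lemma functional_null n (p : {poly R}) : (size p <= n)%N ->
  (forall q, M (p * q) = 0) -> p = 0.
Proof.
elim: n p => [|n IHn] p sp p0; first by apply/eqP; rewrite -size_poly_leq0.
have p'0 : p^`() = 0.
  have [->|pn0] := eqVneq p 0; first by rewrite deriv0.
  apply: IHn => [|q]; first by rewrite -ltnS (leq_trans (lt_size_deriv pn0)).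
  have := Mibp (p * q); rewrite derivM linearD /= mulrCA !p0 mulr0 addr0.
  by [].
have sp1 : (size p <= 1)%N.
  apply/leq_sizeP => -[//|j] _; have := congr1 (fun r : {poly R} => r`_j) p'0.
  by rewrite coef_deriv coef0 => /eqP; rewrite mulrn_eq0 /= => /eqP.
have := p0 1; rewrite (size1_polyC sp1) -alg_polyC mulr1 linearZ /= M1 mulr1.
by move=> ->; rewrite scale0r.
Qed.

(** By Cauchy-Schwarz a polynomial of square norm zero is orthogonal to everything. *)
Lemma functional_sq_gt0 p : p != 0 -> 0 < M (p ^+ 2).
Proof.
move=> pn0; rewrite lt0r functional_sq_ge0 andbT; apply: contraNneq pn0 => h.
apply/eqP; apply: (@functional_null (size p)) => // q.
have := CS p q; rewrite h mul0r => h2.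
by apply/eqP; rewrite -sqrf_eq0 eq_le h2 sqr_ge0.
Qed.

(** The list is built as a whole so that the recursion is structural. *)
Fixpoint gram_schmidt (n : nat) : seq {poly R} :=
  if n is n'.+1 then
    let s := gram_schmidt n' in
    let r := 'X^n' - \sum_(q <- s) M ('X^n' * q) *: q in
    rcons s ((Num.sqrt (M (r ^+ 2)))^-1 *: r)
  else [::].

(** The j-th orthonormal polynomial, of degree j. *)
Definition onp (j : nat) : {poly R} := last 0 (gram_schmidt j.+1).

Definition onp_residual (n : nat) : {poly R} :=
  'X^n - \sum_(i < n) M ('X^n * onp i) *: onp i.

Lemma gram_schmidtE n : gram_schmidt n = mkseq onp n.
Proof.
elim: n => [//|n IHn]; rewrite mkseqS {1}/gram_schmidt -/gram_schmidt -IHn.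
by rewrite /onp /= last_rcons.
Qed.

Lemma onpE n : onp n = (Num.sqrt (M (onp_residual n ^+ 2)))^-1 *: onp_residual n.
Proof.
rewrite /onp /= last_rcons gram_schmidtE /onp_residual.
by rewrite -(big_mkord xpredT (fun i => M ('X^n * onp i) *: onp i)) /index_iota subn0 big_map.
Qed.

Lemma onp_step n : (forall i, (i < n)%N -> size (onp i) = i.+1) ->
  (forall i j, (i < n)%N -> (j < n)%N -> M (onp i * onp j) = (i == j)%:R) ->
  size (onp n) = n.+1 /\
  (forall i, (i <= n)%N -> M (onp n * onp i) = (i == n)%:R).
Proof.
move=> hs ho; have sr : size (onp_residual n) = n.+1.
  rewrite /onp_residual size_polyDl ?size_polyXn// size_polyN ltnS.
  apply: (leq_trans (size_sum _ _ _)); apply/bigmax_leqP => i _.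
  by rewrite (leq_trans (size_scale_leq _ _))// hs.
have r0 : onp_residual n != 0 by rewrite -size_poly_eq0 sr.
have rho : 0 < Num.sqrt (M (onp_residual n ^+ 2)).
  by rewrite sqrtr_gt0 functional_sq_gt0.
have orth i : (i < n)%N -> M (onp_residual n * onp i) = 0.
  move=> lin; rewrite /onp_residual mulrBl linearB /= mulr_suml linear_sum /=.
  rewrite (bigD1 (Ordinal lin))//= -scalerAl linearZ /= ho// eqxx mulr1.
  rewrite big1 ?addr0 ?subrr// => k /eqP kn.
  rewrite -scalerAl linearZ /= ho//.
  by case: eqP => [e|]; rewrite ?mulr0//; case: kn; exact: val_inj.
split; first by rewrite onpE size_scale ?sr// invr_eq0 gt_eqF.
move=> i; rewrite leq_eqVlt => /predU1P[->|lin]; last first.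
  by rewrite onpE -scalerAl linearZ /= orth// mulr0 ltn_eqF.
rewrite eqxx onpE -scalerAl -scalerAr !linearZ /= mulrA -expr2.
rewrite -[onp_residual n * _]expr2 exprVn sqr_sqrtr ?functional_sq_ge0// mulVf//.
by rewrite gt_eqF// functional_sq_gt0.
Qed.

Lemma onp_spec n : (forall i, (i < n)%N -> size (onp i) = i.+1) /\
  (forall i j, (i < n)%N -> (j < n)%N -> M (onp i * onp j) = (i == j)%:R).
Proof.
elim: n => [//|n [hs ho]]; have [h1 h2] := onp_step hs ho; split=> i.
  by rewrite ltnS leq_eqVlt => /predU1P[->//|]; exact: hs.
move=> j; rewrite !ltnS leq_eqVlt => /predU1P[->|lin].
  by move=> /h2 ->; rewrite eq_sym.
rewrite leq_eqVlt => /predU1P[->|ljn]; last exact: ho.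
by rewrite mulrC h2 ?(ltnW lin).
Qed.

Lemma size_onp i : size (onp i) = i.+1.
Proof. by have [h _] := onp_spec i.+1; exact: h. Qed.

Lemma onp_orthonormal i j : M (onp i * onp j) = (i == j)%:R.
Proof.
have [_ h] := onp_spec (maxn i j).+1.
by apply: h; rewrite ltnS ?leq_maxl ?leq_maxr.
Qed.

Lemma onp0 : onp 0 = 1.
Proof.
rewrite onpE /onp_residual big_ord0 subr0 expr0 expr1n.
by rewrite M1 sqrtr1 invr1 scale1r.
Qed.

Lemma functional_onp_comb n (c : nat -> R) i :
  M ((\sum_(k < n) c k *: onp k) * onp i) = if (i < n)%N then c i else 0.
Proof.
rewrite mulr_suml linear_sum /=; under eq_bigr do rewrite -scalerAl linearZ /= onp_orthonormal.
case: ifP => [lin|nin].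
  rewrite (bigD1 (Ordinal lin))//= eqxx mulr1 big1 ?addr0// => k /eqP kn.
  by case: eqP => [e|]; rewrite ?mulr0//; case: kn; exact: val_inj.
rewrite big1// => k _; case: eqP => [e|]; rewrite ?mulr0//.
by move: nin; rewrite -e ltn_ord.
Qed.

Lemma onp_span n (q : {poly R}) : (size q <= n)%N ->
  exists c : nat -> R, q = \sum_(i < n) c i *: onp i.
Proof.
elim: n q => [|n IHn] q sq.
  by exists (fun=> 0); rewrite big_ord0; apply/eqP; rewrite -size_poly_leq0.
have l0 : (onp n)`_n != 0.
  by have := lead_coef_eq0 (onp n); rewrite lead_coefE size_onp /= => ->;
    rewrite -size_poly_eq0 size_onp.
have [|c hc] := IHn (q - (q`_n / (onp n)`_n) *: onp n).
  apply/leq_sizeP => j; rewrite leq_eqVlt => /predU1P[<-|lnj].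
    by rewrite coefB coefZ divfK// subrr.
  rewrite coefB coefZ (nth_default _ (leq_trans sq lnj)).
  by rewrite (@nth_default _ _ (onp n) j) ?size_onp// mulr0 subr0.
exists (fun i => if i == n then q`_n / (onp n)`_n else c i).
rewrite big_ord_recr /= eqxx; apply/eqP; rewrite -subr_eq hc; apply/eqP.
by apply: eq_bigr => i _; rewrite ltn_eqF.
Qed.

Lemma onp_expand n (q : {poly R}) : (size q <= n)%N ->
  q = \sum_(i < n) M (q * onp i) *: onp i.
Proof.
move=> /onp_span[c ->]; apply: eq_bigr => i _.
by rewrite functional_onp_comb ltn_ord.
Qed.

Lemma onp_orth_small (q : {poly R}) j : (size q <= j)%N -> M (q * onp j) = 0.
Proof. by move=> /onp_span[c ->]; rewrite functional_onp_comb ltnn. Qed.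

Lemma functional_sq_comb n (c : nat -> R) :
  M ((\sum_(k < n) c k *: onp k) ^+ 2) = \sum_(k < n) c k ^+ 2.
Proof.
rewrite expr2 {2}[\sum_(k < n) _]big_mkcond mulr_sumr linear_sum /=.
apply: eq_bigr => k _; rewrite -scalerAr linearZ /= functional_onp_comb ltn_ord.
by rewrite expr2.
Qed.

(** * Differentiation in the orthonormal basis, and fourth moments *)

Let horner_simp := (@hornerD R, @hornerN R, @hornerZ R, @hornerM R, @horner_exp R,
  @hornerXn R, @hornerX R, @hornerC R).

(** j^(1/(2m)) is, up to a constant factor, the half-length of the interval on which
    polynomials of degree j carry their mass. *)
Definition freud_scale (j : nat) : R := j%:R `^ ((2 * m)%:R^-1).

Let m2R : (2 * m)%:R != 0 :> R.
Proof. by rewrite pnatr_eq0 muln_eq0 /= -lt0n. Qed.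

Lemma freud_scaleX j : freud_scale j ^+ (2 * m) = j%:R.
Proof.
by rewrite /freud_scale -powR_mulrn ?powR_ge0// -powRrM mulVf// powRr1.
Qed.

Lemma freud_scale_ge0 j : 0 <= freud_scale j. Proof. exact: powR_ge0. Qed.

Lemma freud_scale_gt0 j : (0 < j)%N -> 0 < freud_scale j.
Proof. by move=> j0; rewrite powR_gt0// ltr0n. Qed.

Lemma freud_scale_le i j : (i <= j)%N -> freud_scale i <= freud_scale j.
Proof. by move=> ij; apply: ge0_ler_powR; rewrite ?nnegrE ?invr_ge0 ?ler_nat. Qed.

Lemma freud_scaleM i j : freud_scale (i * j) = freud_scale i * freud_scale j.
Proof. by rewrite /freud_scale natrM powRM. Qed.

Lemma freud_scale_ge1 j : (0 < j)%N -> 1 <= freud_scale j.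
Proof.
move=> j0; apply: le_trans (freud_scale_le j0).
by rewrite /freud_scale powR1.
Qed.

(** j^(1-1/m).  The squared Bernstein factor j^(2-1/m) of degree j is j times this;
    keeping the factor j apart lets it add up over the variables. *)
Definition deriv_scale (j : nat) : R := freud_scale j ^+ (2 * m - 2).

Lemma deriv_scale_ge0 j : 0 <= deriv_scale j.
  Proof. by rewrite exprn_ge0// freud_scale_ge0. Qed.

Lemma deriv_scale_gt0 j : (0 < j)%N -> 0 < deriv_scale j.
  Proof. by move=> j0; rewrite exprn_gt0// freud_scale_gt0. Qed.

Lemma deriv_scale_le i j : (i <= j)%N -> deriv_scale i <= deriv_scale j.
Proof. by move=> ij; rewrite lerXn2r ?nnegrE ?freud_scale_ge0// freud_scale_le. Qed.

Lemma deriv_scaleE j : deriv_scale j * freud_scale j ^+ 2 = j%:R.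
Proof. by rewrite /deriv_scale -exprD subnK ?freud_scaleX// -[X in (X <= _)%N](muln1 2)
  leq_mul2l. Qed.

(** Integrate by parts X p_j^2; X p_j' - j p_j has degree less than j and is
    orthogonal to p_j. *)
Lemma top_moment_onp j : (2 * m)%:R * M ('X^(2 * m) * onp j ^+ 2) = (2 * j + 1)%:R.
Proof.
have := Mibp ('X * onp j ^+ 2).
rewrite mulrA -exprSr prednK ?muln_gt0// => <-.
rewrite derivM derivX mul1r linearD /= expr2 onp_orthonormal eqxx derivM.
have -> : 'X * ((onp j)^`() * onp j + onp j * (onp j)^`()) =
   2 *: (('X * (onp j)^`()) * onp j) by rewrite scaler_nat; ring.
rewrite linearZ /= natrD addrC natrM; congr (_ * _ + _).
have -> : 'X * (onp j)^`() = ('X * (onp j)^`() - j%:R *: onp j) + j%:R *: onp j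
  by rewrite subrK.
have hj : M (j%:R *: onp j * onp j) = j%:R.
  by rewrite -scalerAl linearZ /= onp_orthonormal eqxx mulr1.
rewrite mulrDl linearD [X in _ + X]hj.
rewrite onp_orth_small ?add0r//; apply/leq_sizeP => i ji.
rewrite coefB coefZ coefXM coef_deriv.
case: i ji => [|i] ji; first by move: ji; rewrite leqn0 => /eqP ->; rewrite mul0r subrr.
rewrite /= -(mulr_natl ((onp j)`_i.+1)); move: ji; rewrite leq_eqVlt => /predU1P[->|ji]; first
  by rewrite subrr.
by rewrite nth_default ?size_onp// !mulr0 subrr.
Qed.

Lemma young_pow (u tau : R) i : 0 <= u -> 0 < tau -> (i <= m)%N ->
  u ^+ i <= tau ^+ i + tau ^- (m - i) * u ^+ m.
Proof.
move=> u0 t0 im; have [ut|tu] := leP u tau.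
  by rewrite ler_wpDr ?lerXn2r ?nnegrE ?(ltW t0)// mulr_ge0 ?exprn_ge0// invr_ge0 exprn_ge0//
    ltW.
rewrite ler_wpDl ?exprn_ge0 ?(ltW t0)// mulrC ler_pdivlMr ?exprn_gt0//.
by rewrite -{2}(subnKC im) exprD ler_wpM2l ?exprn_ge0// lerXn2r ?nnegrE ?(ltW t0) ?(ltW tu).
Qed.

Lemma even_moment_young (q : {poly R}) i (tau : R) : 0 < tau -> (i <= m)%N ->
  M ('X^(2 * i) * q ^+ 2) <=
  tau ^+ i * M (q ^+ 2) + tau ^- (m - i) * M ('X^(2 * m) * q ^+ 2).
Proof.
move=> t0 im; rewrite -!linearZ -linearD; apply: functional_le => t.
rewrite !horner_simp [tau ^- _ * _]mulrA -mulrDl ler_wpM2r ?sqr_ge0//.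
by rewrite !exprM; apply: young_pow => //; exact: sqr_ge0.
Qed.

(** Interpolation between the moments of order 0 and 2m at the natural scale. *)
Lemma even_moment_onp i j J : (0 < J)%N -> (j <= J)%N -> (i <= m)%N ->
  M ('X^(2 * i) * onp j ^+ 2) <= 4 * freud_scale J ^+ (2 * i).
Proof.
move=> J0 jJ im.
have t0 : 0 < freud_scale J ^+ 2 by rewrite exprn_gt0// freud_scale_gt0.
apply: le_trans (even_moment_young _ t0 im) _.
rewrite [onp j ^+ 2 in X in X + _]expr2 onp_orthonormal eqxx mulr1 -!exprM.
have h := top_moment_onp j.
set Q := M _ in h *.
have m1 : 1 <= m%:R :> R by rewrite ler1n.
have J1 : 1 <= J%:R :> R by rewrite ler1n.
have hj : j%:R <= J%:R :> R by rewrite ler_nat.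
have hQ : Q <= 3 * J%:R.
  have h2 : (2 * m%:R) * Q = 2 * j%:R + 1 by rewrite -natrM h natrD natrM.
  have [//|Q3] := leP Q (3 * J%:R); nra.
have e : freud_scale J ^- (2 * (m - i)) * J%:R = freud_scale J ^+ (2 * i).
  rewrite -(freud_scaleX J) -{2}(subnK im) mulnDr exprD mulrA mulVf ?mul1r//.
  by rewrite expf_neq0// gt_eqF// freud_scale_gt0.
have : freud_scale J ^- (2 * (m - i)) * Q <= 3 * freud_scale J ^+ (2 * i).
  by rewrite -e mulrCA ler_wpM2l// invr_ge0 exprn_ge0// freud_scale_ge0.
by move=> h3; lra.
Qed.

(** Matrix entries of differentiation in the orthonormal basis. *)
Definition deriv_coef (a i : nat) : R := M ((onp a)^`() * onp i).

Lemma size_deriv_onp a : (size (onp a)^`() <= a)%N.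
Proof.
have := @lt_size_deriv _ (onp a); rewrite size_onp ltnS; apply.
by rewrite -size_poly_eq0 size_onp.
Qed.

Lemma deriv_coef_upper a i : (a <= i)%N -> deriv_coef a i = 0.
Proof. by move=> ai; apply: onp_orth_small; apply: leq_trans ai; exact: size_deriv_onp. Qed.

Lemma deriv_coefE a i : (i < a)%N ->
  deriv_coef a i = (2 * m)%:R * M ('X^((2 * m).-1) * (onp a * onp i)).
Proof.
move=> ia; rewrite -Mibp derivM linearD /= -[LHS]addr0 -/(deriv_coef a i); congr (_ + _).
by rewrite mulrC onp_orth_small// (leq_trans (size_deriv_onp i))// ltnW.
Qed.

(** After integration by parts p_a is tested against X^(2m-1) p_i, of degree smaller
    than a. *)
Lemma deriv_coef_band a i : (i + (2 * m).-1 < a)%N -> deriv_coef a i = 0.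
Proof.
move=> ia; rewrite deriv_coefE; last exact: leq_ltn_trans (leq_addr _ _) ia.
rewrite (_ : _ * _ = ('X^((2 * m).-1) * onp i) * onp a :> {poly R}); last by ring.
rewrite onp_orth_small ?mulr0//.
rewrite (leq_trans (size_polyMleq _ _))// size_onp size_polyXn /=.
by rewrite addnS addnC.
Qed.

(** Split X^(2m-1) = X^m X^(m-1) between the two factors and apply Cauchy-Schwarz. *)
Lemma deriv_coef_le a i : deriv_coef a i ^+ 2 <= 64 * m%:R ^+ 2 * (a%:R * deriv_scale a).
Proof.
have [ai|ia] := leqP a i.
  by rewrite deriv_coef_upper// expr0n mulr_ge0 ?mulr_ge0 ?deriv_scale_ge0.
have a0 : (0 < a)%N by exact: leq_ltn_trans ia.
rewrite deriv_coefE// exprMn.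
have -> : 'X^((2 * m).-1) * (onp a * onp i) = ('X^m * onp a) * ('X^(m.-1) * onp i).
  have -> : ((2 * m).-1 = m + m.-1)%N by case: m m0 => // m' _;
    rewrite mul2n -addnn addSn addnS.
  by rewrite exprD; ring.
have h := CS ('X^m * onp a) ('X^(m.-1) * onp i).
rewrite !exprMn -!exprM ![(_ * 2)%N]mulnC in h.
have h1 := even_moment_onp a0 (leqnn a) (leqnn m).
have h2 := even_moment_onp a0 (ltnW ia) (leq_pred m).
have e : freud_scale a ^+ (2 * m) * freud_scale a ^+ (2 * m.-1) = a%:R * deriv_scale a.
  by rewrite freud_scaleX /deriv_scale -subn1 mulnBr muln1.
have : M ('X^m * onp a * ('X^(m.-1) * onp i)) ^+ 2 <= 16 * (a%:R * deriv_scale a).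
  rewrite -e; apply: (le_trans h);
    rewrite (_ : 16 * _ = (4 * freud_scale a ^+ (2 * m)) * (4 * freud_scale a ^+ (2 * m.-1)));
    last by ring.
  by apply: ler_pM => //; apply: functional_ge0 => t;
    rewrite !horner_simp exprM mulr_ge0 ?sqr_ge0// exprn_ge0// sqr_ge0.
rewrite natrM => h3.
have mm : 0 <= (m%:R : R) ^+ 2 by exact: sqr_ge0.
set X := M _ ^+ 2 in h3 *; nra.
Qed.

Lemma sqr_sum_card (I : finType) (S : pred I) (x : I -> R) :
  (\sum_(a | S a) x a) ^+ 2 <= #|S|%:R * \sum_(a | S a) x a ^+ 2.
Proof.
have : 0 <= \sum_(a | S a) \sum_(b | S b) (x a - x b) ^+ 2.
  by apply: sumr_ge0 => a _; apply: sumr_ge0 => b _; exact: sqr_ge0.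
(* Lagrange's form of the defect in Cauchy-Schwarz. *)
have -> : \sum_(a | S a) \sum_(b | S b) (x a - x b) ^+ 2 =
    2 * (#|S|%:R * \sum_(a | S a) x a ^+ 2) - 2 * (\sum_(a | S a) x a) ^+ 2.
  transitivity (\sum_(a | S a) (#|S|%:R * x a ^+ 2 + \sum_(b | S b) x b ^+ 2
      - 2 * (x a * \sum_(b | S b) x b))).
    apply: eq_bigr => a _; under eq_bigr do rewrite sqrrB -mulr_natl.
    rewrite big_split /= sumrB sumr_const -mulr_sumr -mulr_sumr.
    by rewrite -[x a ^+ 2 *+ _]mulr_natl; ring.
  rewrite sumrB big_split /= -!mulr_sumr -mulr_suml sumr_const -mulr_natl expr2.
  ring.
lra.
Qed.

(** A row or a column of a banded matrix has few nonzero entries. *)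
Lemma card_band n lo w : (#|[pred a : 'I_n | (lo <= a < lo + w)%N]| <= w)%N.
Proof.
case: w => [|w].
  apply: eq_leq; apply: eq_card0 => a; rewrite !inE addn0.
  by apply/negP => /andP[h]; rewrite ltnNge h.
rewrite -[X in (_ <= X)%N]card_ord.
apply: (@leq_card_in _ _ (fun a : 'I_n => inord (a - lo) : 'I_w.+1)) => a b.
rewrite !inE => /andP[a1 a2] /andP[b1 b2] /(congr1 val) /=.
rewrite !inordK ?ltn_subLR// => e.
by apply: val_inj => /=; rewrite -(subnKC a1) e subnKC.
Qed.

Lemma deriv_onp_comb D (c : nat -> R) :
  (\sum_(a < D) c a *: onp a)^`() =
  \sum_(i < D) (\sum_(a < D) c a * deriv_coef a i) *: onp i.
Proof.
rewrite raddf_sum /=; under [RHS]eq_bigr do rewrite scaler_suml.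
rewrite exchange_big /=; apply: eq_bigr => a _.
rewrite derivZ {1}(@onp_expand D (onp a)^`()); last first.
  by apply: leq_trans (size_deriv_onp a) _; rewrite ltnW.
by rewrite scaler_sumr; apply: eq_bigr => i _; rewrite scalerA.
Qed.

Definition deriv_const : R := (2 * m)%:R ^+ 2 * (64 * m%:R ^+ 2).

Lemma deriv_const_ge0 : 0 <= deriv_const.
Proof. by rewrite mulr_ge0 ?sqr_ge0// mulr_ge0 ?sqr_ge0. Qed.

(** Each of the 2m diagonals of the band is controlled by the size of the entries.
    The scale is taken at L and the factor a is kept inside the sum: this weighted
    form is the one that tensorizes. *)
Lemma deriv_comb_le L D (c : nat -> R) : (D <= L.+1)%N ->
  M ((\sum_(a < D) c a *: onp a)^`() ^+ 2) <=
  deriv_const * \sum_(a < D) a%:R * deriv_scale L * c a ^+ 2.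
Proof.
move=> DL; rewrite deriv_onp_comb.
rewrite (functional_sq_comb D (fun i => \sum_(a < D) c a * deriv_coef a i)).
have band (a i : nat) : ~~ (i < a <= i + (2 * m))%N -> deriv_coef a i = 0.
  rewrite negb_and -!leqNgt -ltnNge => /orP[|h]; first exact: deriv_coef_upper.
  apply: deriv_coef_band; apply: leq_ltn_trans h; by rewrite leq_add2l leq_pred.
have h1 (i : 'I_D) : (\sum_(a < D) c a * deriv_coef a i) ^+ 2 <=
    (2 * m)%:R * \sum_(a < D | (i < a <= i + 2 * m)%N) (c a * deriv_coef a i) ^+ 2.
  rewrite (bigID [pred a : 'I_D | (i < a <= i + 2 * m)%N]) /=.
  rewrite [X in _ + X]big1 ?addr0; last by move=> a /band ->; rewrite mulr0.
  apply: le_trans (sqr_sum_card _ _) _; rewrite ler_wpM2r ?ler_nat//; last first.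
    by apply: leq_trans (card_band D i.+1 (2 * m)); apply: subset_leq_card;
      apply/fintype.subsetP => a.
  by apply: sumr_ge0 => a _; exact: sqr_ge0.
apply: (le_trans (ler_sum _ (fun i _ => h1 i))).
rewrite -mulr_sumr (exchange_big_dep xpredT)//= /deriv_const expr2 -!mulrA.
rewrite !ler_pM2l ?ltr0n ?muln_gt0// !mulr_sumr; apply: ler_sum => a _.
have h2 : \sum_(i < D | (i < a <= i + 2 * m)%N) (c a * deriv_coef a i) ^+ 2 <=
    \sum_(i < D | (i < a <= i + 2 * m)%N) c a ^+ 2 * (64 * m%:R ^+ 2 * (a%:R * deriv_scale L)).
  apply: ler_sum => i _; rewrite exprMn ler_wpM2l ?sqr_ge0//.
  apply: le_trans (deriv_coef_le a i) _; rewrite ler_wpM2l ?mulr_ge0 ?sqr_ge0//.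
  by rewrite ler_wpM2l// deriv_scale_le// -ltnS (leq_trans (ltn_ord a)).
apply: (le_trans h2); rewrite sumr_const -[X in X <= _]mulr_natl.
rewrite (_ : (2 * m)%:R * _ =
  (2 * m)%:R * (c a ^+ 2 * (64 * m%:R ^+ 2 * (a%:R * deriv_scale L)))); last by ring.
rewrite ler_wpM2r//; first by rewrite ?(sqr_ge0, deriv_scale_ge0, ler0n, mulr_ge0).
rewrite ler_nat; apply: leq_trans (card_band D (a - 2 * m) (2 * m)).
apply: subset_leq_card; apply/fintype.subsetP => i; rewrite -!topredE /= => /andP[ia ai].
by rewrite leq_subLR addnC ai /=; apply: leq_trans ia _; rewrite addnC -leq_subLR.
Qed.

Lemma deriv_le d L (g : {poly R}) : (size g <= d.+1)%N -> (d <= L)%N ->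
  M (g^`() ^+ 2) <= deriv_const * (d%:R * deriv_scale L) * M (g ^+ 2).
Proof.
move=> sg dL; have /onp_span[c ->] := sg.
rewrite functional_sq_comb -mulrA mulr_sumr.
apply: le_trans (deriv_comb_le c _) _; first by rewrite ltnS; exact: dL.
rewrite ler_wpM2l ?deriv_const_ge0//; apply: ler_sum => a _.
by rewrite ler_wpM2r ?sqr_ge0// ler_wpM2r ?deriv_scale_ge0// ler_nat -ltnS.
Qed.

Definition second_moment_const : R := deriv_const + 3.

Lemma second_moment_const_ge0 : 0 <= second_moment_const.
  Proof. by rewrite addr_ge0// deriv_const_ge0. Qed.

(** By integration by parts the moment of order 2m of g^2 is bounded through the
    norms of X g and g', and Young's inequality closes the loop. *)
Lemma second_moment_le d (g : {poly R}) : (0 < d)%N -> (size g <= d.+1)%N ->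
  M ('X^2 * g ^+ 2) <= second_moment_const * freud_scale d ^+ 2 * M (g ^+ 2).
Proof.
move=> d0 sg; set F := M (g ^+ 2); set S := M (_ * _).
have F0 : 0 <= F by exact: functional_sq_ge0.
set Q := M ('X^(2 * m) * g ^+ 2).
have T0 := deriv_scale_gt0 d0.
have th0 : 0 < freud_scale d ^+ 2 by rewrite exprn_gt0// freud_scale_gt0.
have Q0 : 0 <= Q by apply: functional_ge0 => t;
  rewrite !horner_simp exprM mulr_ge0 ?sqr_ge0// exprn_ge0// sqr_ge0.
have S0 : 0 <= S by apply: functional_ge0 => t; rewrite !horner_simp mulr_ge0 ?sqr_ge0.
have d1 : 1 <= d%:R :> R by rewrite ler1n.
have m1 : 1 <= m%:R :> R by rewrite ler1n.
have eT := deriv_scaleE d.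
(* Young's inequality between the orders 0 and 2m at the scale of d. *)
have hS : deriv_scale d * S <= d%:R * F + Q.
  have := even_moment_young g th0 (m0 : (1 <= m)%N); rewrite expr1 muln1 -/F -/Q -/S => h.
  have e : deriv_scale d * (freud_scale d ^+ 2) ^- (m - 1) = 1.
    by rewrite -exprM mulnBr muln1 /deriv_scale mulfV// gt_eqF.
  rewrite -eT -mulrA -[X in _ <= _ + X]mul1r -e -[X in _ <= _ + X]mulrA -mulrDr.
  by rewrite ler_pM2l.
set Z := M ('X * g * g^`()).
have hZ : Z ^+ 2 <= deriv_const * d%:R * F * (d%:R * F + Q).
  have := CS ('X * g) (g^`()); rewrite exprMn -/S -/Z => h.
  apply: (le_trans h); rewrite mulrC.
  apply: (@le_trans _ _ (deriv_const * (d%:R * deriv_scale d) * F * S)).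
    by rewrite ler_wpM2r//; exact: deriv_le.
  rewrite (_ : deriv_const * (d%:R * deriv_scale d) * F * S =
    deriv_const * d%:R * F * (deriv_scale d * S)); last by ring.
  by rewrite ler_wpM2l// !mulr_ge0 ?deriv_const_ge0.
(* Integration by parts of X g^2. *)
have hQ : (2 * m)%:R * Q = F + 2 * Z.
  have := Mibp ('X * g ^+ 2).
  rewrite mulrA -exprSr prednK ?muln_gt0// -/Q => <-.
  rewrite derivM derivX mul1r linearD /= -/F expr2 derivM; congr (_ + _).
  rewrite (_ : 'X * _ = 2 *: ('X * g * g^`())) ?linearZ//.
  by rewrite scaler_nat; ring.
have k0 := deriv_const_ge0.
have hQ2 : Q <= (deriv_const + 2) * (d%:R * F).
  set z := d%:R * F; have zF : F <= z by rewrite /z ler_peMl.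
  have {}hZ : Z ^+ 2 <= deriv_const * z * (z + Q) by move: hZ; rewrite !mulrA.
  have h2 : 2 * Q <= z + 2 * Z.
    by rewrite -(lerD2r (- 0)) !subr0; move: hQ; rewrite natrM; nra.
  rewrite leNgt; apply/negP => hlt.
  have z0 : 0 <= z by exact: le_trans zF.
  have h3 : 0 <= 2 * Q - z by nra.
  have h4 : (2 * Q - z) ^+ 2 <= 4 * (deriv_const * z * (z + Q)).
    have : (2 * Q - z) ^+ 2 <= (2 * Z) ^+ 2 by rewrite lerXn2r ?nnegrE//; lra.
    rewrite exprMn; lra.
  have : 0 < Q by apply: le_lt_trans hlt; rewrite mulr_ge0// addr_ge0.
  have : 0 <= deriv_const * z by rewrite mulr_ge0.
  nra.
rewrite -(ler_pM2l T0); apply: (le_trans hS).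
rewrite (_ : deriv_scale d * _ =
  second_moment_const * (deriv_scale d * freud_scale d ^+ 2) * F); last by ring.
rewrite eT /second_moment_const; lra.
Qed.

(** The three coefficients of the recurrence X p_a = up p_(a+1) + mid p_a + down p_(a-1). *)
Definition jacobi_up (a : nat) : R := M ('X * onp a * onp a.+1).
Definition jacobi_mid (a : nat) : R := M ('X * onp a * onp a).
Definition jacobi_down (a : nat) : R :=
  if a is a'.+1 then M ('X * onp a * onp a') else 0.

Lemma size_X_onp a : (size ('X * onp a)%R <= a.+2)%N.
Proof. by rewrite (leq_trans (size_polyMleq _ _))// size_onp size_polyX. Qed.

Lemma three_term a : 'X * onp a =
  jacobi_up a *: onp a.+1 + jacobi_mid a *: onp a + jacobi_down a *: onp a.-1.
Proof.
rewrite (onp_expand (size_X_onp a)) !big_ord_recr /= -/(jacobi_up a) -/(jacobi_mid a).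
case: a => [|a] /=; first by rewrite big_ord0 add0r scale0r addr0 addrC.
rewrite big_ord_recr /= big1 ?add0r; last first.
  move=> i _; rewrite (_ : _ * _ * _ = ('X * onp i) * onp a.+1); last by ring.
  rewrite onp_orth_small ?scale0r//.
  by apply: leq_trans (size_X_onp i) _; rewrite ltnS; exact: ltn_ord.
by rewrite addrC [X in _ + X]addrC addrA.
Qed.

Lemma coef_comb_small n (c : 'I_n -> R) : (\sum_(i < n) c i *: onp i)`_n = 0.
Proof.
rewrite coef_sum big1// => i _.
by rewrite coefZ nth_default ?mulr0// size_onp.
Qed.

(** Compare the leading coefficients of p_(a+1)' and of X p_a. *)
Lemma jacobi_upM_deriv_coef a : jacobi_up a * deriv_coef a.+1 a = a.+1%:R.
Proof.
have l0 k : (onp k)`_k != 0.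
  have := lead_coef_eq0 (onp k); rewrite lead_coefE size_onp /= => ->.
  by rewrite -size_poly_eq0 size_onp.
have e1 : (onp a.+1)`_a.+1 *+ a.+1 = deriv_coef a.+1 a * (onp a)`_a.
  rewrite -coef_deriv (onp_expand (size_deriv_onp a.+1)) big_ord_recr /=.
  by rewrite coefD coefZ coef_comb_small add0r.
have e2 : (onp a)`_a = jacobi_up a * (onp a.+1)`_a.+1.
  have := congr1 (fun p : {poly R} => p`_a.+1) (onp_expand (size_X_onp a)).
  rewrite coefXM /= => ->; rewrite big_ord_recr /= coefD coefZ coef_comb_small add0r.
  by [].
apply: (mulIf (l0 a)); rewrite -mulrA -e1 e2 -mulr_natl; ring.
Qed.

(** The product with the derivative coefficient is a + 1, and that coefficient is
    bounded above. *)
Lemma jacobi_up_ge a : freud_scale a.+1 ^+ 2 <= 64 * m%:R ^+ 2 * jacobi_up a ^+ 2.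
Proof.
have h := deriv_coef_le a.+1 a; have e := jacobi_upM_deriv_coef a.
have T0 : 0 < deriv_scale a.+1 by exact: deriv_scale_gt0.
have eT := deriv_scaleE a.+1; have a0 : 0 < a.+1%:R :> R by [].
have b0 : 0 <= jacobi_up a ^+ 2 by exact: sqr_ge0.
have : a.+1%:R ^+ 2 <= jacobi_up a ^+ 2 * (64 * m%:R ^+ 2 * (a.+1%:R * deriv_scale a.+1)).
  by rewrite -{1}e exprMn ler_wpM2l.
move=> hh; rewrite -(ler_pM2l T0) -(ler_pM2l a0) eT -expr2; apply: (le_trans hh).
by rewrite le_eqVlt; apply/orP; left; apply/eqP; ring.
Qed.

Lemma onp_sq1 a : M (onp a ^+ 2) = 1.
Proof. by rewrite expr2 onp_orthonormal eqxx. Qed.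

Lemma jacobi_mid_le a : jacobi_mid a ^+ 2 <= 4 * freud_scale a.+1 ^+ 2.
Proof.
have := CS ('X * onp a) (onp a); rewrite onp_sq1 mulr1.
move=> /le_trans; apply; rewrite exprMn -[2%N]muln1.
by apply: even_moment_onp => //; rewrite leqnSn.
Qed.

Lemma jacobi_down_le a : jacobi_down a ^+ 2 <= 4 * freud_scale a.+1 ^+ 2.
Proof.
case: a => [|a]; first by rewrite expr0n mulr_ge0 ?sqr_ge0.
have := CS ('X * onp a.+1) (onp a); rewrite onp_sq1 mulr1.
move=> /le_trans; apply; rewrite exprMn -[2%N]muln1.
by apply: even_moment_onp => //; rewrite leqnSn.
Qed.

(** The squared scale j^(1/m) grows at most linearly. *)
Lemma freud_scale_ratio i j : (0 < i)%N -> (i <= j)%N ->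
  i%:R * freud_scale j ^+ 2 <= j%:R * freud_scale i ^+ 2.
Proof.
move=> i0 ij; rewrite -(deriv_scaleE i) -(deriv_scaleE j).
rewrite -[leLHS]mulrA -[leRHS]mulrA [freud_scale j ^+ 2 * _]mulrC.
by rewrite ler_wpM2r ?deriv_scale_le// mulr_ge0 ?sqr_ge0.
Qed.

Definition onp_mul_const : R := 192 * m%:R ^+ 2 * (second_moment_const + 8).

Lemma onp_mul_const_ge1 : 1 <= onp_mul_const.
Proof.
have m1 : 1 <= m%:R :> R by rewrite ler1n.
have := second_moment_const_ge0; rewrite /onp_mul_const => k; have : 1 <= m%:R ^+ 2 :> R
  by rewrite exprn_ege1.
nra.
Qed.

(** Express p_(a+1) q through X p_a q, p_a q and p_(a-1) q by the recurrence.  The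
    upper coefficient has size at least the scale of a + 1, and multiplication by X
    costs the scale of a + e + 1; their squared ratio is at most (a + e + 1) / (a + 1). *)
Lemma onp_mul_step a e (q : {poly R}) : (size q <= e.+1)%N ->
  a.+1%:R * M (onp a.+1 ^+ 2 * q ^+ 2) <=
  onp_mul_const * (a + e).+1%:R *
    Num.max (M (onp a ^+ 2 * q ^+ 2)) (M (onp a.-1 ^+ 2 * q ^+ 2)).
Proof.
move=> sq; set f1 := M _; set f0 := M _; set fm := M _; set mx := Num.max _ _.
have fge k : 0 <= M (onp k ^+ 2 * q ^+ 2).
  by apply: functional_ge0 => t; rewrite !horner_simp mulr_ge0 ?sqr_ge0.
have f10 : 0 <= f1 by exact: fge.
have f0m : f0 <= mx by rewrite le_max lexx.
have fmm : fm <= mx by rewrite le_max lexx orbT.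
have mx0 : 0 <= mx by exact: le_trans (fge _) f0m.
have sz : (size (onp a * q)%R <= (a + e).+2)%N.
  rewrite (leq_trans (size_polyMleq _ _))// size_onp /=.
  by rewrite (leq_trans (leq_add (leqnn a) sq))// addnS.
have hX := second_moment_le (ltn0Sn (a + e)) sz; rewrite exprMn -/f0 in hX.
set S := M ('X^2 * _) in hX.
(* Pointwise (u + v + w)^2 <= 3 (u^2 + v^2 + w^2) in the recurrence. *)
have h1 : jacobi_up a ^+ 2 * f1 <=
    3 * (S + jacobi_mid a ^+ 2 * f0 + jacobi_down a ^+ 2 * fm).
  rewrite -!linearZ -!linearD -linearZ /=; apply: functional_le => t.
  have := congr1 (horner^~ t) (three_term a); rewrite !horner_simp.
  move: (onp a).[t] (onp a.+1).[t] (onp a.-1).[t] q.[t] (jacobi_up a) (jacobi_mid a)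
    (jacobi_down a) => x y z u b c e' eq.
  have -> : b ^+ 2 * (y ^+ 2 * u ^+ 2) = ((t * x - c * x - e' * z) * u) ^+ 2 by rewrite eq;
    ring.
  rewrite -subr_ge0.
  rewrite (_ : _ - _ =
    ((t * x * u + c * x * u) ^+ 2 + (t * x * u + e' * z * u) ^+ 2 +
    (c * x * u - e' * z * u) ^+ 2)); last by ring.
  by rewrite !addr_ge0 ?sqr_ge0.
have hu := jacobi_up_ge a.
have hm := jacobi_mid_le a; have hd := jacobi_down_le a.
have hr := @freud_scale_ratio a.+1 (a + e).+1 isT (leq_addr _ _).
set th2 := freud_scale a.+1 ^+ 2 in hu hm hd hr.
have t0 : 0 < th2 by rewrite exprn_gt0// freud_scale_gt0.
have k2 := second_moment_const_ge0.
set Te := freud_scale (a + e).+1 ^+ 2 in hX hr; have Te0 : 0 <= Te by exact: sqr_ge0.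
have mm : 0 <= 64 * m%:R ^+ 2 :> R by rewrite mulr_ge0 ?sqr_ge0.
have h2 : th2 * f1 <= 192 * m%:R ^+ 2 * (second_moment_const * Te + 8 * th2) * mx.
  apply: (@le_trans _ _ (64 * m%:R ^+ 2 * (jacobi_up a ^+ 2 * f1))).
    by rewrite mulrA ler_wpM2r.
  rewrite (_ : 192 * m%:R ^+ 2 * (second_moment_const * Te + 8 * th2) * mx =
    64 * m%:R ^+ 2 * (3 * (second_moment_const * Te + 8 * th2) * mx)); last by ring.
  rewrite ler_wpM2l//; apply: (le_trans h1).
  have g1 : S <= second_moment_const * Te * mx by apply: (le_trans hX);
    rewrite ler_wpM2l// mulr_ge0.
  have g2 : jacobi_mid a ^+ 2 * f0 <= 4 * th2 * mx by apply: ler_pM => //;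
    [exact: sqr_ge0|exact: fge].
  have g3 : jacobi_down a ^+ 2 * fm <= 4 * th2 * mx by apply: ler_pM => //;
    [exact: sqr_ge0|exact: fge].
  rewrite -mulrA ler_wpM2l//; lra.
rewrite -(ler_pM2l t0).
have a0 : 0 <= a.+1%:R :> R by [].
have ae : a.+1%:R <= (a + e).+1%:R :> R by rewrite ler_nat ltnS leq_addr.
apply: (@le_trans _ _
  (a.+1%:R * (192 * m%:R ^+ 2 * (second_moment_const * Te + 8 * th2) * mx))).
  by rewrite mulrCA ler_wpM2l.
have g : a.+1%:R * (second_moment_const * Te + 8 * th2) <=
  (second_moment_const + 8) * (a + e).+1%:R * th2.
  have : second_moment_const * (a.+1%:R * Te) <= second_moment_const * ((a + e).+1%:R * th2)
    by rewrite ler_wpM2l.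
  have : a.+1%:R * th2 <= (a + e).+1%:R * th2 by rewrite ler_wpM2r// ltW.
  lra.
rewrite (_ : a.+1%:R * _ =
  192 * m%:R ^+ 2 * mx * (a.+1%:R * (second_moment_const * Te + 8 * th2))); last by ring.
rewrite (_ : th2 * _ =
  192 * m%:R ^+ 2 * mx * ((second_moment_const + 8) * (a + e).+1%:R * th2)); last
  by rewrite /onp_mul_const; ring.
by rewrite ler_wpM2l// !mulr_ge0// sqr_ge0.
Qed.

(** The ratios of the step multiply up to a binomial coefficient. *)
Lemma onp_mul_le a e (q : {poly R}) : (size q <= e.+1)%N ->
  M (onp a ^+ 2 * q ^+ 2) <= onp_mul_const ^+ a * 'C(a + e, a)%:R * M (q ^+ 2).
Proof.
move=> sq; have F0 := functional_sq_ge0 q.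
have k0 : 0 <= onp_mul_const by exact: le_trans onp_mul_const_ge1.
suff: M (onp a ^+ 2 * q ^+ 2) <= onp_mul_const ^+ a * 'C(a + e, a)%:R * M (q ^+ 2) /\
   M (onp a.-1 ^+ 2 * q ^+ 2) <= onp_mul_const ^+ a * 'C(a + e, a)%:R * M (q ^+ 2) by case.
elim: a => [|a [IH1 IH2]].
  by rewrite /= onp0 expr1n mul1r expr0 bin0 !mul1r.
split; last first.
  apply: (le_trans IH1); rewrite ler_wpM2r//.
  apply: ler_pM; rewrite ?exprn_ge0//.
    by rewrite exprS ler_peMl ?exprn_ge0// onp_mul_const_ge1.
  by rewrite ler_nat addSn binS leq_addl.
have := onp_mul_step a sq.
have a0 : 0 < a.+1%:R :> R by [].
move=> hh; rewrite -(ler_pM2l a0); apply: (le_trans hh).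
have -> : a.+1%:R * (onp_mul_const ^+ a.+1 * 'C(a.+1 + e, a.+1)%:R * M (q ^+ 2)) =
   onp_mul_const * (a + e).+1%:R * (onp_mul_const ^+ a * 'C(a + e, a)%:R * M (q ^+ 2)).
  have : (a.+1 * 'C((a + e).+1, a.+1) = (a + e).+1 * 'C(a + e, a))%N by rewrite mul_bin_diag.
  move/(congr1 (fun n => n%:R : R)); rewrite !natrM -addSn => eb.
  rewrite (_ : a.+1%:R * _ =
    onp_mul_const ^+ a.+1 * M (q ^+ 2) * (a.+1%:R * 'C(a.+1 + e, a.+1)%:R)); last by ring.
  by rewrite eb exprS; ring.
apply: ler_wpM2l; first by rewrite mulr_ge0.
by rewrite ge_max IH1 IH2.
Qed.

Lemma bin_le_expn n k : ('C(n, k) <= 2 ^ n)%N.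
Proof.
elim: n k => [|n IHn] [|k]; rewrite ?bin0 ?expn_gt0//.
by rewrite binS expnS mul2n -addnn leq_add.
Qed.

Lemma onp_fourth_moment a : M (onp a ^+ 4) <= (onp_mul_const * 4) ^+ a.
Proof.
rewrite (exprM _ 2 2) expr2; apply: le_trans (onp_mul_le a (eq_leq (size_onp a))) _.
rewrite onp_sq1 [leLHS]mulr1 [(onp_mul_const * 4) ^+ a]exprMn ler_wpM2l//.
  by rewrite exprn_ge0// (le_trans _ onp_mul_const_ge1).
rewrite (_ : 4 ^+ a = (2 ^ (a + a))%:R :> R) ?ler_nat ?bin_le_expn//.
by rewrite natrX addnn -mul2n exprM; congr (_ ^+ _); ring.
Qed.

End orthonormal_polynomials.

(** * Product functionals in several variables *)

Section product_mean.
Context (R : realType) (m : nat) (m0 : (0 < m)%N).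
Context (M : {linear {poly R} -> R | *%R}) (HM : freud_functional m M) (N : nat).
Local Notation T := (mpoly N R).
Context (E : {linear T -> R | *%R}).

(** E is the tensor power of M; positivity on polynomials in all the variables is a
    requirement of its own. *)
Definition product_mean : Prop :=
  (forall u : multinom N, E (mpolyX R u) = \prod_(i < N) M 'X^(u i)) /\
  (forall f : T, (forall v, 0 <= meval v f) -> 0 <= E f).

Hypothesis HE : product_mean.

Local Notation onp := (onp M).
Local Notation Xv i := (mpolyX R (mnm1 i)).

Lemma mean_ge0 (f : T) : (forall v, 0 <= meval v f) -> 0 <= E f.
Proof. by case: HE => _; apply. Qed.

Lemma mean_le (f g : T) : (forall v, meval v f <= meval v g) -> E f <= E g.
Proof.
move=> h; rewrite -subr_ge0 -linearB; apply: mean_ge0 => v.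
by rewrite mevalB subr_ge0.
Qed.

Lemma mean_sq_ge0 (f : T) : 0 <= E (f ^+ 2).
Proof. by apply: mean_ge0 => v; rewrite rmorphXn /= sqr_ge0. Qed.

Let EZ c (f : T) : E (c *: f) = c * E f.
Proof. exact: linearZ. Qed.

Let MZ c (p : {poly R}) : M (c *: p) = c * M p.
Proof. exact: linearZ. Qed.

Definition polyv (i : 'I_N) : {poly R} -> T := horner_alg (Xv i).
HB.instance Definition _ i := GRing.LRMorphism.copy (polyv i) (horner_alg (Xv i)).

Lemma polyvZ i c p : polyv i (c *: p) = c *: polyv i p.
Proof. by rewrite /polyv linearZ /= mulr_algl. Qed.

Lemma polyvXn i j : polyv i 'X^j = Xv i ^+ j.
Proof. by rewrite rmorphXn /= /polyv horner_algX. Qed.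

Lemma mderiv_polyv l i p : mderiv l (polyv i p) = (l == i)%:R *: polyv i p^`().
Proof.
elim/poly_ind: p => [|p c IHp]; first by rewrite deriv0 !rmorph0 mderiv0 scaler0.
rewrite derivD derivM derivX derivC addr0 mulr1.
rewrite !rmorphD !rmorphM /= -alg_polyC linearZ /= rmorph1.
rewrite mulr1 mderivD mderivM IHp mderivZ.
rewrite (_ : polyv i 'X = Xv i); last by rewrite /polyv horner_algX.
rewrite -mpolyX0 !mderivX mnm1E mnm0E !scale0r scaler0 addr0.
rewrite eq_sym; case: eqP => [->|_].
  by rewrite !scale1r (_ : (mnm_sub _ _) = @mnm0 N) ?mpolyX0 ?mulr1//; apply/mnmP => k;
    rewrite mnmBE mnm0E subnn.
by rewrite !scale0r mul0r mulr0 addr0.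
Qed.

Lemma mderiv0_msupp i (h : T) u : mderiv i h = 0 -> u \in msupp h -> u i = 0%N.
Proof.
move=> dh uh; apply/eqP; rewrite -leqn0 leqNgt; apply/negP => ui.
have := congr1 (mcoeff (mnm_sub u (mnm1 i))) dh; rewrite mcoeff_deriv mcoeff0.
rewrite submK; last by rewrite lep1mP -lt0n.
by move/eqP; rewrite mulrn_eq0 /= mcoeff_eq0 uh.
Qed.

(** The equation mderiv i h = 0 expresses that h does not involve the i-th variable. *)
Lemma mean_tensor i p h : mderiv i h = 0 -> E (polyv i p * h) = M p * E h.
Proof.
move=> dh.
have key j (u : multinom N) : u i = 0%N ->
  E (Xv i ^+ j * mpolyX R u) = M 'X^j * E (mpolyX R u).
  move=> ui; case: HE => hE _; rewrite mpolyXn -mpolyXD !hE.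
  rewrite (bigD1 i)//= [in RHS](bigD1 i)//= mnmDE mulmnE mnm1E eqxx mul1n ui addn0.
  case: HM => -> _ _; rewrite mul1r; congr (_ * _); apply: eq_bigr => k ki.
  by rewrite mnmDE mulmnE mnm1E eq_sym (negbTE ki) mul0n add0n.
have {}key j : E (Xv i ^+ j * h) = M 'X^j * E h.
  rewrite (mpolyE h) mulr_sumr !linear_sum /= mulr_sumr big_seq [RHS]big_seq.
  apply: eq_bigr => u uh; rewrite -scalerAr !EZ key; last exact: mderiv0_msupp uh.
  by rewrite mulrCA.
rewrite -[p]coefK poly_def !linear_sum /= !mulr_suml linear_sum /=.
apply: eq_bigr => j _; rewrite polyvZ -scalerAl EZ MZ polyvXn.
by rewrite key mulrA.
Qed.

Lemma mean_tensorM i p q h g : mderiv i h = 0 -> mderiv i g = 0 ->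
  E ((polyv i p * h) * (polyv i q * g)) = M (p * q) * E (h * g).
Proof.
move=> dh dg; rewrite -(@mean_tensor i); last by rewrite mderivM dh dg mul0r mulr0 addr0.
by rewrite rmorphM /=; congr (E _); ring.
Qed.

(** A quadratic inequality for M with scalar coefficients extends to coefficients
    that are polynomials in the other variables: it holds at every value of these
    variables, and E is monotone. *)
Lemma mean_tensor_sq_le i D (P : nat -> {poly R}) (k : nat -> R) (h : nat -> T) :
  (forall a, mderiv i (h a) = 0) ->
  (forall c : nat -> R, M ((\sum_(a < D) c a *: P a) ^+ 2) <= \sum_(a < D) k a * c a ^+ 2) ->
  E ((\sum_(a < D) polyv i (P a) * h a) ^+ 2) <= \sum_(a < D) k a * E (h a ^+ 2).
Proof.
move=> dh hP.
have -> : E ((\sum_(a < D) polyv i (P a) * h a) ^+ 2) =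
    E (\sum_(a < D) \sum_(b < D) M (P a * P b) *: (h a * h b)).
  rewrite expr2 mulr_suml !linear_sum /=; apply: eq_bigr => a _.
  rewrite mulr_sumr !linear_sum /=; apply: eq_bigr => b _.
  by rewrite mean_tensorM// EZ.
have -> : \sum_(a < D) k a * E (h a ^+ 2) = E (\sum_(a < D) k a *: h a ^+ 2).
  by rewrite linear_sum /=; apply: eq_bigr => a _; rewrite EZ.
apply: mean_le => v.
have -> : meval v (\sum_(a < D) k a *: h a ^+ 2) = \sum_(a < D) k a * meval v (h a) ^+ 2.
  by rewrite raddf_sum /=; apply: eq_bigr => a _; rewrite mevalZ rmorphXn.
apply: le_trans (hP (fun a => meval v (h a))).
rewrite le_eqVlt; apply/orP; left; apply/eqP.
rewrite expr2 mulr_suml linear_sum raddf_sum /=; apply: eq_bigr => a _.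
rewrite mulr_sumr linear_sum raddf_sum /=; apply: eq_bigr => b _.
by rewrite -scalerAl -scalerAr !MZ mevalZ mevalM; ring.
Qed.

Lemma mean_onp_sq i D (h : nat -> T) : (forall a, mderiv i (h a) = 0) ->
  E ((\sum_(a < D) polyv i (onp a) * h a) ^+ 2) = \sum_(a < D) E (h a ^+ 2).
Proof.
move=> dh; rewrite expr2 mulr_suml linear_sum /=; apply: eq_bigr => a _.
rewrite mulr_sumr linear_sum /= (bigD1 a)//= big1 ?addr0.
  by rewrite mean_tensorM// (onp_orthonormal HM) eqxx mul1r expr2.
move=> b ba; rewrite mean_tensorM// (onp_orthonormal HM).
by rewrite (_ : (_ == _) = false) ?mul0r//; apply/negbTE; rewrite eq_sym.
Qed.

(** Weighted degree.  The weights 0 and 1 select the positions, the momenta, or all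
    the variables. *)
Definition wdeg_le (w : 'I_N -> nat) (d : nat) (f : T) : Prop :=
  forall u, u \in msupp f -> (\sum_i w i * u i <= d)%N.

Lemma wdeg_le_sum (w : 'I_N -> nat) d (I : Type) (r : seq I) (P : pred I) (F : I -> T) :
  (forall i, P i -> wdeg_le w d (F i)) -> wdeg_le w d (\sum_(i <- r | P i) F i).
Proof.
move=> hF u; elim: r => [|j r IHr]; first by rewrite big_nil msupp0 in_nil.
rewrite big_cons; case: ifP => // Pj /msuppD_le; rewrite mem_cat => /orP[|//].
exact: hF.
Qed.

Lemma wdeg_leZ w d c f : wdeg_le w d f -> wdeg_le w d (c *: f).
Proof. by move=> hf u /msuppZ_le; exact: hf. Qed.

Definition kill (i : 'I_N) (u : multinom N) : multinom N :=
  Multinom [tuple if l == i then 0%N else u l | l < N].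

Lemma killE i u l : kill i u l = if l == i then 0%N else u l.
Proof. exact: mnmE. Qed.

Lemma mpolyX_kill i u : mpolyX R u = Xv i ^+ u i * mpolyX R (kill i u).
Proof.
rewrite mpolyXn -mpolyXD; congr (mpolyX R _); apply/mnmP => l.
rewrite mnmDE mulmnE mnm1E killE eq_sym.
by case: eqP => [->|_]; rewrite ?mul1n ?mul0n ?addn0.
Qed.

(** Coefficients of f in the basis p_a(X_i), with values in the polynomials in the other
    variables. *)
Definition onp_coef (i : 'I_N) (f : T) (a : nat) : T :=
  \sum_(u <- msupp f) (mcoeff u f * M ('X^(u i) * onp a)) *: mpolyX R (kill i u).

Lemma onp_decomp i D f : (forall u, u \in msupp f -> (u i < D)%N) ->
  f = \sum_(a < D) polyv i (onp a) * onp_coef i f a.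
Proof.
move=> hD; rewrite {1}(mpolyE f) /onp_coef.
under [RHS]eq_bigr do rewrite mulr_sumr.
rewrite exchange_big /= big_seq [RHS]big_seq; apply: eq_bigr => u uf.
have -> : mpolyX R u = polyv i 'X^(u i) * mpolyX R (kill i u).
  by rewrite {1}(mpolyX_kill i u) polyvXn.
have := @onp_expand _ _ _ HM D 'X^(u i); rewrite size_polyXn => /(_ (hD _ uf)) {1}->.
rewrite linear_sum /= mulr_suml scaler_sumr; apply: eq_bigr => a _.
by rewrite polyvZ -scalerAl scalerA -scalerAr.
Qed.

Lemma mderiv_onp_coef i f a : mderiv i (onp_coef i f a) = 0.
Proof.
rewrite raddf_sum /= big1// => u _; rewrite mderivZ mderivX killE eqxx.
by rewrite scale0r scaler0.
Qed.

Lemma mderiv_onp_coef0 l i f a : mderiv l f = 0 -> mderiv l (onp_coef i f a) = 0.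
Proof.
move=> df; rewrite raddf_sum /= big_seq big1// => u uf; rewrite mderivZ mderivX killE.
by rewrite (mderiv0_msupp df uf); case: ifP; rewrite scale0r scaler0.
Qed.

Lemma wdeg_onp_coef w d i f a : wdeg_le w d f -> wdeg_le w (d - w i * a) (onp_coef i f a).
Proof.
move=> hf; rewrite /onp_coef big_seq; apply: wdeg_le_sum => u uf.
have [ua|au] := ltnP (u i) a.
  rewrite (onp_orth_small HM) ?size_polyXn// mulr0 scale0r.
  by move=> u'; rewrite msupp0.
apply: wdeg_leZ => u' /mem_msuppXP <-.
have := hf u uf; rewrite (bigD1 i)//= => h.
rewrite (bigD1 i)//= killE eqxx muln0 add0n.
rewrite (eq_bigr (fun l => w l * u l)%N); last by move=> l li; rewrite killE (negbTE li).
apply: (@leq_trans (d - w i * u i)); first by rewrite leq_subRL ?(leq_trans (leq_addr _ _) h).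
by rewrite leq_sub2l// leq_mul2l au orbT.
Qed.

(** * Gradient estimate and comparison of moments *)

Local Notation deriv_const := (deriv_const R m).
Local Notation deriv_scale := (deriv_scale R m).
Local Notation onp_mul_const := (onp_mul_const R m).

Let ED (f g : T) : E (f + g) = E f + E g.
Proof. exact: linearD. Qed.

Lemma mevalXn v (f : T) k : meval v (f ^+ k) = meval v f ^+ k.
Proof. exact: rmorphXn. Qed.

Let mderivXn_eq0 l i p h : l != i -> mderiv l (polyv i p * h) = polyv i p * mderiv l h.
Proof.
by move=> /negPf li; rewrite mderivM mderiv_polyv li scale0r mul0r add0r.
Qed.

Lemma wdeg_leW w d e f : (d <= e)%N -> wdeg_le w d f -> wdeg_le w e f.
Proof. by move=> de hf u /hf /leq_trans; apply. Qed.

(** Induction over the variables.  Expand f = sum_a p_a(X_i) h_a in the first one.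
    If X_i counts for the degree, then h_a has degree at most d - a: the derivative in X_i
    contributes a and the remaining ones at most d - a, which add up to d.  Therefore the
    constant does not depend on the number of variables. *)
Lemma grad_le (w : 'I_N -> bool) L s d f : uniq s ->
  (forall l, l \notin s -> mderiv l f = 0) -> wdeg_le w d f -> (d <= L)%N ->
  \sum_(l <- s | w l) E (mderiv l f ^+ 2) <= deriv_const * (d%:R * deriv_scale L) * E (f ^+ 2).
Proof.
elim: s d f => [|i s IHs] d f.
  by move=> _ _ _ _; rewrite big_nil !mulr_ge0 ?deriv_const_ge0 ?deriv_scale_ge0 ?mean_sq_ge0.
move=> /= /andP[ins us] hs hf dL.
pose h := onp_coef i f; have dh a : mderiv i (h a) = 0 by exact: mderiv_onp_coef.
(* If X_i has weight 0, any bound on its degree will do. *)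
pose D := if w i then d.+1 else (\max_(u <- msupp f) u i).+1.
have hD u : u \in msupp f -> (u i < D)%N.
  move=> uf; rewrite /D; case: ifP => wi; last by rewrite ltnS (big_rem u uf) /= leq_maxl.
  by have := hf u uf; rewrite (bigD1 i)//= wi mul1n ltnS => /(leq_trans (leq_addr _ _)).
have ef := onp_decomp hD; rewrite -/h in ef.
have hs' a l : l \notin s -> mderiv l (h a) = 0.
  move=> ls; have [->|li] := eqVneq l i; first exact: dh.
  by apply: mderiv_onp_coef0; apply: hs; rewrite inE negb_or li.
have IH a : \sum_(l <- s | w l) E (mderiv l (h a) ^+ 2) <=
    deriv_const * ((d - w i * a)%:R * deriv_scale L) * E (h a ^+ 2).
  apply: IHs => //; first exact: hs'.
    exact: wdeg_onp_coef.
  by apply: leq_trans dL; exact: leq_subr.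
have eE : E (f ^+ 2) = \sum_(a < D) E (h a ^+ 2) by rewrite {1}ef mean_onp_sq.
have h1 : \sum_(l <- s | w l) E (mderiv l f ^+ 2) <=
    \sum_(a < D) deriv_const * ((d - w i * a)%:R * deriv_scale L) * E (h a ^+ 2).
  rewrite [leLHS](_ : _ = \sum_(a < D) \sum_(l <- s | w l) E (mderiv l (h a) ^+ 2)).
    by apply: ler_sum => a _; exact: IH.
  rewrite exchange_big /= big_seq_cond [RHS]big_seq_cond; apply: eq_bigr => l /andP[ls _].
  rewrite {1}ef raddf_sum /= -(@mean_onp_sq i D (fun a => mderiv l (h a))).
    congr (E (_ ^+ 2)); apply: eq_bigr => a _.
    by rewrite mderivXn_eq0//; apply: contraNneq ins => <-.
  by move=> a; rewrite mderiv_comm dh mderiv0.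
rewrite big_cons; case: ifP => wi; last first.
  apply: (le_trans h1); rewrite eE mulr_sumr; apply: ler_sum => a _.
  by rewrite wi mul0n subn0.
have h2 : E (mderiv i f ^+ 2) <=
  \sum_(a < D) (deriv_const * (a%:R * deriv_scale L)) * E (h a ^+ 2).
  rewrite {1}ef raddf_sum /=.
  have -> : \sum_(a < D) mderiv i (polyv i (onp a) * h a) =
     \sum_(a < D) polyv i (onp a)^`() * h a.
    by apply: eq_bigr => a _; rewrite mderivM dh mulr0 addr0 mderiv_polyv eqxx scale1r.
  apply: (@mean_tensor_sq_le i D (fun a => (onp a)^`())
    (fun a => deriv_const * (a%:R * deriv_scale L))) => // c.
  have := @deriv_comb_le R m m0 M HM L D c; rewrite /D wi ltnS => /(_ dL).
  rewrite raddf_sum /= (eq_bigr (fun a : 'I_d.+1 => c a *: (onp a)^`())).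
    by rewrite mulr_sumr => /le_trans; apply; apply: ler_sum => a _; rewrite !mulrA.
  by move=> a _; rewrite derivZ.
apply: (le_trans (lerD h2 h1)); rewrite -big_split /= eE mulr_sumr.
apply: ler_sum => a _; rewrite wi mul1n -mulrDl -mulrDr -mulrDl -natrD subnKC//.
by have := ltn_ord a; rewrite {2}/D wi ltnS.
Qed.

(** Iterate (x + y)^4 <= 8 x^4 + 8 y^4; the geometric weights are affordable because
    the a-th term has degree at least a. *)
Lemma sum_pow4_le n (t : nat -> R) : (\sum_(a < n) t a) ^+ 4 <=
  \sum_(a < n) 8 ^+ a.+1 * t a ^+ 4.
Proof.
elim: n t => [|n IHn] t; first by rewrite !big_ord0 expr0n.
rewrite !big_ord_recl /= expr1; set S := \sum_(i < n) _.
have hS : S ^+ 4 <= \sum_(i < n) 8 ^+ i.+1 * t (bump 0 i) ^+ 4 by exact: IHn (fun i => t i.+1).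
have -> : \sum_(i < n) 8 ^+ (bump 0 i).+1 * t (bump 0 i) ^+ 4 =
   8 * \sum_(i < n) 8 ^+ i.+1 * t (bump 0 i) ^+ 4.
  by rewrite mulr_sumr; apply: eq_bigr => i _; rewrite mulrA -exprS.
apply: (@le_trans _ _ (8 * t 0 ^+ 4 + 8 * S ^+ 4)); last by rewrite lerD2l ler_pM2l.
clear hS IHn; move: S (t 0%N) => x y.
have h1 : (y + x) ^+ 2 <= 2 * (y ^+ 2 + x ^+ 2) by have := sqr_ge0 (y - x); nra.
have h2 : ((y + x) ^+ 2) ^+ 2 <= (2 * (y ^+ 2 + x ^+ 2)) ^+ 2.
  by rewrite lerXn2r ?nnegrE ?sqr_ge0// mulr_ge0// addr_ge0 ?sqr_ge0.
rewrite (exprM _ 2 2); apply: (le_trans h2); rewrite (exprM y 2 2) (exprM x 2 2).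
have := sqr_ge0 (y ^+ 2 - x ^+ 2); move: (y ^+ 2) (x ^+ 2) => u z; nra.
Qed.

Definition fourth_const : R := 128 * (onp_mul_const * 4).

Lemma fourth_const_ge1 : 1 <= fourth_const.
Proof. by have := onp_mul_const_ge1 R m0; rewrite /fourth_const; lra. Qed.

Lemma mean1 : E 1 = 1.
Proof.
case: HE => hE _; rewrite -mpolyX0 hE big1// => i _; rewrite mnm0E expr0.
by case: HM.
Qed.

(** Used when no variable is left. *)
Lemma mpoly_const (f : T) : (forall l, mderiv l f = 0) -> exists c, f = c *: 1.
Proof.
move=> hf; exists (\sum_(u <- msupp f) mcoeff u f).
rewrite {1}(mpolyE f) scaler_suml; apply: eq_big_seq => u uf.
rewrite (_ : u = @mnm0 N) ?mpolyX0//; apply/mnmP => l; rewrite mnm0E.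
by apply: mderiv0_msupp uf.
Qed.

Lemma mderivX_eq0 i (h : T) k : mderiv i h = 0 -> mderiv i (h ^+ k) = 0.
Proof.
move=> dh; elim: k => [|k IHk]; first by rewrite expr0 -mpolyX0 mderivX mnm0E scale0r.
by rewrite exprS mderivM dh IHk mul0r mulr0 addr0.
Qed.

Lemma sum_sqr_le n (x : nat -> R) : (forall a, 0 <= x a) ->
  \sum_(a < n) x a ^+ 2 <= (\sum_(a < n) x a) ^+ 2.
Proof.
move=> x0; elim: n => [|n IHn]; first by rewrite !big_ord0 expr0n.
rewrite !big_ord_recr /=; have := x0 n.
have : 0 <= \sum_(a < n) x a by exact: sumr_ge0.
move: IHn; set A := \sum_(a < n) _ ^+ 2; set B := \sum_(a < n) _; nra.
Qed.

(** Induction over the variables, as for hypercontractivity.  Expand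
    f = h_0 + g, g = sum_(a >= 1) p_a(X_i) h_a.  The term h_0^3 g has mean zero, g^4 is
    estimated termwise with the fourth moments of p_a, and the loss 8^a K^a is paid
    by the degree d - a of h_a.  The numerical constant is large enough to make the
    inequality for f hold with no additional loss. *)
Lemma mean_fourth_le s d f : uniq s ->
  (forall l, l \notin s -> mderiv l f = 0) -> wdeg_le (fun=> 1%N) d f ->
  E (f ^+ 4) <= fourth_const ^+ d * E (f ^+ 2) ^+ 2.
Proof.
have e16 : 8 * (onp_mul_const * 4) = fourth_const / 16 by rewrite /fourth_const; field.
(* The 8 pays for sum_pow4_le, the 16 for the mixed term h_0^2 g^2. *)
move: fourth_const fourth_const_ge1 e16 => H k1 e16.
have k0 : 0 <= H by exact: le_trans k1.
elim: s d f => [|i s IHs] d f.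
  move=> _ hs _; have [c ->] := mpoly_const (fun l => hs l isT).
  rewrite !exprZn !expr1n !EZ mean1 !mulr1 -exprM ler_peMl ?exprn_ege1//.
  by rewrite (exprM _ 2 2) sqr_ge0.
move=> /= /andP[ins us] hs hf.
pose h := onp_coef i f; have dh a : mderiv i (h a) = 0 by exact: mderiv_onp_coef.
have hD u : u \in msupp f -> (u i < d.+1)%N.
  by move=> uf; have := hf u uf;
    rewrite (bigD1 i)//= mul1n ltnS => /(leq_trans (leq_addr _ _)).
have ef := onp_decomp hD; rewrite -/h in ef.
have hs' a l : l \notin s -> mderiv l (h a) = 0.
  move=> ls; have [->|li] := eqVneq l i; first exact: dh.
  by apply: mderiv_onp_coef0; apply: hs; rewrite inE negb_or li.
have IH a : E (h a ^+ 4) <= H ^+ (d - a) * E (h a ^+ 2) ^+ 2.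
  apply: IHs => //; first exact: hs'.
  by have := @wdeg_onp_coef _ d i f a hf; rewrite mul1n.
have eE : E (f ^+ 2) = \sum_(a < d.+1) E (h a ^+ 2) by rewrite {1}ef mean_onp_sq.
pose g : T := \sum_(a < d) polyv i (onp a.+1) * h a.+1.
have efg : f = h 0 + g.
  by rewrite {1}ef big_ord_recl /= (onp0 HM) rmorph1 mul1r.
set v0 := E (h 0 ^+ 2); pose V := \sum_(a < d) E (h a.+1 ^+ 2).
have eEV : E (f ^+ 2) = v0 + V by rewrite eE big_ord_recl.
have v00 : 0 <= v0 by exact: mean_sq_ge0.
have V0 : 0 <= V by apply: sumr_ge0 => a _; exact: mean_sq_ge0.
have hg : E (g ^+ 4) <= H ^+ d / 16 * V ^+ 2.
  apply: (@le_trans _ _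
    (E (\sum_(a < d) 8 ^+ a.+1 *: (polyv i (onp a.+1 ^+ 4) * h a.+1 ^+ 4)))).
    apply: mean_le => v; rewrite rmorphXn /= !raddf_sum /=.
    apply: le_trans (sum_pow4_le d (fun a => meval v (polyv i (onp a.+1) * h a.+1))) _.
    rewrite le_eqVlt; apply/orP; left; apply/eqP; apply: eq_bigr => a _.
    by rewrite mevalZ rmorphXn /= -exprMn [in RHS]rmorphXn.
  apply: (@le_trans _ _ (\sum_(a < d) H ^+ d / 16 * E (h a.+1 ^+ 2) ^+ 2)).
    rewrite linear_sum /=; apply: ler_sum => a _; rewrite EZ mean_tensor; last first.
      exact: mderivX_eq0.
    have h4 := onp_fourth_moment m0 HM a.+1.
    have v2 : 0 <= E (h a.+1 ^+ 2) ^+ 2 by exact: sqr_ge0.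
    have k30 : 0 <= onp_mul_const * 4
      by rewrite mulr_ge0// (le_trans _ (onp_mul_const_ge1 R m0)).
    have E4 : 0 <= E (h a.+1 ^+ 4) by rewrite (exprM _ 2 2) mean_sq_ge0.
    apply: (@le_trans _ _
      (8 ^+ a.+1 * ((onp_mul_const * 4) ^+ a.+1 * (H ^+ (d - a.+1) * E (h a.+1 ^+ 2) ^+ 2)))).
      rewrite ler_wpM2l ?exprn_ge0//; apply: ler_pM => //.
      by rewrite (exprM _ 2 2); exact: (functional_sq_ge0 HM).
    move: (E (h a.+1 ^+ 2) ^+ 2) (onp_mul_const * 4) v2 e16 {h4 k30} => X k X0 e16.
    have -> : 8 ^+ a.+1 * (k ^+ a.+1 * (H ^+ (d - a.+1) * X)) =
        (8 * k) ^+ a.+1 * H ^+ (d - a.+1) * X by rewrite exprMn; ring.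
    rewrite ler_wpM2r// e16 exprMn mulrAC -exprD subnKC//.
    rewrite ler_wpM2l ?exprn_ge0// exprS ger_pMr ?invr_gt0//.
    by rewrite exprn_ile1 ?invr_ge0// invf_le1// ler1n.
  rewrite -mulr_sumr ler_wpM2l ?mulr_ge0 ?exprn_ge0//.
  by apply: (@sum_sqr_le d (fun a => E (h a.+1 ^+ 2))) => a; exact: mean_sq_ge0.
have hh0 : E (h 0 ^+ 4) <= H ^+ d * v0 ^+ 2 by have := IH 0%N; rewrite subn0.
have k0d : 0 <= H ^+ d by exact: exprn_ge0.
have hcross : E (h 0 ^+ 2 * g ^+ 2) <= H ^+ d / 4 * (v0 * V).
  have := linform_cauchy_schwarz mean_sq_ge0 (h 0 ^+ 2) (g ^+ 2).
  rewrite -!exprM => hcs.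
  have : E (h 0 ^+ 2 * g ^+ 2) ^+ 2 <= (H ^+ d / 4 * (v0 * V)) ^+ 2.
    apply: (le_trans hcs).
    rewrite (_ : _ ^+ 2 = (H ^+ d * v0 ^+ 2) * (H ^+ d / 16 * V ^+ 2)); last by field.
    by apply: ler_pM => //; rewrite (exprM _ 2 2) mean_sq_ge0.
  rewrite ler_sqr ?nnegrE//; last by rewrite !mulr_ge0.
  by rewrite -exprMn mean_sq_ge0.
(* p_(a+1) is orthogonal to constants and h_0, h_(a+1) are free of X_i. *)
have h3 : E (h 0 ^+ 3 * g) = 0.
  rewrite /g mulr_sumr linear_sum /= big1// => a _; rewrite mulrCA mean_tensor.
    rewrite -[onp a.+1]mul1r -(onp0 HM) (onp_orthonormal HM) mul0r//.
  by rewrite mderivM mderivX_eq0// dh mul0r mulr0 addr0.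
have : E (f ^+ 4) <=
  E (h 0 ^+ 4) + 4 * E (h 0 ^+ 3 * g) + 8 * E (h 0 ^+ 2 * g ^+ 2) + 3 * E (g ^+ 4).
  pose Q : T := h 0%N ^+ 4 + 4 *: (h 0%N ^+ 3 * g) + 8 *: (h 0%N ^+ 2 * g ^+ 2) + 3 *: g ^+ 4.
  suff: E (f ^+ 4) <= E Q by rewrite /Q !ED !EZ.
  apply: mean_le => v.
  rewrite efg /Q !(mevalD, mevalZ, mevalXn, mevalM).
  move: (meval v (h 0%N)) (meval v g) => x y.
  (* (x + y)^4 = x^4 + 4 x^3 y + 6 x^2 y^2 + 4 x y^3 + y^4, and 4 x y^3 <= 2 x^2 y^2 + 2 y^4. *)
  rewrite -subr_ge0 (_ : _ - _ = 2 * (y * (x - y)) ^+ 2); last by ring.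
  by rewrite mulr_ge0// sqr_ge0.
move=> /le_trans; apply; rewrite h3 mulr0 addr0 eEV.
have : 0 <= H ^+ d * V ^+ 2 by rewrite mulr_ge0// sqr_ge0.
rewrite (_ : H ^+ d * (v0 + V) ^+ 2 =
  H ^+ d * v0 ^+ 2 + 8 * (H ^+ d / 4 * (v0 * V)) + H ^+ d * V ^+ 2); last by field.
move: hg hh0 hcross; rewrite (_ : H ^+ d / 16 * V ^+ 2 = (H ^+ d * V ^+ 2) / 16); last
  by field.
lra.
Qed.

(** * Adjoints of the derivatives *)

Let Esum (I : Type) (r : seq I) (P : pred I) (F : I -> T) :
  E (\sum_(i <- r | P i) F i) = \sum_(i <- r | P i) E (F i).
Proof. exact: linear_sum. Qed.

Definition potential' (i : 'I_N) : T := (2 * m)%:R *: Xv i ^+ (2 * m).-1.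

Let Epot i g : E (potential' i * g) = (2 * m)%:R * E (Xv i ^+ (2 * m).-1 * g).
Proof. by rewrite /potential' -scalerAl EZ. Qed.

Lemma mean_ibp i (f : T) : E (mderiv i f) = E (potential' i * f).
Proof.
rewrite (mpolyE f) [mderiv i _]raddf_sum mulr_sumr !Esum; apply: eq_bigr => u _ /=.
rewrite mderivZ -scalerAr !EZ; congr (_ * _).
have -> : mpolyX R u = polyv i 'X^(u i) * mpolyX R (kill i u).
  by rewrite {1}(mpolyX_kill i u) polyvXn.
have dk : mderiv i (mpolyX R (kill i u)) = 0.
  by rewrite mderivX killE eqxx scale0r.
rewrite mderivM dk mulr0 addr0 mderiv_polyv eqxx scale1r mean_tensor//.
case: HM => _ _ ->; rewrite Epot -polyvXn [_ * (polyv i _ * _)]mulrA -rmorphM.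
by rewrite mean_tensor// mulrA.
Qed.

(** Adjoint of d/dX_i in L^2 of the product measure. *)
Definition adj (i : 'I_N) (g : T) : T := potential' i * g - mderiv i g.

Lemma mean_adj i f g : E (mderiv i f * g) = E (f * adj i g).
Proof.
have := mean_ibp i (f * g); rewrite mderivM ED => h.
rewrite /adj mulrBr linearB /= mulrCA -h; lra.
Qed.

Lemma mderiv_potential' l i : mderiv l (potential' i) =
  (l == i)%:R *: ((2 * m)%:R * (2 * m).-1%:R *: Xv i ^+ (2 * m - 2)).
Proof.
rewrite /potential' mderivZ -!polyvXn mderiv_polyv derivXn.
rewrite -['X^_ *+ _]scaler_nat polyvZ !scalerA subn2; congr (_ *: _); ring.
Qed.

Lemma mderiv_adj l i g : mderiv l (adj i g) =
  mderiv l (potential' i) * g + adj i (mderiv l g).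
Proof. by rewrite /adj mderivB mderivM mderiv_comm addrA. Qed.

Lemma wdeg_leD w d f g : wdeg_le w d f -> wdeg_le w d g -> wdeg_le w d (f + g).
Proof.
by move=> hf hg u /msuppD_le; rewrite mem_cat => /orP[/hf|/hg].
Qed.

Lemma wdeg_leN w d f : wdeg_le w d f -> wdeg_le w d (- f).
Proof. by move=> hf; rewrite -scaleN1r; apply: wdeg_leZ. Qed.

Lemma wdeg_leM w d e f g : wdeg_le w d f -> wdeg_le w e g -> wdeg_le w (d + e) (f * g).
Proof.
move=> hf hg u /msuppM_le /allpairsP[[u1 u2] /= [h1 h2 ->]].
apply: leq_trans (leq_add (hf _ h1) (hg _ h2)).
by rewrite -big_split /=; apply: leq_sum => i _; rewrite mnmDE mulnDr.
Qed.

Lemma wdeg_le1 w : wdeg_le w 0 1.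
Proof.
move=> u; rewrite msupp1 inE => /eqP ->.
by rewrite big1// => i _; rewrite mnm0E muln0.
Qed.

Lemma wdeg_leX w d f k : wdeg_le w d f -> wdeg_le w (d * k) (f ^+ k).
Proof.
move=> hf; elim: k => [|k IHk]; first by rewrite muln0 expr0; exact: wdeg_le1.
by rewrite exprS mulnS; apply: wdeg_leM.
Qed.

Lemma wdeg_le_var w i : wdeg_le w (w i) (Xv i).
Proof.
move=> u /mem_msuppXP <-; rewrite (bigD1 i)//= mnm1E eqxx muln1 big1 ?addn0// => l li.
by rewrite mnm1E eq_sym (negbTE li) muln0.
Qed.

Lemma wdeg_le_deriv w d i f : wdeg_le w d f -> wdeg_le w d (mderiv i f).
Proof.
move=> hf u; rewrite mcoeff_msupp mcoeff_deriv mulrn_eq0 /= => hu.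
have := hf (mnm_add u (mnm1 i)); rewrite mcoeff_msupp => /(_ hu); apply: leq_trans.
by apply: leq_sum => l _; rewrite leq_mul2l mnmDE leq_addr orbT.
Qed.

Lemma wdeg_le_potential' w i : wdeg_le w (w i * (2 * m).-1) (potential' i).
Proof. by apply: wdeg_leZ; apply: wdeg_leX; exact: wdeg_le_var. Qed.

Lemma wdeg_le_adj w d i f : wdeg_le w d f -> wdeg_le w (d + w i * (2 * m).-1) (adj i f).
Proof.
move=> hf; apply: wdeg_leD.
  by rewrite addnC; apply: wdeg_leM hf; exact: wdeg_le_potential'.
by apply: wdeg_leN; apply: wdeg_leW (leq_addr _ _) _; exact: wdeg_le_deriv.
Qed.

Lemma grad_all_le (w : 'I_N -> bool) L d f : wdeg_le w d f -> (d <= L)%N ->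
  \sum_(l | w l) E (mderiv l f ^+ 2) <= deriv_const * (d%:R * deriv_scale L) * E (f ^+ 2).
Proof.
move=> hf dL; apply: grad_le hf dL; first exact: index_enum_uniq.
by move=> l; rewrite mem_index_enum.
Qed.

Lemma deriv_scale_le_nat e : (0 < e)%N -> deriv_scale e <= e%:R.
Proof.
move=> e0; rewrite -(freud_scaleX R m0 e); apply: ler_weXn2l; first exact: freud_scale_ge1.
by rewrite leq_subr.
Qed.

Lemma grad_crude_le (w : 'I_N -> bool) e f : wdeg_le w e f ->
  \sum_(l | w l) E (mderiv l f ^+ 2) <= deriv_const * e%:R ^+ 2 * E (f ^+ 2).
Proof.
move=> hf; apply: (le_trans (grad_all_le hf (leqnn e))).
rewrite ler_wpM2r ?mean_sq_ge0// ler_wpM2l ?deriv_const_ge0//.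
have [->|e0] := posnP e; first by rewrite mul0r expr0n.
by rewrite expr2 ler_wpM2l// deriv_scale_le_nat.
Qed.

(** Integrate X_i f^2 by parts, and bound 2 X_i f d_i f by (X_i f)^2 + (d_i f)^2. *)
Lemma coord_moment_le (w : 'I_N -> bool) e i f : w i -> wdeg_le w e f ->
  E (Xv i ^+ (2 * m) * f ^+ 2) <= (2 + deriv_const * e%:R ^+ 2) * E (f ^+ 2).
Proof.
move=> wi hf; set Q := E _; set F := E (f ^+ 2).
have hG : E (mderiv i f ^+ 2) <= deriv_const * e%:R ^+ 2 * F.
  apply: le_trans (grad_crude_le hf); rewrite (bigD1 i)//= lerDl.
  by apply: sumr_ge0 => l _; exact: mean_sq_ge0.
have hQ : (2 * m)%:R * Q = E (mderiv i (Xv i * f ^+ 2)).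
  rewrite mean_ibp Epot [_ * (_ * f ^+ 2)]mulrA -exprSr prednK// muln_gt0//.
have dX : mderiv i (Xv i) = 1.
  rewrite mderivX mnm1E eqxx scale1r (_ : mnm_sub _ _ = @mnm0 N) ?mpolyX0//.
  by apply/mnmP => k; rewrite mnmBE mnm0E subnn.
have Q0 : 0 <= Q.
  by apply: mean_ge0 => v;
    rewrite mevalM !mevalXn exprM mulr_ge0 ?sqr_ge0// exprn_ge0// sqr_ge0.
have : (2 * m)%:R * Q <= F + (F + Q) + E (mderiv i f ^+ 2).
  rewrite hQ /F /Q -!ED; apply: mean_le => v.
  rewrite mderivM dX mul1r expr2 mderivM.
  rewrite !(mevalD, mevalXn, mevalM) mevalXU.
  move: (v i) (meval v f) (meval v (mderiv i f)) => x y z.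
  have hx : x ^+ 2 <= 1 + x ^+ (2 * m).
    have := @young_pow R m (x ^+ 2) 1 1 (sqr_ge0 x) ltr01 m0.
    by rewrite !expr1 expr1n invr1 mul1r exprM.
  have := sqr_ge0 (x * y - z); have := sqr_ge0 y.
  have : x ^+ 2 * y ^+ 2 <= (1 + x ^+ (2 * m)) * y ^+ 2 by rewrite ler_wpM2r ?sqr_ge0.
  move: (x ^+ (2 * m)) => X; nra.
have m1 : 2 <= (2 * m)%:R :> R by rewrite ler_nat leq_pmulr.
move=> h; have : 2 * Q <= (2 * m)%:R * Q by rewrite ler_wpM2r.
lra.
Qed.

Lemma potential2_le (w : 'I_N -> bool) e i f : w i -> wdeg_le w e f ->
  E (mderiv i (potential' i) * f ^+ 2) <=
    4 * m%:R ^+ 2 * (3 + deriv_const * e%:R ^+ 2) * E (f ^+ 2).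
Proof.
move=> wi hf; rewrite mderiv_potential' eqxx scale1r -scalerAl EZ.
set S := E _; have hS : S <= (3 + deriv_const * e%:R ^+ 2) * E (f ^+ 2).
  apply: (@le_trans _ _ (E (f ^+ 2) + E (Xv i ^+ (2 * m) * f ^+ 2))); last first.
    by have := coord_moment_le wi hf; lra.
  rewrite -ED; apply: mean_le => v; rewrite !(mevalD, mevalXn, mevalM) mevalXU.
  have := @young_pow R m (v i ^+ 2) 1 m.-1 (sqr_ge0 _) ltr01 (leq_pred m).
  rewrite !expr1n invr1 mul1r -!exprM -subn1 mulnBr muln1 => h.
  by rewrite -[X in _ <= X + _]mul1r -mulrDl ler_wpM2r ?sqr_ge0.
have S0 : 0 <= S.
  apply: mean_ge0 => v; rewrite mevalM !mevalXn mulr_ge0 ?sqr_ge0//.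
  have -> : (2 * m - 2 = 2 * (m - 1))%N by rewrite mulnBr muln1.
  by rewrite exprM exprn_ge0 ?sqr_ge0.
rewrite -[leRHS]mulrA; apply: ler_pM => //.
rewrite natrM (_ : 4 * m%:R ^+ 2 = (2 * m%:R) * (2 * m%:R)); last by ring.
by rewrite ler_wpM2l// -natrM ler_nat leq_pred.
Qed.

(** * The Hamiltonian flow and its iterates *)

Section phase_space.
Context (n : nat) (xi yi : 'I_n -> 'I_N).
Hypotheses (xi_inj : injective xi) (yi_inj : injective yi).
Hypothesis xy_neq : forall i l, xi i != yi l.

Definition pos_var (l : 'I_N) : bool := l \in [set xi i | i in [set: 'I_n]]%SET.
Definition mom_var (l : 'I_N) : bool := l \in [set yi i | i in [set: 'I_n]]%SET.

Let pos_xi i : pos_var (xi i). Proof. by rewrite /pos_var imset_f. Qed.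
Let mom_yi i : mom_var (yi i). Proof. by rewrite /mom_var imset_f. Qed.
Let pos_yi i : pos_var (yi i) = false.
Proof.
by apply/negbTE/negP => /imsetP[l _ e]; move: (xy_neq l i); rewrite -e eqxx.
Qed.
Let mom_xi i : mom_var (xi i) = false.
Proof.
by apply/negbTE/negP => /imsetP[l _ e]; move: (xy_neq i l); rewrite -e eqxx.
Qed.

Let sum_pos (F : 'I_N -> R) : \sum_(l | pos_var l) F l = \sum_i F (xi i).
Proof.
rewrite (big_imset F) /=; last by move=> ? ? _ _; exact: xi_inj.
by apply: eq_bigl => i; rewrite inE.
Qed.

Let sum_mom (F : 'I_N -> R) : \sum_(l | mom_var l) F l = \sum_i F (yi i).
Proof.
rewrite (big_imset F) /=; last by move=> ? ? _ _; exact: yi_inj.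
by apply: eq_bigl => i; rewrite inE.
Qed.

(** Raises the degree in the momenta and lowers it in the positions; [lower] is its
    adjoint. *)
Definition raise (g : T) : T := \sum_(i < n) adj (yi i) (mderiv (xi i) g).
Definition lower (g : T) : T := \sum_(i < n) adj (xi i) (mderiv (yi i) g).

(** The generator of the Hamiltonian flow, see [flowE]. *)
Definition flow (g : T) : T := raise g - lower g.

Lemma mean_raise f g : E (raise f * g) = E (f * lower g).
Proof.
rewrite mulr_suml mulr_sumr !Esum; apply: eq_bigr => i _.
by rewrite mulrC -(mean_adj (yi i)) mulrC (mean_adj (xi i)).
Qed.

Lemma flowE g : flow g = \sum_(i < n)
  (potential' (yi i) * mderiv (xi i) g - potential' (xi i) * mderiv (yi i) g).
Proof.
rewrite /flow /raise /lower -sumrB; apply: eq_bigr => i _.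
by rewrite /adj mderiv_comm opprB addrA subrK.
Qed.

Lemma flowM f g : flow (f * g) = flow f * g + f * flow g.
Proof.
rewrite !flowE mulr_suml mulr_sumr -big_split; apply: eq_bigr => i _ /=.
rewrite !mderivM; ring.
Qed.

Definition raise_const : R := 4 * m%:R ^+ 2 * (3 + deriv_const) + deriv_const.

Lemma raise_const_ge0 : 0 <= raise_const.
Proof. by rewrite addr_ge0 ?deriv_const_ge0// mulr_ge0 ?mulr_ge0 ?sqr_ge0// addr_ge0
  ?deriv_const_ge0. Qed.

(** Commute the adjoint of one momentum derivative past the other momentum
    derivative; the commutator is W''. *)
Lemma mean_adj_cross (h : 'I_n -> T) i l :
  E (adj (yi i) (h i) * adj (yi l) (h l)) =
  (l == i)%:R * E (mderiv (yi i) (potential' (yi i)) * h i ^+ 2) +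
  E (mderiv (yi l) (h i) * mderiv (yi i) (h l)).
Proof.
rewrite -mean_adj mderiv_adj mulrDl ED; congr (_ + _).
  have [->|li] := eqVneq l i; first by rewrite mul1r -mulrA expr2.
  by rewrite mderiv_potential' (inj_eq yi_inj) (negbTE li) scale0r !mul0r -(scale0r 0) EZ
    mul0r.
by rewrite mulrC -mean_adj mulrC.
Qed.

(** The commutation formula reduces the square norm to W''-weighted norms of
    the d_(x_i) g and to the momentum derivatives of the d_(x_i) g.  Both only involve
    the momentum degree e, while the sum over i of the norms of the d_(x_i) g
    is the gradient estimate in the positions. *)
Lemma raise_le L d e g : wdeg_le pos_var d g -> (d <= L)%N -> wdeg_le mom_var e g ->
  E (raise g ^+ 2) <= raise_const * e.+1%:R ^+ 2 * (deriv_const * (L%:R * deriv_scale L)) *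
    E (g ^+ 2).
Proof.
move=> hd dL he; pose h i := mderiv (xi i) g.
have hh i : wdeg_le mom_var e (h i) by exact: wdeg_le_deriv.
have k1 := deriv_const_ge0 R m.
have e1 : e%:R <= e.+1%:R :> R by rewrite ler_nat.
have e2 : (e%:R : R) ^+ 2 <= e.+1%:R ^+ 2 by rewrite lerXn2r ?nnegrE.
have e3 : 1 <= (e.+1%:R : R) ^+ 2 by rewrite exprn_ege1// ler1n.
have hA : \sum_i E (h i ^+ 2) <= deriv_const * (L%:R * deriv_scale L) * E (g ^+ 2).
  apply: (@le_trans _ _ (deriv_const * (d%:R * deriv_scale L) * E (g ^+ 2))).
    by rewrite -(sum_pos (fun l => E (mderiv l g ^+ 2))); exact: grad_all_le.
  by rewrite ler_wpM2r ?mean_sq_ge0// ler_wpM2l// ler_wpM2r ?deriv_scale_ge0// ler_nat.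
rewrite -[X in _ <= X]mulrA;
  apply: (@le_trans _ _ (raise_const * e.+1%:R ^+ 2 * \sum_i E (h i ^+ 2))); last first.
  by rewrite ler_wpM2l// mulr_ge0 ?raise_const_ge0 ?sqr_ge0.
have -> : E (raise g ^+ 2) = \sum_i E (mderiv (yi i) (potential' (yi i)) * h i ^+ 2) +
    \sum_i \sum_l E (mderiv (yi l) (h i) * mderiv (yi i) (h l)).
  rewrite expr2 /raise mulr_suml Esum -big_split; apply: eq_bigr => i _ /=.
  rewrite mulr_sumr Esum (eq_bigr _ (fun l _ => mean_adj_cross h i l)) big_split /=;
    congr (_ + _).
  rewrite (bigD1 i)//= eqxx mul1r big1 ?addr0// => l /negPf ->; by rewrite mul0r.
(* Symmetrize 2 a b <= a^2 + b^2. *)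
have hC : \sum_i \sum_l E (mderiv (yi l) (h i) * mderiv (yi i) (h l)) <=
    \sum_i \sum_l E (mderiv (yi l) (h i) ^+ 2).
  have cs a b : E (a * b) <= (E (a ^+ 2) + E (b ^+ 2)) / 2.
    rewrite ler_pdivlMr// mulrC -EZ -ED; apply: mean_le => v.
    rewrite !(mevalD, mevalZ, mevalXn, mevalM).
    have := sqr_ge0 (meval v a - meval v b); rewrite sqrrB -mulr_natl; lra.
  apply: (@le_trans _ _
    (\sum_i \sum_l (E (mderiv (yi l) (h i) ^+ 2) + E (mderiv (yi i) (h l) ^+ 2)) / 2)).
    by apply: ler_sum => i _; apply: ler_sum => l _; exact: cs.
  rewrite le_eqVlt; apply/orP; left; apply/eqP.
  under eq_bigr do rewrite -mulr_suml big_split /=.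
  rewrite -mulr_suml big_split /= [X in (_ + X) / 2]exchange_big /=; lra.
have hC2 : \sum_i \sum_l E (mderiv (yi l) (h i) ^+ 2) <=
  \sum_i deriv_const * e.+1%:R ^+ 2 * E (h i ^+ 2).
  apply: ler_sum => i _; rewrite -(sum_mom (fun l => E (mderiv l (h i) ^+ 2))).
  apply: (le_trans (grad_crude_le (hh i))).
  by rewrite ler_wpM2r ?mean_sq_ge0// ler_wpM2l.
apply: (le_trans (lerD (ler_sum _ (fun i _ => potential2_le (mom_yi i) (hh i)))
  (le_trans hC hC2))).
rewrite -big_split mulr_sumr; apply: ler_sum => i _ /=.
rewrite -mulrDl ler_wpM2r ?mean_sq_ge0// /raise_const [leRHS]mulrDl lerD2r.
rewrite -[leRHS]mulrA ler_wpM2l ?mulr_ge0 ?sqr_ge0//.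
have : deriv_const * e%:R ^+ 2 <= deriv_const * e.+1%:R ^+ 2 by rewrite ler_wpM2l.
by rewrite mulrDl; lra.
Qed.

Lemma wdeg_raise w c d g : (forall i, (w (yi i) * (2 * m).-1 <= c)%N) ->
  wdeg_le w d g -> wdeg_le w (d + c) (raise g).
Proof.
move=> hw hg; apply: wdeg_le_sum => i _.
apply: (@wdeg_leW _ (d + w (yi i) * (2 * m).-1)); first by rewrite leq_add2l.
by apply: wdeg_le_adj; exact: wdeg_le_deriv.
Qed.

Lemma wdeg_lower w c d g : (forall i, (w (xi i) * (2 * m).-1 <= c)%N) ->
  wdeg_le w d g -> wdeg_le w (d + c) (lower g).
Proof.
move=> hw hg; apply: wdeg_le_sum => i _.
apply: (@wdeg_leW _ (d + w (xi i) * (2 * m).-1)); first by rewrite leq_add2l.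
by apply: wdeg_le_adj; exact: wdeg_le_deriv.
Qed.

(** By duality: E (lower g)^2 = E (raise (lower g)) g, then Cauchy-Schwarz and the
    estimate for raise. *)
Lemma lower_le L d e g : wdeg_le pos_var d g -> (d + (2 * m).-1 <= L)%N ->
  wdeg_le mom_var e g ->
  E (lower g ^+ 2) <= raise_const * e.+1%:R ^+ 2 * (deriv_const * (L%:R * deriv_scale L)) *
    E (g ^+ 2).
Proof.
move=> hd dL he; set B := _ * (deriv_const * _).
have hd' : wdeg_le pos_var (d + (2 * m).-1) (lower g).
  by apply: wdeg_lower hd => i; rewrite pos_xi mul1n.
have he' : wdeg_le mom_var e (lower g).
  by rewrite -(addn0 e); apply: wdeg_lower he => i; rewrite mom_xi.
have h1 := raise_le hd' dL he'; rewrite -/B in h1.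
have h2 : E (lower g ^+ 2) ^+ 2 <= E (raise (lower g) ^+ 2) * E (g ^+ 2).
  rewrite {1}[lower g ^+ 2]expr2 -mean_raise.
  exact: linform_cauchy_schwarz mean_sq_ge0 _ _.
have F0 := mean_sq_ge0 g; have G0 := mean_sq_ge0 (lower g).
have B0 : 0 <= B.
  by rewrite !mulr_ge0 ?raise_const_ge0 ?sqr_ge0 ?deriv_const_ge0 ?deriv_scale_ge0.
move: (E (raise _ ^+ 2)) (E (lower g ^+ 2)) (E (g ^+ 2)) h1 h2 F0 G0 => u x y h1 h2 y0 x0.
have [x1|x1] := ltP 0 x; last by apply: le_trans x1 _; rewrite mulr_ge0.
rewrite -(ler_pM2l x1); apply: (le_trans h2).
by rewrite (_ : x * (B * y) = B * x * y); [rewrite ler_wpM2r|ring].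
Qed.

Lemma wdeg_flow_pos d g : wdeg_le pos_var d g -> wdeg_le pos_var (d + (2 * m).-1) (flow g).
Proof.
move=> hd; apply: wdeg_leD.
  by apply: wdeg_raise hd => i; rewrite pos_yi.
by apply: wdeg_leN; apply: wdeg_lower hd => i; rewrite pos_xi mul1n.
Qed.

Lemma wdeg_flow_mom e g : wdeg_le mom_var e g -> wdeg_le mom_var (e + (2 * m).-1) (flow g).
Proof.
move=> he; apply: wdeg_leD.
  by apply: wdeg_raise he => i; rewrite mom_yi mul1n.
by apply: wdeg_leN; apply: wdeg_lower he => i; rewrite mom_xi.
Qed.

Lemma flow_le L d e g : wdeg_le pos_var d g -> (d + (2 * m).-1 <= L)%N ->
  wdeg_le mom_var e g ->
  E (flow g ^+ 2) <= 4 *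
    (raise_const * e.+1%:R ^+ 2 * (deriv_const * (L%:R * deriv_scale L))) * E (g ^+ 2).
Proof.
move=> hd dL he.
have h1 := raise_le hd (leq_trans (leq_addr _ _) dL) he.
have h2 := lower_le hd dL he.
have : E (flow g ^+ 2) <= 2 * E (raise g ^+ 2) + 2 * E (lower g ^+ 2).
  rewrite -!EZ -ED; apply: mean_le => v; rewrite /flow !(mevalB, mevalD, mevalZ, mevalXn).
  move: (meval v (raise g)) (meval v (lower g)) => a b.
  have := sqr_ge0 (a + b); nra.
lra.
Qed.

Lemma wdeg_iter_pos d g j : wdeg_le pos_var d g ->
  wdeg_le pos_var (d + j * (2 * m).-1) (iter j flow g).
Proof.
move=> hd; elim: j => [|j IHj]; first by rewrite addn0.
by rewrite iterS mulSn addnCA addnC; exact: wdeg_flow_pos.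
Qed.

Lemma wdeg_iter_mom g j : wdeg_le mom_var 0 g ->
  wdeg_le mom_var (j * (2 * m).-1) (iter j flow g).
Proof.
move=> hd; elim: j => [|j IHj] //.
by rewrite iterS mulSn addnC; exact: wdeg_flow_mom.
Qed.

Definition flow_const : R := 4 * raise_const * (2 * m)%:R ^+ 2 * deriv_const.

Lemma flow_const_ge0 : 0 <= flow_const.
Proof. by rewrite !mulr_ge0 ?raise_const_ge0 ?sqr_ge0 ?deriv_const_ge0. Qed.

(** The momentum degree after j steps is j (2m - 1), which yields the factor
    (j + 1)^2 at the j-th step, hence (j!)^2. *)
Lemma iter_flow_le L d g j : wdeg_le pos_var d g -> wdeg_le mom_var 0 g ->
  (d + j * (2 * m).-1 <= L)%N ->
  E (iter j flow g ^+ 2) <=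
    (flow_const * (L%:R * deriv_scale L)) ^+ j * j`!%:R ^+ 2 * E (g ^+ 2).
Proof.
move=> hd he; elim: j => [|j IHj] hL; first by rewrite expr0 fact0 expr1n !mul1r.
have c0 := flow_const_ge0.
have hL' : (d + j * (2 * m).-1 <= L)%N.
  by apply: leq_trans hL; rewrite leq_add2l leq_mul2r leqnSn orbT.
have h := @flow_le L _ _ _ (@wdeg_iter_pos _ _ j hd) _ (@wdeg_iter_mom _ j he).
rewrite iterS; apply: (le_trans (h _)).
  by rewrite -addnA [(j * _ + _)%N]addnC -mulSn.
have G0 : 0 <= L%:R * deriv_scale L :> R by rewrite mulr_ge0 ?deriv_scale_ge0.
set G := L%:R * deriv_scale L in IHj G0 *.
set F := E (g ^+ 2) in IHj *.
apply: (@le_trans _ _ (flow_const * G * j.+1%:R ^+ 2 * E (iter j flow g ^+ 2))).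
  rewrite ler_wpM2r ?mean_sq_ge0// /flow_const.
  have hj : ((j * (2 * m).-1).+1%:R : R) ^+ 2 <= (2 * m)%:R ^+ 2 * j.+1%:R ^+ 2.
    rewrite -exprMn lerXn2r ?nnegrE ?mulr_ge0// -natrM ler_nat.
    have m2 : (0 < 2 * m)%N by rewrite muln_gt0.
    by rewrite mulnS mulnC -addn1 addnC leq_add// leq_mul2r leq_pred orbT.
  have hc : 0 <= 4 * raise_const * deriv_const * G.
    by apply: mulr_ge0 G0; rewrite !mulr_ge0 ?raise_const_ge0 ?deriv_const_ge0.
  have := ler_wpM2l hc hj.
  by congr (_ <= _); ring.
apply: (@le_trans _ _
  (flow_const * G * j.+1%:R ^+ 2 * ((flow_const * G) ^+ j * j`!%:R ^+ 2 * F))).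
  by rewrite ler_wpM2l ?IHj// mulr_ge0 ?sqr_ge0// mulr_ge0.
rewrite factS natrM [(_ * j`!%:R) ^+ 2]exprMn [_ ^+ j.+1]exprS le_eqVlt; apply/orP; left;
  apply/eqP; ring.
Qed.

(** * Taylor polynomials along the flow *)

Lemma flowD f g : flow (f + g) = flow f + flow g.
Proof.
rewrite !flowE -big_split; apply: eq_bigr => i _ /=; rewrite !mderivD; ring.
Qed.

Lemma flowZ c f : flow (c *: f) = c *: flow f.
Proof.
rewrite !flowE scaler_sumr; apply: eq_bigr => i _ /=.
by rewrite !mderivZ -!scalerAr scalerBr.
Qed.

Lemma flow0 : flow 0 = 0.
Proof. by rewrite -[X in flow X](scale0r (0 : T)) flowZ scale0r. Qed.

Lemma flow_sum (I : Type) (r : seq I) (P : pred I) (F : I -> T) :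
  flow (\sum_(i <- r | P i) F i) = \sum_(i <- r | P i) flow (F i).
Proof. by apply: (big_morph flow); [exact: flowD|exact: flow0]. Qed.

Lemma flow1 : flow 1 = 0.
Proof.
have := flowM 1 1; rewrite !mulr1 mul1r => h.
by apply: (@addrI _ (flow 1)); rewrite -h addr0.
Qed.

(** Taylor coefficients of g along the flow; division by j! turns the
    Leibniz rule into a convolution. *)
Definition divided_flow (g : T) (j : nat) : T := (j`!%:R)^-1 *: iter j flow g.

Lemma divided_flow0 g : divided_flow g 0 = g.
Proof. by rewrite /divided_flow fact0 invr1 scale1r. Qed.

Lemma divided_flow1 g : divided_flow g 1 = flow g.
Proof. by rewrite /divided_flow factS fact0 invr1 scale1r. Qed.

Lemma divided_flowS g j : j.+1%:R *: divided_flow g j.+1 = flow (divided_flow g j).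
Proof.
rewrite /divided_flow flowZ -iterS scalerA factS natrM invfM mulrA divff ?mul1r ?pnatr_eq0//.
Qed.

Lemma divided_flow_one l : divided_flow 1 l = (l == 0)%:R.
Proof.
case: l => [|l]; first by rewrite divided_flow0.
by rewrite /divided_flow iterSr flow1 (_ : iter l flow 0 = 0) ?scaler0//; elim: l => //= l ->;
  rewrite flow0.
Qed.

Lemma divided_flowM g h l : divided_flow (g * h) l =
  \sum_(i < l.+1) divided_flow g i * divided_flow h (l - i).
Proof.
elim: l => [|l IHl]; first by rewrite big_ord_recl big_ord0 addr0 !divided_flow0.
have l0 : l.+1%:R != 0 :> R by rewrite pnatr_eq0.
apply: (scalerI l0); rewrite divided_flowS IHl flow_sum.
under eq_bigr do rewrite flowM -!divided_flowS.
rewrite big_split /=.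
transitivity (\sum_(i < l.+2) i%:R *: (divided_flow g i * divided_flow h (l.+1 - i)) +
              \sum_(i < l.+2) (l.+1 - i)%:R *: (divided_flow g i * divided_flow h (l.+1 - i))).
  rewrite [X in _ = X + _]big_ord_recl [X in _ = _ + X]big_ord_recr /=.
  rewrite subnn !scale0r add0r addr0; congr (_ + _); apply: eq_bigr => i _ /=.
    by rewrite -scalerAl.
  by rewrite -scalerAr subSn// -ltnS.
rewrite -big_split scaler_sumr; apply: eq_bigr => i _ /=.
by rewrite -scalerDl -natrD subnKC// -ltnS.
Qed.

(** Taylor polynomial of f along the flow, as a polynomial in the time. *)
Definition jet (d : nat) (f : T) : {poly T} := \poly_(j < d.+1) divided_flow f j.

(** Truncation at order d does not affect the coefficients up to d. *)
Lemma coef_jetX d f q l : (l <= d)%N -> (jet d f ^+ q)`_l = divided_flow (f ^+ q) l.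
Proof.
elim: q l => [|q IHq] l ld; first by rewrite !expr0 coef1 divided_flow_one.
rewrite !exprS divided_flowM coefM; apply: eq_bigr => i _.
have il : (i <= l)%N by rewrite -ltnS.
rewrite IHq ?(leq_trans (leq_subr _ _))// coef_poly ltnS.
by rewrite (leq_trans il ld).
Qed.

Lemma wdeg_le0 w d : wdeg_le w d 0.
Proof. by move=> u; rewrite msupp0. Qed.

Lemma wdeg_divided_flow d f j : wdeg_le (fun=> 1%N) d f ->
  wdeg_le (fun=> 1%N) (d + j * (2 * m).-1) (divided_flow f j).
Proof.
move=> hf; apply: wdeg_leZ; elim: j => [|j IHj]; first by rewrite addn0.
rewrite iterS mulSn [(_ + j * _)%N]addnC addnA; apply: wdeg_leD.
  by apply: wdeg_raise IHj => i; rewrite mul1n.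
by apply: wdeg_leN; apply: wdeg_lower IHj => i; rewrite mul1n.
Qed.

Lemma wdeg_polyX w D (P : {poly T}) q l : (forall i, wdeg_le w D P`_i) ->
  wdeg_le w (D * q) (P ^+ q)`_l.
Proof.
move=> hP; elim: q l => [|q IHq] l.
  by rewrite expr0 coef1 muln0; case: eqP => _; [exact: wdeg_le1|exact: wdeg_le0].
by rewrite exprS mulnS coefM; apply: wdeg_le_sum => i _; exact: wdeg_leM.
Qed.

Lemma wdeg_jet d f i : wdeg_le (fun=> 1%N) d f -> wdeg_le (fun=> 1%N) (2 * m * d) (jet d f)`_i.
Proof.
move=> hf; rewrite coef_poly; case: ltnP => [|_]; last exact: wdeg_le0.
rewrite ltnS => id; apply:
  (@wdeg_leW _ (d + i * (2 * m).-1) _ _ _ (@wdeg_divided_flow d f i hf)).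
rewrite -[(2 * m)%N]prednK ?muln_gt0// mulSn /= leq_add2l mulnC.
by rewrite leq_mul2l id orbT.
Qed.

Let fourth d f : wdeg_le (fun=> 1%N) d f -> E (f ^+ 4) <= fourth_const ^+ d * E (f ^+ 2) ^+ 2.
Proof.
apply: (@mean_fourth_le (index_enum _)); first exact: index_enum_uniq.
by move=> l; rewrite mem_index_enum.
Qed.

(** Cauchy-Schwarz and the comparison of the fourth and the second moments. *)
Lemma mean_prod_sq_le D1 D2 f g : wdeg_le (fun=> 1%N) D1 f -> wdeg_le (fun=> 1%N) D2 g ->
  E ((f * g) ^+ 2) <= fourth_const ^+ (D1 + D2) * (E (f ^+ 2) * E (g ^+ 2)).
Proof.
move=> hf hg; have h1 := fourth_const_ge1.
have f0 := mean_sq_ge0 f; have g0 := mean_sq_ge0 g.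
rewrite -(@ler_pXn2r _ 2)// ?nnegrE ?mean_sq_ge0//; last first.
  by rewrite mulr_ge0 ?mulr_ge0// exprn_ge0// (le_trans ler01).
rewrite exprMn; apply: (le_trans (linform_cauchy_schwarz mean_sq_ge0 _ _)).
rewrite -!exprM; apply:
  (@le_trans _ _ ((fourth_const ^+ D1 * E (f ^+ 2) ^+ 2) *
  (fourth_const ^+ D2 * E (g ^+ 2) ^+ 2))).
  by apply: ler_pM; [rewrite exprM mean_sq_ge0|rewrite exprM mean_sq_ge0|exact: fourth|exact:
    fourth].
rewrite mulrACA -exprD -exprMn [leRHS]exprMn ler_wpM2r ?sqr_ge0//.
by rewrite -exprM ler_weXn2l// leq_pmulr.
Qed.

(** One factor per multiplication by the jet: 4^d bounds the squared number of terms,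
    the power of the fourth moment constant bounds the loss for one product. *)
Fixpoint jet_const (q : nat) : R :=
  if q is q'.+1 then 4 * fourth_const ^+ (2 * m * q) * jet_const q' else 1.

Lemma jet_const_ge1 q : 1 <= jet_const q.
Proof.
elim: q => [|q IHq] //=; have h1 := fourth_const_ge1.
have h2 : 1 <= fourth_const ^+ (2 * m * q.+1) by rewrite exprn_ege1.
rewrite -[1]mulr1; apply: ler_pM => //; rewrite -[1]mulr1; apply: ler_pM => //; lra.
Qed.

(** Exponential loss in d only; it is used for the coefficients of order above d. *)
Lemma mean_jetX_crude d f (B : R) q l : wdeg_le (fun=> 1%N) d f -> 0 <= B ->
  (forall j, (j <= d)%N -> E (divided_flow f j ^+ 2) <= B ^+ j * E (f ^+ 2)) ->
  E ((jet d f ^+ q)`_l ^+ 2) <= jet_const q ^+ d * (B ^+ l * E (f ^+ 2) ^+ q).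
Proof.
move=> hf B0 hj; have f0 := mean_sq_ge0 f; have h1 := fourth_const_ge1; have E0 : E 0 = 0
  by exact: linear0.
elim: q l => [|q IHq] l.
  rewrite !expr0 coef1 expr1n mul1r mulr1; case: eqP => [->|_].
    by rewrite expr1n mean1.
  by rewrite expr0n E0 exprn_ge0.
pose Q := jet d f ^+ q.
(* Indexed by the order i <= d in the jet, so that there are d + 1 terms whatever l is. *)
pose F (i : nat) : T := if (l < i)%N then 0 else divided_flow f i * Q`_(l - i).
have -> : (jet d f ^+ q.+1)`_l = \sum_(i < d.+1) F i.
  rewrite exprS -/Q /jet poly_def mulr_suml coef_sum; apply: eq_bigr => i _.
  rewrite -scalerAl coefZ mulrC coefXnM /F; case: ifP => _; first by rewrite mul0r.
  by rewrite mulrC.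
have F1 i : (i <= d)%N -> E (F i ^+ 2) <=
    fourth_const ^+ (2 * m * q.+1) ^+ d * jet_const q ^+ d * (B ^+ l * E (f ^+ 2) ^+ q.+1).
  move=> id; rewrite /F; case: ltnP => [_|il].
    rewrite expr0n /= E0.
    have := jet_const_ge1 q => ?; by rewrite !mulr_ge0 ?exprn_ge0//; lra.
  have hi : wdeg_le (fun=> 1%N) (2 * m * d) (divided_flow f i).
    by have := @wdeg_jet d f i hf; rewrite coef_poly ltnS id.
  have hQ : wdeg_le (fun=> 1%N) (2 * m * d * q) Q`_(l - i).
    by apply: wdeg_polyX => i'; exact: wdeg_jet.
  apply: (le_trans (mean_prod_sq_le hi hQ)).
  rewrite -mulnS -mulnA [(d * q.+1)%N]mulnC mulnA exprM -mulrA ler_wpM2l ?exprn_ge0//.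
    lra.
  apply: (le_trans (ler_pM (mean_sq_ge0 _) (mean_sq_ge0 _) (hj i id) (IHq (l - i)%N))).
  have -> : B ^+ l = B ^+ i * B ^+ (l - i) by rewrite -exprD subnKC.
  rewrite [E _ ^+ q.+1]exprS le_eqVlt; apply/orP; left; apply/eqP; ring.
apply: (@le_trans _ _ (d.+1%:R * \sum_(i < d.+1) E (F i ^+ 2))).
  exact: (linform_sqr_sum_le mean_sq_ge0 (fun i : 'I_d.+1 => F i)).
set K := _ * (_ * _) in F1.
apply: (@le_trans _ _ (d.+1%:R * \sum_(i < d.+1) K)).
  by rewrite ler_wpM2l//; apply: ler_sum => i _; apply: F1; rewrite -ltnS.
have K0 : 0 <= K.
  by apply: le_trans (F1 0%N _) => //; exact: mean_sq_ge0.
rewrite sumr_const card_ord -[K *+ _]mulr_natl [_ * (_ * K)]mulrA -natrM.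
apply: (@le_trans _ _ ((2 ^ d * 2 ^ d)%:R * K)).
  by rewrite ler_wpM2r// ler_nat leq_mul// ltn_expl.
rewrite -expnMn natrX /K /= -/(jet_const q) !exprMn le_eqVlt; apply/orP; left; apply/eqP; ring.
Qed.

(** Tangent at the mean. *)
Lemma mean_pow_le (t : T) k : (forall v, 0 <= meval v t) -> E t ^+ k <= E (t ^+ k).
Proof.
move=> t0; have s0 : 0 <= E t by exact: mean_ge0.
have -> : E t ^+ k = E (E t ^+ k *: 1 + (k%:R * E t ^+ k.-1) *: (t - E t *: 1)).
  by rewrite ED !EZ linearB /= EZ mean1 !mulr1 subrr mulr0 addr0.
apply: mean_le => v; rewrite !(mevalD, mevalN, mevalZ, mevalXn, meval1) !mulr1.
exact: tangent_pow.
Qed.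

(** The degree budget L = (k + 2m) d is enough for d iterations applied to f^k. *)
Definition flow_rate (k d : nat) : R :=
  let L := ((k + 2 * m) * d)%N in flow_const * (L%:R * deriv_scale L).

Lemma flow_rate_ge0 k d : 0 <= flow_rate k d.
Proof. by rewrite mulr_ge0 ?flow_const_ge0// mulr_ge0 ?deriv_scale_ge0. Qed.

Lemma mean_divided_flow_le k d f j : (0 < k)%N -> wdeg_le pos_var (d * k) f ->
  wdeg_le mom_var 0 f ->
  (j <= d)%N -> E (divided_flow f j ^+ 2) <= flow_rate k d ^+ j * E (f ^+ 2).
Proof.
move=> k0 hd he jd; rewrite /divided_flow exprZn EZ.
have fn0 : 0 < (j`!)%:R ^- 1 ^+ 2 :> R by rewrite exprn_gt0// invr_gt0 ltr0n fact_gt0.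
have := @iter_flow_le ((k + 2 * m) * d) _ f j hd he.
rewrite mulnDl [(k * d)%N]mulnC => /(_ _)/wrap[].
  by rewrite leq_add2l mulnC leq_mul// leq_pred.
rewrite -(ler_pM2l fn0) => /le_trans; apply.
rewrite /flow_rate mulnDl [(k * d)%N]mulnC.
rewrite (_ : _ * (_ * E _) =
  (j`!%:R^-1 * j`!%:R) ^+ 2 *
  ((flow_const * ((d * k + 2 * m * d)%:R * deriv_scale (d * k + 2 * m * d))) ^+ j *
  E (f ^+ 2))); last by ring.
by rewrite mulVf ?expr1n ?mul1r// pnatr_eq0 -lt0n fact_gt0.
Qed.

(** Up to order d the coefficient is a Taylor coefficient of f^k; beyond d the
    loss C^d of the crude bound is at most C^l. *)
Lemma mean_jetX_le k d f l : (0 < k)%N -> wdeg_le (fun=> 1%N) d f ->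
  wdeg_le pos_var d f -> wdeg_le mom_var 0 f ->
  E ((jet d f ^+ k)`_l ^+ 2) <= (jet_const k * flow_rate k d) ^+ l * E (f ^+ (2 * k)).
Proof.
move=> k0 ht hd he; have J1 := jet_const_ge1 k; have B0 := flow_rate_ge0 k d.
have F0 : 0 <= E (f ^+ (2 * k)) by rewrite mulnC exprM mean_sq_ge0.
rewrite exprMn; have [ld|dl] := leqP l d.
  rewrite coef_jetX//; apply: (le_trans (@mean_divided_flow_le k d _ l k0 _ _ ld)).
  - exact: wdeg_leX.
  - by rewrite -(mul0n k); exact: wdeg_leX.
  rewrite -exprM [(k * 2)%N]mulnC ler_wpM2r// ler_peMl ?exprn_ge0//.
  by rewrite exprn_ege1.
have hd' : wdeg_le pos_var (d * k) f by apply: wdeg_leW hd; rewrite leq_pmulr.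
apply: (le_trans (mean_jetX_crude k l ht B0 (fun j => mean_divided_flow_le k0 hd' he))).
rewrite -mulrA; apply: ler_pM.
- by rewrite exprn_ge0// (le_trans ler01).
- by rewrite mulr_ge0 ?exprn_ge0// mean_sq_ge0.
- by rewrite ler_weXn2l// ltnW.
rewrite ler_wpM2l ?exprn_ge0// exprM; apply: mean_pow_le => v.
by rewrite mevalXn sqr_ge0.
Qed.

Lemma flow_const_gt0 : 0 < flow_const.
Proof.
have m1 : 0 < m%:R ^+ 2 :> R by rewrite exprn_gt0// ltr0n.
have m2 : 0 < (2 * m)%:R ^+ 2 :> R by rewrite exprn_gt0// ltr0n muln_gt0.
have k1 : 0 < deriv_const by rewrite mulr_gt0// mulr_gt0.
have c1 : 0 < raise_const.
  by move: m1; rewrite /raise_const; set a := _ ^+ 2 => a0; nra.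
by rewrite /flow_const mulr_gt0// mulr_gt0// mulr_gt0.
Qed.

Lemma flow_rate_gt0 k d : (0 < d)%N -> 0 < flow_rate k d.
Proof.
move=> d0; have L0 : (0 < (k + 2 * m) * d)%N by rewrite muln_gt0 d0 addn_gt0 muln_gt0 m0 orbT.
by rewrite mulr_gt0 ?flow_const_gt0// mulr_gt0 ?deriv_scale_gt0// ltr0n.
Qed.

(** The inequality on coefficients of a power, at every point, for the jet with the time
    rescaled by the square root of rho. *)
Lemma jet_coef1_le k d f (rho : R) : (0 < d)%N -> 0 <= rho ->
  rho ^+ k * E (flow f ^+ (2 * k)) <=
  \sum_(l < (d * k + d).+2) rho ^+ l * E ((jet d f ^+ k)`_l ^+ 2).
Proof.
move=> d0 r0; rewrite -EZ.
have -> : \sum_(l < (d * k + d).+2) rho ^+ l * E ((jet d f ^+ k)`_l ^+ 2) =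
  E (\sum_(l < (d * k + d).+2) rho ^+ l *: ((jet d f ^+ k)`_l ^+ 2)).
  by rewrite Esum; apply: eq_bigr => l _; rewrite EZ.
apply: mean_le => v; pose r := Num.sqrt rho.
have r2 : r ^+ 2 = rho by rewrite sqr_sqrtr.
pose Q : {poly R} := map_poly (meval v) (jet d f) \Po (r *: 'X).
have comp (p : {poly R}) i : (p \Po (r *: 'X))`_i = r ^+ i * p`_i.
  elim/poly_ind: p i => [|p c IHp] i; first by rewrite comp_poly0 !coef0 mulr0.
  rewrite comp_poly_MXaddC !coefD coefC -scalerAr coefZ !coefMX.
  case: i => [|i] /=; first by rewrite expr0 mul1r mulr0.
  by rewrite IHp !addr0 exprS mulrA.
have sJ : (size (map_poly (meval v) (jet d f)) <= d.+1)%N.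
  by apply: leq_trans (size_poly _ _) (size_poly _ _).
have sQ : (size Q <= d.+1)%N.
  apply: leq_trans sJ; apply/leq_sizeP => i hi.
  by rewrite comp nth_default ?mulr0.
have QX : Q ^+ k = map_poly (meval v) (jet d f ^+ k) \Po (r *: 'X) by rewrite !rmorphXn.
have sQ2 : (size Q <= (d * k + d).+2)%N.
  by apply: (leq_trans sQ); rewrite ltnS ltnW// ltnS leq_addl.
have sQk : (size (Q ^+ k) <= (d * k + d).+2)%N.
  apply: (leq_trans (size_poly_exp_leq _ _)); rewrite ltnS ltnW// ltnS.
  apply: leq_trans (leq_addr _ _); rewrite leq_mul2r; apply/orP; right.
  by case: (size Q) sQ.
have := @real_coef1_pow_le R Q (d * k + d).+2 k isT sQ2 sQk.
rewrite /Q comp coef_map expr1 /jet coef_poly ltnS d0 divided_flow1 exprMn mevalZ mevalXn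
  exprM r2.
move=> /le_trans; apply; rewrite raddf_sum /=; apply: ler_sum => l _.
by rewrite -/Q QX comp coef_map exprMn mevalZ mevalXn -exprM mulnC exprM r2.
Qed.

(** Choose rho so that the l-th term is at most 2^(-l) E f^(2k). *)
Lemma mean_flow_pow_le k d f : (0 < k)%N -> (0 < d)%N -> wdeg_le (fun=> 1%N) d f ->
  wdeg_le pos_var d f -> wdeg_le mom_var 0 f ->
  E (flow f ^+ (2 * k)) <= 2 * (2 * (jet_const k * flow_rate k d)) ^+ k * E (f ^+ (2 * k)).
Proof.
move=> k0 d0 ht hd he; set A := jet_const k * flow_rate k d.
have A0 : 0 < A.
  by rewrite mulr_gt0 ?flow_rate_gt0// (lt_le_trans ltr01)// jet_const_ge1.
have A2 : 0 < (2 * A) ^+ k by rewrite exprn_gt0// mulr_gt0.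
have F0 : 0 <= E (f ^+ (2 * k)) by rewrite mulnC exprM mean_sq_ge0.
rewrite [2 * _ ^+ k]mulrC -mulrA -ler_pdivrMl// -exprVn.
apply: (le_trans (jet_coef1_le k f d0 _)); first by rewrite invr_ge0 mulr_ge0 ?ltW.
apply: (le_trans _ (ler_wpM2r F0 (half_geometric_le R (d * k + d).+2))).
rewrite mulr_suml; apply: ler_sum => l _.
apply: (@le_trans _ _ ((2 * A)^-1 ^+ l * (A ^+ l * E (f ^+ (2 * k))))).
  rewrite ler_wpM2l ?mean_jetX_le// exprn_ge0// invr_ge0 mulr_ge0 ?ltW//.
by rewrite mulrA -exprMn invfM -mulrA mulVf ?mulr1// gt_eqF.
Qed.

(** * Averaging over the momenta *)

Section velocity_jensen.
Variable f : T.
Hypothesis f_pos : forall i, mderiv (yi i) f = 0.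

Lemma wdeg_mom0 : wdeg_le mom_var 0 f.
Proof.
move=> u uf; rewrite big1// => l _; rewrite /mom_var.
by case: imsetP => [[i _ ->]|_]; rewrite ?mul0n// (mderiv0_msupp (f_pos i) uf) muln0.
Qed.

Lemma flow_posE : flow f = \sum_(i < n) potential' (yi i) * mderiv (xi i) f.
Proof. by rewrite flowE; apply: eq_bigr => i _; rewrite f_pos mulr0 subr0. Qed.

(** M(W''). *)
Definition curvature : R := M ((2 * m)%:R *: ((2 * m).-1%:R *: 'X^(2 * m - 2))).

Lemma curvature_gt0 : 0 < curvature.
Proof.
rewrite /curvature !MZ (_ : (2 * m - 2 = m.-1 * 2)%N); last by rewrite -subn1 mulnBl mulnC.
have m2 : 0 < (2 * m)%:R :> R by rewrite ltr0n muln_gt0.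
have m3 : 0 < (2 * m).-1%:R :> R by rewrite ltr0n; case: (m) m0 => // p _; rewrite mulnS.
rewrite mulr_gt0// mulr_gt0// exprM; apply: (functional_sq_gt0 HM).
by rewrite expf_neq0// polyX_eq0.
Qed.

(** Integrate by parts in y_i: two distinct momenta contribute nothing, and a repeated
    one contributes the factor W''(y_i), which is independent of h. *)
Lemma mean_velocity_cross (h : T) i l : (forall j, mderiv (yi j) h = 0) ->
  E (h * (potential' (yi i) * potential' (yi l))) = (i == l)%:R * (curvature * E h).
Proof.
move=> dh; rewrite mulrC -mulrA -mean_ibp mderivM dh mulr0 addr0 mderiv_potential'.
rewrite (inj_eq yi_inj) -!scalerAl EZ.
case: eqP => _; last by rewrite !mul0r.
by rewrite !mul1r EZ -polyvXn mean_tensor// /curvature !MZ !mulrA.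
Qed.

(** Conditional Jensen in the momenta: the conditional mean of (D f)^2 is
    c |grad f|^2.  Use the tangent at this value; the first order term has mean zero. *)
Lemma mean_grad_pow_le k : (0 < k)%N ->
  curvature ^+ k * E ((\sum_(i < n) mderiv (xi i) f ^+ 2) ^+ k) <= E (flow f ^+ (2 * k)).
Proof.
move=> k0; set g := \sum_(i < n) _; have c0 := curvature_gt0.
have dg i : mderiv (yi i) g = 0.
  rewrite /g raddf_sum big1// => l _; apply: mderivX_eq0.
  by rewrite mderiv_comm f_pos mderiv0.
have dfx j i : mderiv (yi j) (mderiv (xi i) f) = 0.
  by rewrite mderiv_comm f_pos mderiv0.
have key : E (g ^+ k.-1 * (flow f ^+ 2 - curvature *: g)) = 0.
  rewrite mulrBr linearB /= -scalerAr EZ.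
  have -> : E (g ^+ k.-1 * flow f ^+ 2) =
    \sum_(i < n) curvature * E (g ^+ k.-1 * mderiv (xi i) f ^+ 2).
    rewrite flow_posE expr2 mulr_suml mulr_sumr Esum; apply: eq_bigr => i _.
    rewrite mulr_sumr mulr_sumr Esum (bigD1 i)//= big1 ?addr0.
      rewrite (_ : _ * _ =
        (g ^+ k.-1 * mderiv (xi i) f ^+ 2) * (potential' (yi i) * potential' (yi i))).
        rewrite mean_velocity_cross ?eqxx ?mul1r// => j.
        rewrite mderivM mderivX_eq0 ?dg// mul0r add0r mderivX_eq0 ?mulr0//.
      by ring.
    move=> l li.
    rewrite (_ : _ * _ =
      (g ^+ k.-1 * (mderiv (xi i) f * mderiv (xi l) f)) *
      (potential' (yi i) * potential' (yi l))).
      rewrite mean_velocity_cross.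
        by rewrite eq_sym (negbTE li) mul0r.
      move=> j; rewrite mderivM mderivX_eq0 ?dg// mul0r add0r mderivM.
      by rewrite !dfx mulr0 mul0r addr0 mulr0.
    by ring.
  by rewrite -mulr_sumr -Esum -mulr_sumr -/g subrr.
have -> : curvature ^+ k * E (g ^+ k) = E ((curvature *: g) ^+ k +
    (k%:R * curvature ^+ k.-1) *: (g ^+ k.-1 * (flow f ^+ 2 - curvature *: g))).
  by rewrite ED EZ key mulr0 addr0 exprZn EZ.
apply: mean_le => v; have gv : 0 <= meval v g.
  by rewrite /g raddf_sum sumr_ge0// => i _ /=; rewrite mevalXn sqr_ge0.
rewrite exprM; move: (flow f) => a; rewrite !(mevalD, mevalN, mevalZ, mevalXn, mevalM).
have cg : 0 <= curvature * meval v g by rewrite mulr_ge0// ltW.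
have := @tangent_pow R (meval v a ^+ 2) _ k (sqr_ge0 _) cg.
by rewrite [(_ * _) ^+ k.-1]exprMn !mulrA.
Qed.

Lemma mean_grad_pos_le d k : (0 < k)%N -> (0 < d)%N -> wdeg_le (fun=> 1%N) d f ->
  curvature ^+ k * E ((\sum_(i < n) mderiv (xi i) f ^+ 2) ^+ k) <=
  2 * (2 * (jet_const k * flow_rate k d)) ^+ k * E (f ^+ (2 * k)).
Proof.
move=> k0 d0 ht; apply: (le_trans (mean_grad_pow_le k0)).
apply: mean_flow_pow_le => //; last exact: wdeg_mom0.
move=> u uf; apply: leq_trans (ht u uf); apply: leq_sum => i _.
by case: (pos_var i).
Qed.

End velocity_jensen.
End phase_space.
End product_mean.

(** * Doubling the variables *)

Section doubling.
Context (R : realType) (n : nat).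

Definition embed_mnm (u : multinom n) : multinom (n + n) :=
  Multinom [tuple match fintype.split l with inl i => u i | inr _ => 0%N end | l < n + n].

Lemma embed_mnm_l u i : embed_mnm u (lshift n i) = u i.
Proof. by rewrite mnmE (unsplitK (inl i)). Qed.

Lemma embed_mnm_r u i : embed_mnm u (rshift n i) = 0%N.
Proof. by rewrite mnmE (unsplitK (inr i)). Qed.

(** Views a polynomial in the positions as one in positions and momenta. *)
Definition embed : mpoly n R -> mpoly (n + n) R :=
  comp_mpoly [tuple mpolyX R (mnm1 (lshift n i)) | i < n].
HB.instance Definition _ := GRing.LRMorphism.copy embed
  (comp_mpoly [tuple mpolyX R (mnm1 (lshift n i)) | i < n]).

Lemma embedZ c f : embed (c *: f) = c *: embed f.
Proof. exact: comp_mpolyZ. Qed.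

Lemma embedX u : embed (mpolyX R u) = mpolyX R (embed_mnm u).
Proof.
rewrite /embed comp_mpolyX [RHS]mpolyXE_id big_split_ord /= [X in _ = _ * X]big1 ?mulr1.
  by apply: eq_bigr => i _; rewrite tnth_mktuple embed_mnm_l.
by move=> i _; rewrite embed_mnm_r expr0.
Qed.

Lemma embedE f : embed f = \sum_(u <- msupp f) mcoeff u f *: mpolyX R (embed_mnm u).
Proof.
rewrite {1}(mpolyE f) raddf_sum; apply: eq_bigr => u _ /=.
by rewrite embedZ embedX.
Qed.

Lemma mderiv_embed_l i f : mderiv (lshift n i) (embed f) = embed (mderiv i f).
Proof.
rewrite embedE [in RHS](mpolyE f) raddf_sum [mderiv i _]raddf_sum [RHS]raddf_sum.
apply: eq_bigr => u _ /=.
rewrite !mderivZ [RHS]embedZ !mderivX [X in _ = _ *: X]embedZ embedX embed_mnm_l.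
congr (_ *: (_ *: mpolyX _ _)); apply/mnmP => l; rewrite mnmBE mnm1E.
case: (split_ordP l) => j ->.
  by rewrite !embed_mnm_l mnmBE mnm1E (inj_eq (@lshift_inj _ _)).
by rewrite !embed_mnm_r.
Qed.

Lemma mderiv_embed_r i f : mderiv (rshift n i) (embed f) = 0.
Proof.
rewrite embedE raddf_sum big1// => u _ /=.
by rewrite mderivZ mderivX embed_mnm_r scale0r scaler0.
Qed.

Lemma wdeg_embed d f : wdeg_le (fun=> 1%N) d f -> wdeg_le (fun=> 1%N) d (embed f).
Proof.
move=> hf; rewrite embedE big_seq; apply: wdeg_le_sum => u uf; apply: wdeg_leZ.
move=> u' /mem_msuppXP <-; apply: leq_trans (hf u uf).
rewrite big_split_ord /= [X in (_ + X)%N]big1 ?addn0; last first.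
  by move=> i _; rewrite embed_mnm_r.
by apply: leq_sum => i _; rewrite embed_mnm_l.
Qed.

Context (m : nat) (M : {linear {poly R} -> R | *%R}) (HM : freud_functional m M).
Context (E : {linear mpoly n R -> R | *%R}) (E2 : {linear mpoly (n + n) R -> R | *%R}).
Hypotheses (HE : product_mean M E) (HE2 : product_mean M E2).

Lemma mean_embed f : E2 (embed f) = E f.
Proof.
rewrite embedE [in RHS](mpolyE f) !linear_sum /=; apply: eq_bigr => u _.
rewrite 2!linearZ /=; congr (_ * _).
have [h _] := HE; have [h2 _] := HE2; have [M1 _ _] := HM.
rewrite h h2 big_split_ord /= [X in _ * X]big1 ?mulr1.
  by apply: eq_bigr => i _; rewrite embed_mnm_l.
by move=> i _; rewrite embed_mnm_r expr0 M1.
Qed.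

Lemma mean_bernstein (m0 : (0 < m)%N) d k f : (0 < k)%N -> (0 < d)%N ->
  wdeg_le (fun=> 1%N) d f ->
  curvature m M ^+ k * E ((\sum_(i < n) mderiv i f ^+ 2) ^+ k) <=
  2 * (2 * (jet_const R m k * flow_rate R m k d)) ^+ k * E (f ^+ (2 * k)).
Proof.
move=> k0 d0 hf; rewrite -!mean_embed 2!rmorphXn rmorph_sum /=.
under eq_bigr do rewrite rmorphXn /= -mderiv_embed_l.
apply: (@mean_grad_pos_le R m m0 M HM _ E2 HE2 n (lshift n) (@rshift n n)) => //.
- exact: lshift_inj.
- exact: rshift_inj.
- by move=> i l; rewrite eq_lrshift.
- by move=> i; exact: mderiv_embed_r.
- exact: wdeg_embed.
Qed.

End doubling.

(** The rate has the order of d^(2-1/m), the square of the Bernstein factor. *)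
Lemma flow_rateE R m k d (m0 : (0 < m)%N) : flow_rate R m k d =
  flow_const R m * (freud_scale R m (k + 2 * m) ^+ (2 * m).-1) ^+ 2 *
    (freud_scale R m d ^+ (2 * m).-1) ^+ 2.
Proof.
rewrite /flow_rate -mulrA -exprMn -exprMn -freud_scaleM; congr (_ * _).
rewrite -(freud_scaleX R m0) /deriv_scale -exprD -exprM; congr (_ ^+ _).
by case: (m) m0 => // p _; rewrite mulnS addKn /= muln2 -addnn addnS -addSn.
Qed.

(** * The inequality for Freud measures *)

Section freud_instance.
Context (R : realType) (m : nat) (m0 : (0 < m)%N).

Lemma freud_functional_mean1 : freud_functional m (freud_mean1 R m0).
Proof.
have E1 j : freud_mean1 R m0 'X^j = freud_moment R m j by exact: freud_expect1Xn.
have E0 (p : {poly R}) : (forall t, 0 <= p.[t]) -> 0 <= freud_mean1 R m0 p.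
  exact: freud_expect1_ge0.
split => //; first by rewrite -(expr0 'X) E1 freud_moment0.
move: (freud_mean1 R m0) E1 {E0} => M E1 p.
rewrite -[p]coefK poly_def [deriv _]raddf_sum mulr_sumr !linear_sum mulr_sumr /=.
apply: eq_bigr => j _; rewrite derivZ -scalerAr !linearZ /= mulrCA; congr (_ * _).
by rewrite -exprD addnC E1 freud_moment_rec// derivXn raddfMn /= E1 mulr_natl.
Qed.

Lemma freud_product_mean n : product_mean (freud_mean1 R m0) (freud_mean R m0 n).
Proof.
split; last by move=> f; exact: freud_expect_ge0.
move=> u; rewrite [LHS](freud_expectX R m0 u); apply: eq_bigr => i _.
by rewrite [RHS]freud_expect1Xn.
Qed.

(** Turns norms of even exponent into means of polynomials, to which the algebraic
    estimate applies. *)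
Lemma Lnorm_even n k (F : n.-tuple R -> R) (h : mpoly n R) : (0 < k)%N ->
  (forall x, F x ^+ (2 * k) = poly_fun h x) ->
  Lnorm (power_measure (freud_measure R m) n) (2 * k)%:R%:E (fun x => (F x)%:E) =
  (freud_mean R m0 n h `^ (2 * k)%:R^-1)%:E.
Proof.
move=> k0 hF; rewrite unlock /=; set I := (\int[_]_x _)%E.
have {I}-> : I = (freud_mean R m0 n h)%:E.
  have hI := fineK (integrable_fin_num measurableT (integrable_poly_fun m0 h)).
  apply: etrans (esym hI); apply: eq_integral => x _; congr EFin.
  by rewrite powR_mulrn// -hF !exprM real_normK ?num_real.
by rewrite poweR_EFin.
Qed.

Lemma wdeg_of_degree n d (f : mpoly n R) : degree_le d f -> wdeg_le (fun=> 1%N) d f.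
Proof.
move=> fd u /msize_mdeg_lt uf; rewrite -ltnS; apply: leq_trans fd.
by rewrite mdegE in uf; under eq_bigr do rewrite mul1n.
Qed.

Lemma freud_scale_powR d : freud_scale R m d ^+ (2 * m).-1 = d%:R `^ (1 - (2 * m)%:R^-1).
Proof.
have m2 : (2 * m)%:R != 0 :> R by rewrite pnatr_eq0 muln_eq0 /= -lt0n.
rewrite /freud_scale -powR_mulrn ?powR_ge0// -powRrM; congr (_ `^ _).
have -> : (2 * m).-1%:R = (2 * m)%:R - 1 :> R.
  by rewrite -subn1 natrB// muln_gt0.
by rewrite mulrBr mulr1 mulVf.
Qed.

(** The constant collects the radius of the circle, the curvature and the loss of the
    crude bound; none of them depends on n or d. *)
Lemma mean_bernstein_freud k : (0 < k)%N -> exists C : R, 0 < C /\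
  forall n d (f : mpoly n R), (0 < d)%N -> wdeg_le (fun=> 1%N) d f ->
  freud_mean R m0 n ((\sum_(i < n) mderiv i f ^+ 2) ^+ k) <=
  (C * freud_scale R m d ^+ (2 * m).-1) ^+ (2 * k) * freud_mean R m0 n (f ^+ (2 * k)).
Proof.
move=> k0; pose c := curvature m (freud_mean1 R m0).
have HM := freud_functional_mean1.
have c0 : 0 < c by exact: curvature_gt0.
pose s0 : R := freud_scale R m (k + 2 * m) ^+ (2 * m).-1.
have s0p : 0 < s0 by rewrite exprn_gt0// freud_scale_gt0// addn_gt0 k0.
pose D : R := 2 * (2 * (jet_const R m k * (flow_const R m * s0 ^+ 2)) / c) ^+ k.
have J0 : 0 < jet_const R m k by rewrite (lt_le_trans ltr01)// jet_const_ge1.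
have F0 : 0 < flow_const R m by exact: flow_const_gt0.
have D0 : 0 < D.
  have s2 : 0 < s0 ^+ 2 by rewrite exprn_gt0.
  have ci : 0 < c^-1 by rewrite invr_gt0.
  by rewrite mulr_gt0// exprn_gt0// mulr_gt0// mulr_gt0// mulr_gt0// mulr_gt0.
exists (D `^ (2 * k)%:R^-1); split; first exact: powR_gt0.
move=> n d f d0 hf.
have k2 : (2 * k)%:R != 0 :> R by rewrite pnatr_eq0 muln_eq0 /= -lt0n.
have DX : (D `^ (2 * k)%:R^-1) ^+ (2 * k) = D.
  by rewrite -powR_mulrn ?powR_ge0// -powRrM mulVf// powRr1// ltW.
have := @mean_bernstein R n m _ HM _ _ (freud_product_mean n) (freud_product_mean (n + n)) m0
  d k f k0 d0 hf.
rewrite -/c -ler_pdivlMl ?exprn_gt0// => /le_trans; apply.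
rewrite [(D `^ _ * _) ^+ _]exprMn DX (flow_rateE R k d m0) -/s0 [leLHS]mulrA.
rewrite le_eqVlt; apply/orP; left; apply/eqP; congr (_ * _).
rewrite /D [X in _ = _ * X]exprM mulrCA -[RHS]mulrA; congr (_ * _).
by rewrite -exprVn -!exprMn; congr (_ ^+ _); ring.
Qed.

End freud_instance.

Theorem theorem1p8 (R : realType) (m k : nat) (hm : (0 < m)%N) (hk : (0 < k)%N) :
  exists C : R, 0 < C /\
    forall (n d : nat), (0 < n)%N -> (0 < d)%N ->
    forall f : mpoly.mpoly n R, degree_le d f ->
      (Lnorm (power_measure (freud_measure R m) n) (2 * k)%:R%:E
         (fun x => (grad_length f x)%:E)
       <= (C * d%:R `^ (1 - (2 * m)%:R^-1))%:E *
          Lnorm (power_measure (freud_measure R m) n) (2 * k)%:R%:E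
            (fun x => (poly_fun f x)%:E))%E.
Proof.
have [C [C0 hC]] := mean_bernstein_freud R hm hk.
exists C; split=> // n d _ d0 f /wdeg_of_degree fd.
rewrite (@Lnorm_even _ _ hm _ _ _ ((\sum_(i < n) mderiv i f ^+ 2) ^+ k) hk); last first.
  move=> x; have S0 : 0 <= \sum_(i < n) poly_fun (mderiv i f) x ^+ 2.
    by rewrite sumr_ge0// => i _; rewrite sqr_ge0.
  rewrite /grad_length exprM sqr_sqrtr// /poly_fun rmorphXn rmorph_sum /=.
  by congr (_ ^+ _); apply: eq_bigr => i _; rewrite rmorphXn.
rewrite (@Lnorm_even _ _ hm _ _ _ (f ^+ (2 * k)) hk); last first.
  by move=> x; rewrite /poly_fun rmorphXn.
rewrite -EFinM lee_fin -(freud_scale_powR R hm).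
set a := C * _; set A := freud_mean _ _ _ _; set B := freud_mean _ _ _ _.
have a0 : 0 <= a by rewrite mulr_ge0 ?ltW// exprn_gt0// freud_scale_gt0.
have AB : A <= a ^+ (2 * k) * B by exact: hC.
have A0 : 0 <= A.
  apply: freud_expect_ge0 => v; rewrite rmorphXn exprn_ge0// rmorph_sum sumr_ge0// => i _.
  by rewrite /= rmorphXn sqr_ge0.
have B0 : 0 <= B.
  by apply: freud_expect_ge0 => v; rewrite rmorphXn exprM exprn_ge0// sqr_ge0.
have k2 : (2 * k)%:R != 0 :> R by rewrite pnatr_eq0 muln_eq0 /= -lt0n.
have -> : a * B `^ (2 * k)%:R^-1 = (a ^+ (2 * k) * B) `^ (2 * k)%:R^-1.
  by rewrite powRM ?exprn_ge0// -powR_mulrn// -powRrM divff// powRr1.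
by rewrite ge0_ler_powR ?invr_ge0 ?nnegrE// mulr_ge0// exprn_ge0.
Qed.
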